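(* Let $K$ be a field, let $n\ge 1$ and $d$ be natural numbers, and let $\Lambda\subseteq K[X_1,\ldots,X_n]$ be a set of polynomials each of total degree at most $d$. If the ideal $(\Lambda)$ of $K[X_1,\ldots,X_n]$ is prime up to $\mathfrak{p}_n(d)$, then $(\Lambda)$ is prime, i.e. for all $f,g\in K[X_1,\ldots,X_n]$ (of arbitrary degree) with $fg\in(\Lambda)$, either $f\in(\Lambda)$ or $g\in(\Lambda)$.
   Context: An ideal $I\subseteq K[X_1,\ldots,X_n]$ is \emph{prime up to $b$} if whenever $fg\in I$ with $f,g\in K[X_1,\ldots,X_n]$ of total degree at most $b$, either $f\in I$ or $g\in I$. The function $\mathfrak{p}_n$ is defined through the following functions of natural numbers: - $\mathfrak{d}_n(b)=(2b)^{2^n}$; - $\mathfrak{e}(n,b)=2^{(b+\mathfrak{d}_{n-1}(b))^{n-1}+1}\,b+b+\mathfrak{d}_{n-1}(b)$; - $\zeta_0(n,d)=\binom{n+\mathfrak{d}_n(d)}{n}$; - $\zeta_1(n,d,b)=\left(\binom{b+n}{n}+2\right)\zeta_0(n,d)$; - $\zeta_2(n,d,b)=(\zeta_1(n,d,b)+1)^{2^{\zeta_1(n,d,b)}-1}$; - $\mathfrak{p}_1(d)=d$, and for $n\ge 2$, with $\upsilon(n,d)=\zeta_1(n-1,\mathfrak{p}_{n-1}(d),d)\,\zeta_2(n-1,\mathfrak{p}_{n-1}(d),d)$, $$\mathfrak{p}_n(d)=\max\left\{2\binom{\upsilon(n,d)+n}{n}\upsilon(n,d),\ \mathfrak{e}(n-1,d)\right\}.$$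 *)

(* Defs.v *)
From HB Require Import structures.
From mathcomp Require Import all_boot all_order all_algebra.
From mathcomp Require Import mpoly.

Set Implicit Arguments.
Unset Strict Implicit.
Unset Printing Implicit Defensive.

Definition frakd (n b : nat) : nat := (2 * b) ^ (2 ^ n).

(* Only meaningful for [0 < n]. *)
Definition frake (n b : nat) : nat :=
  2 ^ ((b + frakd n.-1 b) ^ n.-1 + 1) * b + b + frakd n.-1 b.

Definition zeta0 (n d : nat) : nat := 'C(n + frakd n d, n).

Definition zeta1 (n d b : nat) : nat := ('C(b + n, n) + 2) * zeta0 n d.

Definition zeta2 (n d b : nat) : nat :=
  (zeta1 n d b + 1) ^ (2 ^ zeta1 n d b - 1).

(* The value at [n = 0] is a dummy; in the last case [m] is [n - 1]. *)
Fixpoint frakp (n d : nat) : nat :=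
  match n with
  | 0 => 0
  | 1 => d
  | m.+1 =>
      let u := zeta1 m (frakp m d) d * zeta2 m (frakp m d) d in
      maxn (2 * 'C(u + n, n) * u) (frake m d)
  end.

Import GRing.Theory.
Local Open Scope ring_scope.

Section Ideals.
Context {R : comNzRingType} {n : nat}.
Implicit Types (L I : {mpoly R[n]} -> Prop) (f g : {mpoly R[n]}) (b : nat).

(* [msize f] is one plus the total degree of [f], and [msize 0 = 0]. *)
Definition tdeg_le f b : Prop := (msize f <= b.+1)%N.

Definition ideal_gen L f : Prop :=
  exists s : seq ({mpoly R[n]} * {mpoly R[n]}),
    (forall c, c \in s -> L c.2) /\ f = \sum_(c <- s) c.1 * c.2.

Definition prime_upto I b : Prop :=
  forall f g, tdeg_le f b -> tdeg_le g b -> I (f * g) -> I f \/ I g.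

(* Properness is not required: the unit ideal counts as prime. *)
Definition prime_ideal I : Prop := forall f g, I (f * g) -> I f \/ I g.

End Ideals.

(* Main.v *)
(* Let I = (Lambda) be proper. A rapidly growing chain of degree thresholds yields
   variables u_1, ..., u_r that are independent modulo I up to a large degree T,
   whereas every variable x_i satisfies modulo I a relation over P = K[u] of much
   smaller degree. Hence, up to a denominator outside I, a box of monomials spans
   K[X] over P modulo I, and the determinant trick gives a polynomial F with
   F(sum_i x_i U_i) in I[U]. Replacing x_i by x_i^q, with q a power of the
   characteristic exponent, F may be replaced by a prime factor Phi with
   Phi' <> 0: bounded primality selects the factor, minimality of the degree makes
   it separable. Differentiating in U_i gives x_i^q = - (d_i Phi / Phi')(theta)
   modulo I, so x_i |-> - d_i Phi / Phi' defines the residue field of a prime ideal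
   (Phi divides the numerator of f) that contains Lambda and all of whose elements
   have their q-th power in I.

   It remains to take q-th roots modulo I. On combinations of box monomials the
   condition that Phi divides the numerator is a linear system over P (rewrite the
   q-th powers in a basis of K over K^q), whose solutions are generated in bounded
   degree by Cramer's rule up to a nonzero multiplier; bounded primality handles
   these generators. Multipliers and denominators are cancelled because, by
   Hermann's bound, a polynomial of bounded degree outside I is not a zero divisor
   modulo I. All degrees involved stay below p_n(d). *)

Require Import Defs.
From HB Require Import structures.
From mathcomp Require Import all_boot all_order all_algebra.
From mathcomp Require Import mpoly.
From Stdlib Require Import Classical.
From mathcomp Require Import zify ring.

Set Implicit Arguments.
Unset Strict Implicit.
Unset Printing Implicit Defensive.

Import GRing.Theory Pdiv.Idomain.
Local Open Scope ring_scope.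

(** * Unique factorization *)

(** The ring K[X]/I is not known to be a domain, so it has no fraction field to work in.
    Factorization, division and elimination are therefore carried out over P[U], which is factorial,
    and conclusions pass to I through three degree budgets: [T] (elements of P in I of degree at
    most [T] vanish), [D] (elements outside I of degree at most [D] are not zero divisors modulo I)
    and [B] (bounded primality). The generic form sum_i x_i U_i stands in for a primitive element:
    it needs no choice of coefficients in K, which may be finite, and its derivatives in the U_i
    return the coordinates. Inseparability is the main obstacle: the x_i need not be rational in the
    generic form, only some x_i^q are, so the prime ideal obtained determines I only up to q-th
    roots. A threshold is raised to the power 3n+5 at each of n+1 steps, and Hermann's bound raises
    the last one to a power of at most 2^(n^2+1); this doubly exponential quantity is exceeded by
    the [zeta2] in p_n(d) from n = 2 on, and n = 1 is settled by gcds. *)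

Lemma classic_min (P : nat -> Prop) :
  (exists k, P k) -> exists2 k, P k & forall j, (j < k)%N -> ~ P j.
Proof.
case=> k; have [m] := ubnP k; elim: m k => // m IH k; rewrite ltnS => lekm Pk.
have [[j ltjk Pj]|none] := classic (exists2 j, (j < k)%N & P j).
  exact: IH (leq_trans ltjk lekm) Pj.
by exists k => // j ltjk Pj; apply: none; exists j.
Qed.

Section Factoriality.
Variable D : idomainType.
Implicit Types (a b p u : D) (s : seq D).

Definition dvdr a b := exists c, b = c * a.
Definition primer p :=
  [/\ p != 0, p \isn't a GRing.unit
    & forall a b, dvdr p (a * b) -> dvdr p a \/ dvdr p b].
Definition prime_seq s := forall p, p \in s -> primer p.
Definition ufd_factors a := exists s, prime_seq s /\
  exists2 u, u \is a GRing.unit & a = u * \prod_(p <- s) p.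
Definition ufd := forall a, a != 0 -> ufd_factors a.

Lemma dvdr_mull a b c : dvdr a b -> dvdr a (c * b).
Proof. by case=> d ->; exists (c * d); rewrite mulrA. Qed.

Lemma dvdr_mulr a b c : dvdr a b -> dvdr a (b * c).
Proof. by rewrite mulrC; apply: dvdr_mull. Qed.

Lemma dvdrD a b c : dvdr a b -> dvdr a c -> dvdr a (b + c).
Proof. by case=> x -> [y ->]; exists (x + y); rewrite mulrDl. Qed.

Lemma dvdrN a b : dvdr a b -> dvdr a (- b).
Proof. by case=> x ->; exists (- x); rewrite mulNr. Qed.

Lemma dvdr_sum (I : Type) (r : seq I) (P : pred I) (F : I -> D) a :
  (forall i, P i -> dvdr a (F i)) -> dvdr a (\sum_(i <- r | P i) F i).
Proof.
move=> H; elim/big_rec: _ => [|i x Pi IH]; first by exists 0; rewrite mul0r.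
by apply: dvdrD IH; apply: H.
Qed.

Lemma primer_ndvd_unit p u : primer p -> u \is a GRing.unit -> ~ dvdr p u.
Proof.
case=> _ np _ Uu [c Eu]; move: Uu; rewrite Eu unitrM => /andP[_].
by rewrite (negPf np).
Qed.

Lemma primer_dvd_prod p s :
  primer p -> dvdr p (\prod_(x <- s) x) -> exists2 x, x \in s & dvdr p x.
Proof.
move=> pp; elim: s => [|x s IH]; first by rewrite big_nil => /(primer_ndvd_unit pp (unitr1 _)).
rewrite big_cons; case: (pp) => _ _ h /h[pdx|/IH[y ys pdy]].
  by exists x; rewrite ?mem_head.
by exists y; rewrite // in_cons ys orbT.
Qed.

Lemma prime_seq_cat s t : prime_seq s -> prime_seq t -> prime_seq (s ++ t).
Proof. by move=> Hs Ht p; rewrite mem_cat => /orP[/Hs|/Ht]. Qed.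

Lemma prime_seq_rem s x : prime_seq s -> prime_seq (rem x s).
Proof. by move=> Hs p /mem_rem; apply: Hs. Qed.

Lemma primer_assoc p q : primer p -> primer q -> dvdr p q ->
  exists2 u, u \is a GRing.unit & q = u * p.
Proof.
case=> p0 np _ [q0 _ hq] [c Eq].
have [[e Ec]|[e Ee]] := hq c p (ex_intro _ 1 (esym (etrans (mul1r q) Eq))).
  have E1 : e * p = 1 by apply: (mulIf q0); rewrite mul1r [in RHS]Eq Ec; ring.
  by move: np; have : e * p \is a GRing.unit by [rewrite E1 unitr1]; rewrite unitrM => /andP[_ ->].
have E1 : e * c = 1 by apply: (mulIf p0); rewrite mul1r [in RHS]Ee Eq; ring.
by exists c => //; have : e * c \is a GRing.unit by [rewrite E1 unitr1]; rewrite unitrM => /andP[].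
Qed.

Lemma ufd_factors_mul a b : ufd_factors a -> ufd_factors b -> ufd_factors (a * b).
Proof.
move=> [s [Hs [u Uu ->]]] [t [Ht [v Uv ->]]]; exists (s ++ t).
split; first exact: prime_seq_cat.
by exists (u * v); rewrite ?unitrM ?Uu // big_cat /= mulrACA.
Qed.

End Factoriality.

Section FactorialityPoly.
Variable D : idomainType.
Implicit Types (F G H : {poly D}) (p : D).

Lemma scale_polyI (c : D) F G : c != 0 -> c *: F = c *: G -> F = G.
Proof. by move=> c0; rewrite -!mul_polyC; apply: mulfI; rewrite polyC_eq0. Qed.

Lemma dvdr_polyC p F : dvdr p%:P F <-> forall i, dvdr p F`_i.
Proof.
split=> [[G ->] i|H]; first by exists G`_i; rewrite coefMC.
have [c Hc] : exists c : nat -> D, forall i, (i < size F)%N -> F`_i = c i * p.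
  elim: (size F) => [|k [c Hc]]; first by exists (fun _ => 0).
  have [d Hd] := H k; exists (fun i => if i == k then d else c i) => i.
  by rewrite ltnS leq_eqVlt; case: eqP => [->//|_] /= /Hc.
exists (\poly_(i < size F) c i); apply/polyP=> i; rewrite coefMC coef_poly.
by case: ltnP => [/Hc//|h]; rewrite mul0r nth_default.
Qed.

Lemma ndvdr_polyC_min p F : ~ dvdr p%:P F ->
  exists2 i, ~ dvdr p F`_i & forall j, (j < i)%N -> dvdr p F`_j.
Proof.
move=> nd; have /classic_min[i Hi Hm] : exists i, ~ dvdr p F`_i.
  by apply: NNPP => h; apply: nd; apply/dvdr_polyC=> i; apply: NNPP => h2; apply: h; exists i.
by exists i => // j /Hm /NNPP.
Qed.

(** Gauss's lemma: take the first coefficients of F and G that p does not divide; in the coefficient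
    of F G at the sum of their indices, every other term is divisible by p. *)
Lemma primer_polyC p : primer p -> primer p%:P.
Proof.
case=> p0 np hp; split; rewrite ?polyC_eq0 //.
  by rewrite poly_unitE coefC eqxx (negPf np) andbF.
move=> F G pFG; apply: NNPP => /not_or_and[/ndvdr_polyC_min[i nFi Fi] /ndvdr_polyC_min[j nGj Gj]].
have /dvdr_polyC/(_ (i + j)%N) := pFG.
have lti : (i < (i + j).+1)%N by rewrite ltnS leq_addr.
rewrite coefM (bigD1 (Ordinal lti)) //= addKn => h.
have {}h : dvdr p (F`_i * G`_j).
  set S := \sum_(_ < _ | _) _ in h.
  have -> : F`_i * G`_j = F`_i * G`_j + S - S by rewrite addrK.
  apply: dvdrD => //; apply: dvdrN; apply: dvdr_sum => k nk.
  have : (k < i)%N || (k > i)%N by move: nk; rewrite -val_eqE /= neq_ltn.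
  case/orP=> hk; first by apply: dvdr_mulr; apply: Fi.
  by apply: dvdr_mull; apply: Gj; have := ltn_ord k; lia.
by case: (hp _ _ h).
Qed.

(** Clears the denominator of a factorization over the fraction field: each prime of the scalar
    divides G or H by Gauss's lemma and is cancelled there without raising a size. *)
Lemma primer_clear s F G H u : prime_seq s -> u \is a GRing.unit ->
  (u * \prod_(p <- s) p) *: F = G * H ->
  exists G' H', [/\ F = G' * H', (size G' <= size G)%N & (size H' <= size H)%N].
Proof.
elim: s u G H => [|p s IH] u G H Hs Uu.
  rewrite big_nil mulr1 => E; exists (u^-1 *: G), H; split=> //; last exact: size_scale_leq.
  by rewrite -scalerAl -E scalerA mulVr // scale1r.
rewrite big_cons => E.
have pp : primer p by apply: Hs; rewrite mem_head.
have p0 : p != 0 by case: pp.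
have Hs' : prime_seq s by move=> q qs; apply: Hs; rewrite in_cons qs orbT.
have key G1 H1 : G * H = (G1 * p%:P) * H1 ->
    (u * \prod_(q <- s) q) *: F = G1 * H1.
  rewrite -E => E1; apply: (scale_polyI p0); rewrite scalerA.
  have -> : p * (u * \prod_(q <- s) q) = u * (p * \prod_(q <- s) q) by ring.
  by rewrite E1 -mul_polyC; ring.
have size1 G1 : (size G1 <= size (G1 * p%:P)%R)%N.
  by rewrite mulrC mul_polyC size_scale.
have : dvdr p%:P (G * H).
  by rewrite -E; exists ((u * \prod_(q <- s) q) *: F); rewrite [RHS]mulrC mul_polyC scalerA; congr (_ *: _); ring.
case: (primer_polyC pp) => _ _ hp /hp[[G1 EG]|[H1 EH]].
  have [|G' [H' [-> lG lH]]] := IH u G1 H Hs' Uu; first by apply: key; rewrite EG.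
  by exists G', H'; split=> //; apply: leq_trans lG _; rewrite EG.
have [|G' [H' [-> lG lH]]] := IH u G H1 Hs' Uu; first by apply: key; rewrite EH; ring.
by exists G', H'; split=> //; apply: leq_trans lH _; rewrite EH.
Qed.

Lemma primer_cancel s F G c u : prime_seq s -> u \is a GRing.unit ->
  (forall p, primer p -> ~ dvdr p%:P F) ->
  (u * \prod_(p <- s) p) *: c = F * G -> dvdr F c.
Proof.
elim: s u G => [|p s IH] u G Hs Uu prF.
  rewrite big_nil mulr1 => E; exists (u^-1 *: G).
  by rewrite -scalerAl mulrC -E scalerA mulVr // scale1r.
rewrite big_cons => E.
have pp : primer p by apply: Hs; rewrite mem_head.
have p0 : p != 0 by case: pp.
have : dvdr p%:P (F * G).
  by rewrite -E; exists ((u * \prod_(q <- s) q) *: c); rewrite [RHS]mulrC mul_polyC scalerA; congr (_ *: _); ring.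
case: (primer_polyC pp) => _ _ hp /hp[/prF[]//|[G1 EG]].
apply: (IH u G1) => //; first by move=> q qs; apply: Hs; rewrite in_cons qs orbT.
apply: (scale_polyI p0); rewrite scalerA.
have -> : p * (u * \prod_(q <- s) q) = u * (p * \prod_(q <- s) q) by ring.
by rewrite E EG -mul_polyC; ring.
Qed.

(* A primitive polynomial without proper factors over the fraction field is
   prime: pseudo-divisibility [%|] is divisibility over the fraction field. *)
Lemma primer_primitive F : ufd D -> (1 < size F)%N ->
  (forall p, primer p -> ~ dvdr p%:P F) ->
  (forall c G H, c != 0 -> c *: F = G * H ->
     ~~ ((size G < size F)%N && (size H < size F)%N)) ->
  primer F.
Proof.
move=> ufdD F1 prF irrF.
have F0 : F != 0 by rewrite -size_poly_gt0 ltnW.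
have dvdF G : F %| G -> dvdr F G.
  move=> /dvdpP[[c q] /= c0 E]; have [s [Hs [u Uu Ec]]] := ufdD c c0.
  by apply: (primer_cancel (G := q) (s := s) (u := u)); rewrite // -Ec E mulrC.
split=> //; first by rewrite poly_unitE; case: (size F) F1 => [|[]].
move=> A B [C E].
have FAB : F %| A * B by apply/dvdpP; exists (1, C); rewrite ?oner_eq0 //= scale1r.
have [FA|] := boolP (F %| A); first by left; apply: dvdF.
move=> nFA; right; apply: dvdF; rewrite -(@Gauss_dvdpr _ _ A) //.
rewrite /coprimep; set g := gcdp F A.
have /dvdpP[[c q] /= c0 Eg] : g %| F by apply: dvdp_gcdl.
have g0 : g != 0 by rewrite gcdp_eq0 negb_and F0.
have q0 : q != 0.
  by apply/eqP=> q0; move: Eg; rewrite q0 mul0r => /eqP; rewrite -mul_polyC mulf_eq0 polyC_eq0 (negPf c0) (negPf F0).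
have := irrF _ _ _ c0 Eg; have := congr1 (fun p : {poly D} => size p) Eg.
rewrite size_scale // size_mul //.
have : (0 < size g)%N by rewrite size_poly_gt0.
have : (0 < size q)%N by rewrite size_poly_gt0.
have [gF|leFg] := ltnP (size g) (size F); first by rewrite andbT -leqNgt; case: (size g) => [|[|j]] //=; rewrite addnS /= => q0l _ -> ; lia.
move=> q_gt0 g_gt0 sz _; exfalso; move/negP: nFA; apply.
have : g %= F; last by move=> gF; rewrite -(eqp_dvdl _ gF) dvdp_gcdr.
rewrite -dvdp_size_eqp ?dvdp_gcdl //; apply/eqP.
by apply: anti_leq; rewrite dvdp_leq ?dvdp_gcdl.
Qed.

(** Outer induction on the size, inner induction on the number of primes in the leading coefficient.
    A constant prime dividing F uses up one of these, so the content is removed without gcds in D; a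
    primitive nonconstant F then either splits over the fraction field or is prime. *)
Lemma ufd_poly : ufd D -> ufd {poly D}.
Proof.
move=> ufdD F; have [k] := ubnP (size F); elim: k F => // k IHk F; rewrite ltnS => szF F0.
have [s] : ufd_factors (lead_coef F) by apply: ufdD; rewrite lead_coef_eq0.
have [m] := ubnP (size s); elim: m s F szF F0 => // m IHm s F szF F0.
rewrite ltnS => szs [Hs [u Uu El]].
have [[p pp [F' EF]]|prF] := classic (exists2 p, primer p & dvdr p%:P F).
  have p0 : p != 0 by case: pp.
  have F'0 : F' != 0 by apply: contra_neq F0 => F'0; rewrite EF F'0 mul0r.
  have lF : lead_coef F = lead_coef F' * p by rewrite EF lead_coefM lead_coefC.
  have [x xs px] : exists2 x, x \in s & dvdr p x.
    have : dvdr p (u * \prod_(q <- s) q) by exists (lead_coef F'); rewrite -El lF.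
    by case: (pp) => _ _ h /h[/(primer_ndvd_unit pp Uu)//|/(primer_dvd_prod pp)].
  have [v Uv Ex] := primer_assoc pp (Hs _ xs) px.
  rewrite EF; apply: ufd_factors_mul; last first.
    exists [:: p%:P]; split; first by move=> q; rewrite inE => /eqP->; apply: primer_polyC.
    by exists 1; rewrite ?unitr1 // big_seq1 mul1r.
  apply: (IHm (rem x s)) => //.
  - by move: szF; rewrite EF [_ * p%:P]mulrC mul_polyC size_scale.
  - by rewrite size_rem // prednK // lt0n size_eq0; case: (s) xs.
  split; first exact: prime_seq_rem.
  exists (u * v); first by rewrite unitrM Uu.
  apply: (mulIf p0); rewrite -lF El (perm_big _ (perm_to_rem xs)) big_cons /=; set P := (\prod_(j <- rem x s) j); rewrite Ex; ring.
have {}prF p : primer p -> ~ dvdr p%:P F by move=> pp pF; apply: prF; exists p.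
have [F1|F1] := leqP (size F) 1.
  rewrite (size1_polyC F1); have c0 : F`_0 != 0.
    by apply: contra_neq F0 => c0; rewrite (size1_polyC F1) c0.
  have [t [Ht [v Uv ->]]] := ufdD _ c0; exists (map polyC t); split.
    by move=> q /mapP[p pt ->]; apply: primer_polyC; apply: Ht.
  exists v%:P; first by rewrite poly_unitE coefC eqxx Uv size_polyC (memPn _ v Uv) // unitr0.
  by rewrite polyCM rmorph_prod big_map.
have [[[c [G H]] /= [c0 E /andP[sG sH]]]|irrF] := classic (exists z : D * ({poly D} * {poly D}),
   [/\ z.1 != 0, z.1 *: F = z.2.1 * z.2.2 & (size z.2.1 < size F)%N && (size z.2.2 < size F)%N]).
  have [t [Ht [v Uv Ec]]] := ufdD _ c0.
  rewrite Ec in E; have [G' [H' [EF lG lH]]] := primer_clear Ht Uv E.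
  have [G0 H0] : G' != 0 /\ H' != 0.
    by apply/andP; rewrite -negb_or -mulf_eq0 -EF.
  rewrite EF; apply: ufd_factors_mul; apply: IHk => //.
    by apply: leq_trans szF; apply: leq_ltn_trans sG.
  by apply: leq_trans szF; apply: leq_ltn_trans sH.
exists [:: F]; split; last by exists 1; rewrite ?unitr1 // big_seq1 mul1r.
move=> q; rewrite inE => /eqP->; apply: primer_primitive => // c G H c0 E.
by apply/negP=> h; apply: irrF; exists (c, (G, H)).
Qed.

End FactorialityPoly.

Lemma ufd_field (K : fieldType) : ufd K.
Proof.
by move=> a a0; exists [::]; split=> //; exists a; rewrite ?unitfE // big_nil mulr1.
Qed.

Lemma ufd_iso (A B : idomainType) (phi : {rmorphism A -> B}) :
  injective phi -> (forall b, exists a, b = phi a) -> ufd B -> ufd A.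
Proof.
move=> inj surj ufdB a a0.
have phiU x : (phi x \is a GRing.unit) = (x \is a GRing.unit).
  apply/idP/idP => [/unitrP[y [Ey _]]|]; last exact: rmorph_unit.
  have [z Ez] := surj y; apply/unitrP; exists z.
  by rewrite [x * z]mulrC; split; apply: inj; rewrite rmorphM rmorph1 -Ez.
have dvd x y : dvdr x y <-> dvdr (phi x) (phi y).
  split=> [[c ->]|[c]]; first by exists (phi c); rewrite rmorphM.
  by have [z ->] := surj c; rewrite -rmorphM => /inj ->; exists z.
have pr x : primer (phi x) -> primer x.
  case=> x0 xU hx; split.
  - by apply: contra_neq x0 => ->; rewrite rmorph0.
  - by rewrite -phiU.
  by move=> y z /dvd; rewrite rmorphM => /hx[]/dvd; [left|right].
have [s [Hs [u Uu E]]] : ufd_factors (phi a).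
  by apply: ufdB; apply: contra_neq a0 => h; apply: inj; rewrite h rmorph0.
have [t Et] : exists t, s = map phi t.
  elim: (s) => [|b s' [t ->]]; first by exists [::].
  by have [x ->] := surj b; exists (x :: t).
have [v Ev] := surj u; exists t; split.
  by move=> p pt; apply: pr; apply: Hs; rewrite Et map_f.
exists v; first by rewrite -phiU -Ev.
by apply: inj; rewrite E Ev Et rmorphM rmorph_prod big_map.
Qed.

(** * Degree functions *)

Section Muni.
Variables (n : nat) (R : nzRingType).

Definition mnm_rcons (m : 'X_{1..n}) (k : nat) : 'X_{1..n.+1} :=
  [multinom of rcons m k].

Lemma mnm_rconsE m k i : mnm_rcons m k i =
  if unlift ord_max i is Some j then m j else k.
Proof.
rewrite (mnm_nth 0%N) /= nth_rcons size_tuple; case: unliftP => [j ->|->] /=.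
  have -> : bump n j = j by rewrite /bump leqNgt ltn_ord.
  by rewrite ltn_ord (mnm_nth 0%N).
by rewrite ltnn eqxx.
Qed.

Lemma mnm_rcons_max m k : mnm_rcons m k ord_max = k.
Proof. by rewrite mnm_rconsE unlift_none. Qed.

Lemma mnm_rcons_widen m k i : mnm_rcons m k (widen_ord (leqnSn n) i) = m i.
Proof.
rewrite mnm_rconsE (_ : widen_ord _ _ = lift ord_max i) ?liftK //.
by apply: val_inj; rewrite /= /bump leqNgt ltn_ord.
Qed.

Lemma mnm_rcons_surj (m : 'X_{1..n.+1}) :
  m = mnm_rcons [multinom m (widen_ord (leqnSn n) i) | i < n] (m ord_max).
Proof.
apply/mnmP=> i; rewrite mnm_rconsE; case: unliftP => [j ->|->] //.
by rewrite mnmE; congr (m _); apply: val_inj; rewrite /= /bump leqNgt ltn_ord.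
Qed.

Lemma coef_muni (p : {mpoly R[n.+1]}) k m :
  ((muni p)`_k)@_m = p@_(mnm_rcons m k).
Proof.
rewrite muniE coef_sum raddf_sum /= [in RHS](mpolyE p) raddf_sum /=.
apply: eq_bigr => m' _; rewrite !coefZ coefXn mcoeffZ mcoeffX.
rewrite -scalerAl mcoeffZ; congr (_ * _).
have [->|nk] := eqVneq k (m' ord_max).
  rewrite mulr1 mcoeffX; congr ((_ : bool)%:R); apply/eqP/eqP => [<-|->].
    exact: mnm_rcons_surj.
  by apply/mnmP=> i; rewrite mnmE mnm_rcons_widen.
rewrite mulr0 mcoeff0 (_ : (_ == _) = false) //; apply/negbTE.
by apply: contra_neq nk => ->; rewrite mnm_rcons_max.
Qed.

Lemma muni_inj : injective (@muni n R).
Proof.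
move=> p q E; apply/mpolyP=> m; rewrite (mnm_rcons_surj m).
by rewrite -!coef_muni E.
Qed.

Lemma muni_surj (F : {poly {mpoly R[n]}}) : exists p, F = muni p.
Proof.
exists (\sum_(k < size F) \sum_(m <- msupp F`_k) F`_k@_m *: 'X_[mnm_rcons m k]).
apply/polyP=> k; apply/mpolyP=> m; rewrite coef_muni.
rewrite raddf_sum /=.
under eq_bigr do rewrite raddf_sum /=.
have inner (j : nat) : (\sum_(m' <- msupp F`_j) (F`_j@_m' *: 'X_[mnm_rcons m' j])@_(mnm_rcons m k))
   = if j == k then F`_k@_m else 0.
  have [->|njk] := eqVneq j k.
    rewrite [in RHS](mpolyE F`_k) raddf_sum /=; apply: eq_bigr => m' _.
    rewrite !mcoeffZ !mcoeffX; congr (_ * (_ : bool)%:R).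
    apply/eqP/eqP => [/mnmP E|-> //]; apply/mnmP=> i.
    by have := E (widen_ord (leqnSn n) i); rewrite !mnm_rcons_widen.
  apply: big1 => m' _; rewrite mcoeffZ mcoeffX (_ : (_ == _) = false) ?mulr0 //.
  by apply: contra_neqF njk => /eqP/mnmP/(_ ord_max); rewrite !mnm_rcons_max.
have [ltk|gek] := ltnP k (size F).
  rewrite (bigD1 (Ordinal ltk)) //= inner eqxx big1 ?addr0 // => j.
  by rewrite -val_eqE /= inner => /negbTE ->.
rewrite nth_default // mcoeff0 big1 // => j _.
by rewrite inner ltn_eqF // (leq_trans (ltn_ord j)).
Qed.

End Muni.

Lemma ufd_mpoly (R : idomainType) n : ufd R -> ufd {mpoly R[n]}.
Proof.
move=> ufdR; elim: n => [|n IH].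
  apply: (@ufd_iso _ _ (mcoeff 0%MM)) ufdR.
    exact: (can_inj (@mpolyKC R)).
  by move=> b; exists b%:MP; rewrite /= mpolyCK.
exact: (@ufd_iso _ _ (@muni n R) (@muni_inj n R) (@muni_surj n R) (ufd_poly IH)).
Qed.

(* [sz a] is one plus a degree, with [sz 0 = 0], as for [size] and [msize]. *)
Record size_fun (R : idomainType) := SizeFun {
  sz :> R -> nat;
  sz_eq0 : forall a, (sz a == 0%N) = (a == 0);
  szD_le : forall a b, (sz (a + b)%R <= maxn (sz a) (sz b))%N;
  sz_mul : forall a b, a != 0 -> b != 0 -> sz (a * b) = (sz a + sz b).-1
}.

Section SizeFunTheory.
Variables (R : idomainType) (w : size_fun R).
Implicit Types (a b : R).

Lemma sz0 : w 0 = 0%N. Proof. by apply/eqP; rewrite sz_eq0. Qed.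

Lemma sz_gt0 a : (0 < w a)%N = (a != 0). Proof. by rewrite lt0n sz_eq0. Qed.

Lemma sz1 : w 1 = 1%N.
Proof.
have E : w 1 = (w 1 + w 1).-1 by rewrite -(sz_mul w) ?mulr1 ?oner_neq0.
by have : (0 < w 1%R)%N; [rewrite sz_gt0 oner_neq0 | lia].
Qed.

Lemma szN a : w (- a) = w a.
Proof.
have [->|a0] := eqVneq a 0; first by rewrite oppr0.
have n0 : (-1 : R) != 0 by rewrite oppr_eq0 oner_neq0.
have E : w (-1) = 1%N.
  have E : w 1 = (w (-1)%R + w (-1)%R).-1 by rewrite -(sz_mul w) // mulrNN mulr1.
  by have : (0 < w (-1)%R)%N; [rewrite sz_gt0 | rewrite sz1 in E; lia].
by rewrite -mulN1r sz_mul // E.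
Qed.

Definition dle e a := (w a <= e.+1)%N.

Lemma dle0 e : dle e 0. Proof. by rewrite /dle sz0. Qed.
Lemma dle1 e : dle e 1. Proof. by rewrite /dle sz1. Qed.

Lemma dleW e e' a : (e <= e')%N -> dle e a -> dle e' a.
Proof. by rewrite /dle => h /leq_trans; apply. Qed.

Lemma dleD e a b : dle e a -> dle e b -> dle e (a + b).
Proof. by move=> ha hb; apply: leq_trans (szD_le _ _ _) _; rewrite geq_max; apply/andP. Qed.

Lemma dleN e a : dle e (- a) = dle e a.
Proof. by rewrite /dle szN. Qed.

Lemma dleB e a b : dle e a -> dle e b -> dle e (a - b).
Proof. by move=> ha hb; apply: dleD; rewrite ?dleN. Qed.

Lemma dleM e e' a b : dle e a -> dle e' b -> dle (e + e') (a * b).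
Proof.
have [->|a0] := eqVneq a 0; first by rewrite mul0r => *; apply: dle0.
have [->|b0] := eqVneq b 0; first by rewrite mulr0 => *; apply: dle0.
rewrite /dle sz_mul //; lia.
Qed.

(** Exact additivity in [sz_mul] makes bounds descend to factors; this is how the prime factors of a
    relation inherit its degree bounds. *)
Lemma dle_mulKr e a b : b != 0 -> dle e (a * b) -> dle e a.
Proof.
have [->|a0 b0] := eqVneq a 0; first by move=> *; apply: dle0.
have wb : (0 < w b)%N by rewrite sz_gt0.
rewrite /dle sz_mul //; lia.
Qed.

Lemma dle_sum e (I : Type) (r : seq I) (P : pred I) (F : I -> R) :
  (forall i, P i -> dle e (F i)) -> dle e (\sum_(i <- r | P i) F i).
Proof. by move=> H; elim/big_rec: _ => [|i x Pi]; [apply: dle0|apply/dleD/H]. Qed.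

Lemma dle_prod (I : Type) (r : seq I) (P : pred I) (F : I -> R) (e : I -> nat) :
  (forall i, P i -> dle (e i) (F i)) ->
  dle (\sum_(i <- r | P i) e i) (\prod_(i <- r | P i) F i).
Proof.
move=> H; elim: r => [|i r IH]; first by rewrite !big_nil dle1.
by rewrite !big_cons; case: ifP => // /H Hi; apply: dleM.
Qed.

Lemma dleX e a k : dle e a -> dle (e * k) (a ^+ k).
Proof.
move=> ha; elim: k => [|k IH]; first by rewrite expr0 dle1.
by rewrite exprS mulnS; apply: dleM.
Qed.

Lemma dle_sign e k : dle e ((-1) ^+ k).
Proof. by rewrite -signr_odd; case: odd; rewrite ?expr1 ?dleN ?expr0 dle1. Qed.

Lemma dle_det e m (A : 'M[R]_m) :
  (forall i j, dle e (A i j)) -> dle (m * e) (\det A).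
Proof.
move=> H; apply: dle_sum => s _; rewrite -[(m * e)%N]add0n; apply: dleM; first exact: dle_sign.
rewrite -[m in (m * e)%N]card_ord -sum_nat_const.
by apply: dle_prod.
Qed.

Lemma dle_adj e m (A : 'M[R]_m) i j :
  (forall i j, dle e (A i j)) -> dle (m.-1 * e) ((\adj A) i j).
Proof.
move=> H; rewrite mxE /cofactor -[(_ * e)%N]add0n; apply: dleM; first exact: dle_sign.
by apply: dle_det => k l; rewrite !mxE.
Qed.

End SizeFunTheory.

(** * Gauss norms: the degrees of coefficients *)

Section SizePoly.
Variables (R : idomainType) (w : size_fun R).
Implicit Types F G : {poly R}.

(** The Gauss norm for the degree on R: only coefficients are measured, so the polynomial variable
    costs nothing. This separates degrees in P from degrees in auxiliary variables. *)
Definition szp F := (\max_(i < size F) w (F`_i)%R)%N.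

Lemma szp_leP F e : reflect (forall i, (w (F`_i)%R <= e)%N) (szp F <= e)%N.
Proof.
apply: (iffP (bigmax_leqP _ _ _)) => [H i|H i _] //.
by have [lti|ge] := ltnP i (size F); [exact: (H (Ordinal lti))|rewrite nth_default ?sz0].
Qed.

Lemma szp_coef F i : (w (F`_i)%R <= szp F)%N.
Proof. exact: szp_leP. Qed.

Lemma szp_eq0 F : (szp F == 0%N) = (F == 0).
Proof.
rewrite -leqn0; apply/szp_leP/eqP => [H|-> i]; last by rewrite coef0 sz0.
by apply/polyP=> i; have := H i; rewrite leqn0 sz_eq0 coef0 => /eqP.
Qed.

Lemma szpD F G : (szp (F + G)%R <= maxn (szp F) (szp G))%N.
Proof.
apply/szp_leP=> i; rewrite coefD; apply: leq_trans (szD_le _ _ _) _.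
by rewrite geq_max !leq_max !szp_coef orbT.
Qed.

Lemma szp_min F : F != 0 ->
  exists i, w (F`_i)%R = szp F /\ forall j, (j < i)%N -> (w (F`_j)%R < szp F)%N.
Proof.
move=> F0; have [i0 Ei0] : exists i, w (F`_i)%R == szp F.
  have [|i E] := @eq_bigmax _ (fun i : 'I_(size F) => w (F`_i)%R); first by rewrite card_ord size_poly_gt0.
  by exists i; rewrite /szp E.
have [|i /eqP Ei Hi] := @classic_min (fun i => w (F`_i)%R == szp F); first by exists i0.
exists i; split=> // j /Hi; rewrite ltn_neqAle szp_coef andbT.
by move/negP.
Qed.

(* Gauss's lemma for the valuation minus the degree: look at the product of
   the first coefficients of maximal size. *)
Lemma szpM F G : F != 0 -> G != 0 -> szp (F * G) = (szp F + szp G).-1.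
Proof.
move=> F0 G0; have [i [Ei Hi]] := szp_min F0; have [j [Ej Hj]] := szp_min G0.
have sF : (0 < szp F)%N by rewrite lt0n szp_eq0.
have sG : (0 < szp G)%N by rewrite lt0n szp_eq0.
have Fi : F`_i != 0 by rewrite -(sz_gt0 w) Ei.
have Gj : G`_j != 0 by rewrite -(sz_gt0 w) Ej.
apply/eqP; rewrite eqn_leq; apply/andP; split.
  apply/szp_leP=> k; rewrite coefM -[X in (_ <= X)%N]prednK; last by lia.
  apply: (@dle_sum _ w) => l _.
  have -> : (szp F + szp G).-1.-1 = ((szp F).-1 + (szp G).-1)%N by lia.
  by apply: dleM; rewrite /dle prednK ?szp_coef.
rewrite leqNgt; apply/negP=> hlt.
have lti : (i < (i + j).+1)%N by rewrite ltnS leq_addr.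
have := coefM F G (i + j); rewrite (bigD1 (Ordinal lti)) //= addKn.
set S := \sum_(_ < _ | _) _ => E.
have ltS : (w S < (szp F + szp G).-1)%N.
  have [e1|gt1] := leqP (szp F + szp G) 2.
    suff -> : S = 0 by rewrite sz0; lia.
    apply: big1 => k nk.
    have : (k < i)%N || (k > i)%N by move: nk; rewrite -val_eqE /= neq_ltn.
    case/orP=> hk.
      have := Hi _ hk; have -> : szp F = 1%N by lia.
      by rewrite ltnS leqn0 sz_eq0 => /eqP ->; rewrite mul0r.
    have ltk : (i + j - k < j)%N by have := ltn_ord k; lia.
    have := Hj _ ltk; have -> : szp G = 1%N by lia.
    by rewrite ltnS leqn0 sz_eq0 => /eqP ->; rewrite mulr0.
  have -> : (szp F + szp G).-1 = (szp F + szp G - 3).+2 by lia.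
  rewrite ltnS; apply: (@dle_sum _ w) => k nk.
  have : (k < i)%N || (k > i)%N by move: nk; rewrite -val_eqE /= neq_ltn.
  case/orP=> hk.
    have := Hi _ hk; have [->|Fk0 ltF] := eqVneq F`_k 0; first by rewrite mul0r dle0.
    have Fk1 : (0 < w (F`_k)%R)%N by rewrite sz_gt0.
    have sF2 : (1 < szp F)%N by apply: leq_ltn_trans ltF.
    apply: (@dleW _ _ ((szp F).-2 + (szp G).-1)%N); first by lia.
    apply: dleM; last by rewrite /dle prednK ?szp_coef.
    by rewrite /dle; case: (szp F) sF2 ltF => [|[]].
  have ltk : (i + j - k < j)%N by have := ltn_ord k; lia.
  have := Hj _ ltk; have [->|Gk0 ltG] := eqVneq G`_(i + j - k) 0; first by rewrite mulr0 dle0.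
  have Gk1 : (0 < w (G`_(i + j - k))%R)%N by rewrite sz_gt0.
  have sG2 : (1 < szp G)%N by apply: leq_ltn_trans ltG.
  apply: (@dleW _ _ ((szp F).-1 + (szp G).-2)%N); first by lia.
  apply: dleM; first by rewrite /dle prednK ?szp_coef.
  by rewrite /dle; case: (szp G) sG2 ltG => [|[]].
have E2 : F`_i * G`_j = (F * G)`_(i + j) - S by rewrite E addrK.
have := sz_mul w Fi Gj; rewrite E2 Ei Ej => sz2.
have := szD_le w (F * G)`_(i + j) (- S); rewrite sz2 szN.
have := szp_coef (F * G) (i + j); lia.
Qed.

Definition poly_size_fun := SizeFun szp_eq0 szpD szpM.

End SizePoly.

Section SizeMpoly.
Variables (R : idomainType) (w : size_fun R).

Definition szm n (f : {mpoly R[n]}) := (\max_(m <- msupp f) w (f@_m)%R)%N.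

Lemma szm_leP n (f : {mpoly R[n]}) e :
  reflect (forall m, (w (f@_m)%R <= e)%N) (szm f <= e)%N.
Proof.
apply: (iffP (bigmax_leqP_seq _ _ _ _)) => [H m|H m _ _] //.
have [mf|/memN_msupp_eq0 ->] := boolP (m \in msupp f); first exact: H.
by rewrite sz0.
Qed.

Lemma szm_size_fun n : exists W : size_fun {mpoly R[n]}, W =1 @szm n.
Proof.
elim: n => [|n [W EW]].
  pose c0 (f : {mpoly R[0]}) := f@_0.
  have Ec f : @szm 0 f = w (c0 f).
    apply/eqP; rewrite eqn_leq; apply/andP; split; last exact: (szm_leP _ _ (leqnn _)).
    by apply/szm_leP=> m; rewrite [m]nvar0_mnmE.
  have inj : injective c0 by apply: (can_inj (@mpolyKC R)).
  have e0 f : (@szm 0 f == 0%N) = (f == 0).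
    by rewrite Ec sz_eq0 -(inj_eq inj) /c0 mcoeff0.
  have eD f g : (@szm 0 (f + g)%R <= maxn (@szm 0 f) (@szm 0 g))%N.
    by rewrite !Ec /c0 mcoeffD szD_le.
  have eM f g : f != 0 -> g != 0 -> @szm 0 (f * g) = (@szm 0 f + @szm 0 g).-1.
    rewrite -!(inj_eq inj) !Ec /c0 mcoeff0 => f0 g0.
    by rewrite rmorphM /= sz_mul.
  by exists (SizeFun e0 eD eM).
pose W' := poly_size_fun W.
have Ec f : @szm n.+1 f = W' (muni f).
  apply/eqP; rewrite eqn_leq; apply/andP; split.
    apply/szm_leP=> m; rewrite (mnm_rcons_surj m) -coef_muni.
    apply: leq_trans (szp_coef W (muni f) (m ord_max)).
    by rewrite EW; apply: (szm_leP _ _ (leqnn _)).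
  apply/szp_leP=> k; rewrite EW; apply/szm_leP=> m; rewrite coef_muni.
  exact: (szm_leP _ _ (leqnn _)).
have e0 f : (@szm n.+1 f == 0%N) = (f == 0).
  by rewrite Ec sz_eq0 -(inj_eq (@muni_inj n R)) muni0.
have eD f g : (@szm n.+1 (f + g)%R <= maxn (@szm n.+1 f) (@szm n.+1 g))%N.
  by rewrite !Ec muniD szD_le.
have eM f g : f != 0 -> g != 0 -> @szm n.+1 (f * g) = (@szm n.+1 f + @szm n.+1 g).-1.
  have nz (h : {mpoly R[n.+1]}) : h != 0 -> muni h != 0.
    by apply: contra_neq => h0; have /(_ h 0) := @muni_inj n R; rewrite h0 muni0 => ->.
  move=> f0 g0; rewrite (Ec f) (Ec g) (Ec (f * g)).
  move: (sz_mul W' (nz f f0) (nz g g0)) => <-.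
  by congr (W' _); apply: muniM.
by exists (SizeFun e0 eD eM).
Qed.

Lemma szm_eq0 n (f : {mpoly R[n]}) : (szm f == 0%N) = (f == 0).
Proof. by have [W EW] := szm_size_fun n; rewrite -EW sz_eq0. Qed.

Lemma szmD n (f g : {mpoly R[n]}) : (szm (f + g)%R <= maxn (szm f) (szm g))%N.
Proof. by have [W EW] := szm_size_fun n; rewrite -!EW szD_le. Qed.

Lemma szmM n (f g : {mpoly R[n]}) :
  f != 0 -> g != 0 -> szm (f * g) = (szm f + szm g).-1.
Proof. by have [W EW] := szm_size_fun n; rewrite -!EW => *; rewrite sz_mul. Qed.

Definition mpoly_size_fun n := SizeFun (@szm_eq0 n) (@szmD n) (@szmM n).

End SizeMpoly.

Definition msize_fun (R : idomainType) n : size_fun {mpoly R[n]} :=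
  SizeFun (@msize_poly_eq0 n R) (@msizeD_le n R) (@msizeM n R).

Lemma dle_polyP (R : idomainType) (w : size_fun R) e (F : {poly R}) :
  reflect (forall i, dle w e F`_i) (dle (poly_size_fun w) e F).
Proof. exact: szp_leP. Qed.

Lemma dle_mpolyP (R : idomainType) (w : size_fun R) n e (f : {mpoly R[n]}) :
  reflect (forall m, dle w e f@_m) (dle (mpoly_size_fun w n) e f).
Proof. exact: szm_leP. Qed.

(** * Cramer's rule over a domain *)

(* The rows of [Z] span the left kernel of [A] up to the nonzero scalar [mu];
   [fr] selects the free coordinates of Cramer's rule. *)
Lemma cramer_kernel (D : idomainType) (w : size_fun D) (e M h : nat)
    (A : 'M[D]_(M, h)) : (forall i j, dle w e (A i j)) ->
  exists (k : nat) (mu : D) (Z : 'M[D]_M) (fr : pred 'I_M),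
   [/\ (k <= M)%N /\ (k <= h)%N, dle w (k * e) mu, forall i j, dle w (k * e) (Z i j)
     & [/\ mu != 0, Z *m A = 0, forall v : 'rV_M, v *m A = 0 -> mu *: v = v *m Z,
        forall i j, fr i -> fr j -> Z i j = mu *+ (i == j)
      & forall i j, ~~ fr i -> Z i j = 0]].
Proof.
move=> dA; pose B := map_mx (@tofrac D) A; set k := \rank B.
(* [f] picks k independent rows, and [g] below picks k columns that make a nonsingular minor [C];
   [mu] is its determinant. *)
pose f := maxrankfun B; pose Af := rowsub f A.
have free_f : row_free (rowsub f B) := maxrowsub_free B.
have full_f : row_full (rowsub f B)^T by rewrite /row_full mxrank_tr.
pose g := fullrankfun full_f; pose C := mxsub f g A; pose mu := \det C.
have Cunit : map_mx (@tofrac D) C \in unitmx.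
  have := fullrowsub_unit full_f; rewrite -unitmx_tr; congr (_ \in unitmx).
  by apply/matrixP=> i j; rewrite !mxE.
have mu0 : mu != 0.
  by move: Cunit; rewrite unitmxE det_map_mx unitfE tofrac_eq0.
pose P := colsub g A *m \adj C.
(* Over the fraction field a row is a combination of the chosen rows, with coefficients its [g]
   columns times C^-1; [mu] turns C^-1 into the adjugate. *)
have PA : P *m Af = mu *: A.
  have [X EX] : exists X, B = X *m rowsub f B.
    by apply/submxP; rewrite eq_maxrowsub.
  suff : map_mx (@tofrac D) (P *m Af) = map_mx (@tofrac D) (mu *: A).
    by move=> /matrixP E; apply/matrixP=> i j; have := E i j; rewrite !mxE => /eqP; rewrite tofrac_eq => /eqP.
  rewrite map_mxM map_mxM map_mxZ -/B map_mx_adj.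
  have -> : map_mx (@tofrac D) (colsub g A) = X *m map_mx (@tofrac D) C.
    have -> : map_mx (@tofrac D) (colsub g A) = colsub g B.
      by apply/matrixP=> i j; rewrite !mxE.
    rewrite (congr1 (fun Y => colsub g Y) EX) -mulmx_colsub; congr (_ *m _).
    by apply/matrixP=> i j; rewrite !mxE.
  rewrite -[X *m _ *m _]mulmxA mul_mx_adj det_map_mx -/mu -mulmxA mul_scalar_mx.
  rewrite -scalemxAr; congr (_ *: _); apply: etrans (esym EX); congr (_ *m _).
  by apply/matrixP=> i j; rewrite !mxE.
(* Row i is mu e_i minus the expression of mu times row i of [A] in the chosen rows. It vanishes for
   chosen i, so the free coordinates are those outside the image of [f]. *)
pose Z := mu%:M - P *m rowsub f 1%:M.
have dP i j : dle w (k * e) (P i j).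
  rewrite mxE; apply: dle_sum => l _; rewrite mxE.
  have k0 : (0 < k)%N by apply: leq_ltn_trans (ltn_ord l).
  rewrite -(prednK k0) mulSn; apply: dleM => //; apply: dle_adj => x y.
  by rewrite mxE.
have dmu : dle w (k * e) mu by apply: dle_det => i j; rewrite mxE.
exists k, mu, Z, [pred i | i \notin codom f]; split=> //.
- by have := rank_leq_row B; have := rank_leq_col B; rewrite -/k => h1 h2.
- move=> i j; rewrite mxE; apply: dleD; first by rewrite mxE; case: eqP; rewrite ?mulr1n ?mulr0n ?dle0.
  rewrite mxE dleN mxE; apply: dle_sum => l _; rewrite [X in _ * X]mxE [X in _ * X]mxE.
  case: eqP => _ /=; last by rewrite mulr0; apply: dle0.
  by rewrite mulr1; apply: dP.
split=> //.
- by rewrite mulmxBl -mulmxA -rowsubE PA mul_scalar_mx subrr.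
- move=> v vA; rewrite mulmxBr mul_mx_scalar mulmxA [v *m P]mulmxA mulmx_colsub vA.
  by rewrite (_ : colsub g 0 = 0) ?mul0mx ?subr0 //; apply/matrixP=> i j; rewrite !mxE.
- move=> i j _ /= fj; rewrite mxE [X in X + _]mxE [X in _ + X]mxE [X in - X]mxE big1 ?subr0 // => l _; rewrite [X in _ * X]mxE [X in _ * X]mxE.
  case: eqP => [E|]; rewrite ?mulr0 //.
  by case/negP: fj; rewrite -E codom_f.
- move=> i j /negPn/codomP[l ->].
  have Pl x : P (f l) x = mu *+ (l == x).
    have /matrixP/(_ l x) := mul_mx_adj C; rewrite [in X in _ = X]mxE => <-; rewrite !mxE; apply: eq_bigr => y _.
    by rewrite !mxE.
  rewrite mxE [X in X + _]mxE [X in _ + X]mxE [X in - X]mxE (bigD1 l) //= Pl eqxx big1 => [|x nx].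
    by rewrite !mxE addr0 mulr1n mulr_natr subrr.
  by rewrite Pl eq_sym (negPf nx) mul0r.
Qed.

(** * Hermann's bound *)

Lemma mpoly_hom_ext (R : nzRingType) (S : comNzRingType) n
    (f g : {rmorphism {mpoly R[n]} -> S}) :
  (forall c, f c%:MP = g c%:MP) -> (forall i, f 'X_i = g 'X_i) -> f =1 g.
Proof.
move=> fC fX p; rewrite (mpolyE p) !rmorph_sum /=; apply: eq_bigr => m _.
rewrite -mul_mpolyC !rmorphM fC mpolyXE_id !rmorph_prod; congr (_ * _).
by apply: eq_bigr => i _; rewrite !rmorphXn fX.
Qed.

Lemma poly_hom_ext (R S : nzRingType) (f g : {rmorphism {poly R} -> S}) :
  (forall c, f c%:P = g c%:P) -> f 'X = g 'X -> f =1 g.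
Proof.
move=> fC fX; elim/poly_ind => [|p c IH]; first by rewrite !rmorph0.
by rewrite !rmorphD !rmorphM IH fX fC.
Qed.

Lemma tdeg_leW (R : comNzRingType) n e e' (f : {mpoly R[n]}) :
  (e <= e')%N -> tdeg_le f e -> tdeg_le f e'.
Proof. by move=> h /leq_trans; apply. Qed.

Lemma mmap_mpolyC (R S : nzRingType) n (f : {additive R -> S}) (h : 'I_n -> S) c :
  mmap f h c%:MP = f c.
Proof. exact: mmapC. Qed.

Lemma mmap_mpolyU (R S : nzRingType) n (f : {rmorphism R -> S}) (h : 'I_n -> S) i :
  mmap f h 'X_i = h i.
Proof. by rewrite mmapX mmap1U. Qed.

Lemma dle_mmap1 (S : idomainType) (w : size_fun S) n (h : 'I_n -> S) e m :
  (forall i, dle w e (h i)) -> dle w (mdeg m * e) (mmap1 h m).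
Proof.
move=> dh; rewrite mdegE big_distrl /=; apply: dle_prod => i _.
by rewrite mulnC; apply: dleX.
Qed.

Lemma dle_mmap (R : comNzRingType) (S : idomainType) (w : size_fun S) n
    (f : {additive R -> S}) (h : 'I_n -> S) D d e (p : {mpoly R[n]}) :
  (forall c, dle w d (f c)) -> (forall i, dle w e (h i)) -> tdeg_le p D ->
  dle w (d + D * e) (mmap f h p).
Proof.
move=> df dh dp; rewrite /mmap big_seq; apply: dle_sum => m mp; apply: dleM => //.
apply: dleW (dle_mmap1 m dh); rewrite leq_mul2r; apply/orP; right.
by rewrite -ltnS; apply: leq_trans dp; apply: msize_mdeg_lt.
Qed.

Definition size_size_fun (R : idomainType) : size_fun {poly R} :=
  SizeFun (@size_poly_eq0 R) (@size_polyD R) (@size_mul R).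

Lemma dle_msizeC (K : idomainType) n (c : K) d : dle (msize_fun K n) d c%:MP.
Proof. by rewrite /dle /= msizeC; case: eqP. Qed.

Lemma dle_msizeX (K : idomainType) n i : dle (msize_fun K n) 1 'X_i.
Proof. by rewrite /dle /= msizeX mdeg1. Qed.

(** * Nagata's change of variables *)

Section Nagata.
Variables (K : fieldType) (n : nat) (wt : 'I_n -> nat) (W : nat).
Hypothesis W0 : (0 < W)%N.
Hypothesis wtW : forall i, (wt i <= W)%N.
Local Notation R' := {mpoly K[n]}.
Local Notation R := {mpoly K[n.+1]}.

(** The last variable becomes the main variable Y, and X_j becomes X_j + Y^(wt j). Weights that are
    powers of e+1 will give polynomials of degree at most e a constant leading coefficient in Y. *)
Definition nagata_var (i : 'I_n.+1) : {poly R'} :=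
  if unlift ord_max i is Some j then ('X_j)%:P + 'X^(wt j) else 'X.
Definition nagata : R -> {poly R'} := mmap (polyC \o @mpolyC n K) nagata_var.
HB.instance Definition _ := GRing.RMorphism.on nagata.

Definition unnagata_coef : R' -> R :=
  mmap (@mpolyC n.+1 K) (fun j => 'X_(lift ord_max j) - 'X_ord_max ^+ wt j).
HB.instance Definition _ := GRing.RMorphism.on unnagata_coef.
Definition unnagata : {poly R'} -> R :=
  horner_eval 'X_ord_max \o map_poly unnagata_coef.
HB.instance Definition _ := GRing.RMorphism.on unnagata.

Lemma nagataC c : nagata c%:MP = (c%:MP)%:P.
Proof. exact: mmap_mpolyC. Qed.

Lemma nagataX i : nagata 'X_i = nagata_var i.
Proof. exact: mmap_mpolyU. Qed.

Lemma unnagataC c : unnagata c%:P = unnagata_coef c.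
Proof. by rewrite /unnagata /= map_polyC /horner_eval hornerC. Qed.

Lemma unnagataX : unnagata 'X = 'X_ord_max.
Proof. by rewrite /unnagata /= map_polyX /horner_eval hornerX. Qed.

Lemma nagataK : cancel nagata unnagata.
Proof.
apply: (@mpoly_hom_ext _ _ _ (unnagata \o nagata) idfun) => [c|i] /=.
  by rewrite nagataC unnagataC /unnagata_coef mmap_mpolyC.
rewrite nagataX /nagata_var; case: unliftP => [j ->|->]; last exact: unnagataX.
rewrite rmorphD rmorphXn /= unnagataX unnagataC /unnagata_coef mmap_mpolyU.
by rewrite subrK.
Qed.

Lemma unnagataK : cancel unnagata nagata.
Proof.
have cC : (nagata \o unnagata_coef) =1 polyC.
  apply: (@mpoly_hom_ext _ _ _ (nagata \o unnagata_coef) polyC) => [c|i] /=.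
    by rewrite /unnagata_coef mmap_mpolyC nagataC.
  rewrite /unnagata_coef mmap_mpolyU rmorphB rmorphXn /= !nagataX /nagata_var.
  by rewrite liftK unlift_none addrK.
apply: (@poly_hom_ext _ _ (nagata \o unnagata) idfun) => [c|] /=.
  by rewrite unnagataC; apply: cC.
by rewrite unnagataX nagataX /nagata_var unlift_none.
Qed.

Lemma size_nagata p D : tdeg_le p D -> (size (nagata p) <= (D * W).+1)%N.
Proof.
move=> dp; have := @dle_mmap _ _ (size_size_fun R') _ (polyC \o @mpolyC n K) nagata_var D 0 W p.
apply=> // [c|i]; first by rewrite /dle /= size_polyC; case: eqP.
rewrite /dle /= /nagata_var; case: unlift => [j|]; last by rewrite size_polyX.
apply: leq_trans (size_polyD _ _) _; rewrite size_polyC size_polyXn geq_max.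
by case: eqP => //= _; rewrite ltnS ?wtW ?W0.
Qed.

Lemma coef_nagata p D : tdeg_le p D ->
  forall k, tdeg_le (nagata p)`_k D.
Proof.
move=> dp; have := @dle_mmap _ _ (poly_size_fun (msize_fun K n)) _
   (polyC \o @mpolyC n K) nagata_var D 0 1 p.
rewrite muln1 => H k; apply: (dle_polyP (msize_fun K n) _ _ (H _ _ dp)) => [c|i].
  apply/dle_polyP => j; rewrite coefC; case: eqP => _; [exact: dle_msizeC|exact: dle0].
apply/dle_polyP => j.
rewrite /nagata_var; case: unlift => [l|]; last by rewrite coefX -mpolyC_nat dle_msizeC.
rewrite coefD coefC coefXn -mpolyC_nat; apply: dleD; last exact: dle_msizeC.
by case: eqP => _; [apply: dle_msizeX|apply: dle0].
Qed.

Lemma dle_unnagata_coef c b : tdeg_le c b ->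
  dle (msize_fun K n.+1) (b * W) (unnagata_coef c).
Proof.
move=> dc; rewrite -[(b * W)%N]add0n; apply: dle_mmap dc => [a|i]; first exact: dle_msizeC.
apply: dleB; first exact: dleW (dle_msizeX _ _).
by apply: dleW (wtW i) _; rewrite -[X in dle _ X _]mul1n; apply/dleX/dle_msizeX.
Qed.

Lemma dle_unnagata (c : nat -> R') N b : (forall k, tdeg_le (c k) b) ->
  tdeg_le (unnagata (\poly_(k < N) c k)) (b * W + N).
Proof.
move=> dc; rewrite poly_def rmorph_sum /=; apply: (@dle_sum _ (msize_fun K n.+1)) => k _.
rewrite -mul_polyC rmorphM rmorphXn /= unnagataC unnagataX.
apply: dleM; first exact: dle_unnagata_coef.
apply: dleW (ltnW (ltn_ord k)) _; rewrite -[X in dle _ X _]mul1n.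
exact/dleX/dle_msizeX.
Qed.

End Nagata.

Lemma digits_inj b n (f g : 'I_n -> nat) :
  (forall i, f i < b)%N -> (forall i, g i < b)%N ->
  (\sum_(i < n) f i * b ^ i = \sum_(i < n) g i * b ^ i)%N -> f =1 g.
Proof.
elim: n f g => [|n IH] f g fb gb; first by move=> _ [].
have shift (h : 'I_n.+1 -> nat) : (\sum_(i < n.+1) h i * b ^ i =
    (\sum_(i < n) h (lift ord0 i) * b ^ i) * b + h ord0)%N.
  rewrite big_ord_recl muln1 addnC; congr (_ + _)%N; rewrite big_distrl /=.
  by apply: eq_bigr => i _; rewrite /bump /= add1n expnSr mulnA.
rewrite !shift => E.
have b0 : (0 < b)%N by apply: leq_ltn_trans (fb ord0).
have E0 : f ord0 = g ord0.
  by have := congr1 (modn^~ b) E; rewrite !modnMDl !modn_small.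
have ES : (fun i => f (lift ord0 i)) =1 (fun i => g (lift ord0 i)).
  by apply: IH => //; move: E; rewrite E0 => /addIn /eqP; rewrite eqn_pmul2r // => /eqP.
by move=> i; case: (unliftP ord0 i) => [j|] ->; [exact: (ES j)|exact: E0].
Qed.

Lemma seq_argmax (T : eqType) (F : T -> nat) (s : seq T) : s != [::] ->
  exists2 m, m \in s & forall x, x \in s -> (F x <= F m)%N.
Proof.
elim: s => // a s IH _; have [->|/IH[m ms Hm]] := eqVneq s [::].
  by exists a => [|x]; rewrite ?inE // => /eqP->.
have [le|/ltnW le] := leqP (F a) (F m).
  by exists m => [|x]; rewrite inE ?ms ?orbT // => /predU1P[->|/Hm].
exists a => [|x]; rewrite inE ?eqxx // => /predU1P[->//|/Hm h].
exact: leq_trans h le.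
Qed.

Section NagataMonic.
Variables (K : fieldType) (n e : nat).
Let wt (i : 'I_n) := (e.+1 ^ i.+1)%N.
Local Notation nag := (@nagata K n wt).

(** [N m] is the Y-degree of the image of the monomial m: its digits in base e+1 are the exponents
    of m, with that of the last variable as units digit. *)
Let digit (m : 'X_{1..n.+1}) (i : 'I_n.+1) :=
  if unlift ord0 i is Some j then m (lift ord_max j) else m ord_max.
Let N (m : 'X_{1..n.+1}) := (\sum_(i < n.+1) digit m i * e.+1 ^ i)%N.

Let monic_deg (k : nat) (F : {poly {mpoly K[n]}}) := F \is monic /\ size F = k.+1.

Let monic_degM k l F G : monic_deg k F -> monic_deg l G -> monic_deg (k + l) (F * G).
Proof.
move=> [mF sF] [mG sG]; split; first by rewrite monicMl.
by rewrite size_monicM ?monic_neq0 // sF sG addnS.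
Qed.

Let monic_degX k F j : monic_deg k F -> monic_deg (j * k) (F ^+ j).
Proof.
move=> dF; elim: j => [|j IH]; first by split; rewrite ?monic1 ?size_poly1.
by rewrite exprS mulSn; apply: monic_degM.
Qed.

Lemma nagata_mnm_monic m : monic_deg (N m) (mmap1 (@nagata_var K n wt) m).
Proof.
have -> : N m = (\sum_(i < n.+1) m i *
    (if unlift ord_max i is Some j then wt j else 1))%N.
  rewrite /N big_ord_recl big_ord_recr /= /digit unlift_none muln1 addnC; congr (_ + _)%N.
    apply: eq_bigr => i _; rewrite liftK /=.
    have E : lift ord_max i = widen_ord (leqnSn n) i.
      by apply: val_inj; rewrite /= /bump leqNgt ltn_ord.
    by rewrite -E liftK.
  by rewrite unlift_none muln1.
apply: (big_ind2 (fun F k => monic_deg k F)) => [|F k G l|i _].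
- by split; rewrite ?monic1 ?size_poly1.
- exact: monic_degM.
apply: monic_degX; rewrite /nagata_var; case: unlift => [j|]; last first.
  by split; rewrite ?monicX ?size_polyX.
have lt1 : (size (('X_j : {mpoly K[n]})%:P : {poly _}) < size ('X^(wt j) : {poly {mpoly K[n]}}))%N.
  rewrite size_polyXn ltnS size_polyC; apply: leq_trans (leq_b1 _) _.
  by rewrite expn_gt0.
split; first by rewrite monicE lead_coefDr ?lead_coefXn.
by rewrite addrC (size_polyDl lt1) size_polyXn.
Qed.

(** Exponents are at most e, so distinct monomials have distinct base e+1 values, hence distinct
    Y-degrees. Their images are monic, so a single monomial determines the leading coefficient. *)
Lemma nagata_lead (p : {mpoly K[n.+1]}) : p != 0 -> tdeg_le p e ->
  exists2 c : K, c != 0 & lead_coef (nag p) = c%:MP.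
Proof.
move=> p0 dp; have digitP m i : m \in msupp p -> (digit m i < e.+1)%N.
  move=> /msize_mdeg_lt h; rewrite ltnS; apply: (@leq_trans (mdeg m)); last first.
    by rewrite -ltnS; apply: leq_trans dp.
  have le j : (m j <= mdeg m)%N by rewrite mdegE (bigD1 j) //= leq_addr.
  by rewrite /digit; case: unlift.
have Ninj m m' : m \in msupp p -> m' \in msupp p -> N m = N m' -> m = m'.
  move=> mp m'p /digits_inj E; apply/mnmP=> i.
  have {}E := E (fun i => digitP m i mp) (fun i => digitP m' i m'p).
  case: (unliftP ord_max i) => [j|] ->.
    by have := E (lift ord0 j); rewrite /digit liftK.
  by have := E ord0; rewrite /digit unlift_none.
have [m mp Hm] : exists2 m, m \in msupp p & forall m', m' \in msupp p -> (N m' <= N m)%N.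
  by apply: seq_argmax; rewrite msupp_eq0.
exists p@_m; first by rewrite -mcoeff_msupp.
have [mon sz] := nagata_mnm_monic m.
rewrite /nagata /mmap (bigD1_seq m) ?msupp_uniq //= lead_coefDl.
  by rewrite mul_polyC lead_coefZ (monicP mon) mulr1.
rewrite mul_polyC size_scale ?mpolyC_eq0 -?mcoeff_msupp // sz ltnS.
apply: leq_trans (size_sum _ _ _) _; rewrite big_seq_cond; apply/bigmax_leqP_seq => m' _.
case/andP=> m'p nm'; rewrite mul_polyC; apply: leq_trans (size_scale_leq _ _) _.
have [_ ->] := nagata_mnm_monic m'; rewrite ltn_neqAle Hm // andbT.
by apply: contra_neq nm' => /Ninj->.
Qed.

End NagataMonic.

Lemma nagata_iso (K : fieldType) n e :
  exists (f : {rmorphism {mpoly K[n.+1]} -> {poly {mpoly K[n]}}})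
         (g : {rmorphism {poly {mpoly K[n]}} -> {mpoly K[n.+1]}}),
  [/\ cancel f g /\ cancel g f,
      forall p D, tdeg_le p D -> (size (f p) <= (D * e.+1 ^ n).+1)%N,
      forall p D, tdeg_le p D -> forall k, tdeg_le (f p)`_k D,
      forall c N b, (forall k, tdeg_le (c k) b) ->
        tdeg_le (g (\poly_(k < N) c k)) (b * e.+1 ^ n + N)
    & forall p, p != 0 -> tdeg_le p e ->
        exists2 c : K, c != 0 & lead_coef (f p) = c%:MP].
Proof.
pose wt (i : 'I_n) := (e.+1 ^ i.+1)%N.
have W0 : (0 < e.+1 ^ n)%N by rewrite expn_gt0.
have wtW i : (wt i <= e.+1 ^ n)%N by apply: leq_pexp2l (ltn_ord i).
exists (@nagata K n wt), (@unnagata K n wt); split.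
- by split; [exact: nagataK|exact: unnagataK].
- by move=> p D; apply: size_nagata.
- exact: coef_nagata.
- by move=> c N b; apply: dle_unnagata.
- exact: nagata_lead.
Qed.

(** The minors of [m] equations of degree [D] have degree at most m D, so Nagata weights for e = m D
    are bounded by [W]. Solutions reduce to size at most [N] in the main variable, and comparing
    coefficients leaves m (N + D W) equations of degree [D] in one variable fewer. *)
Fixpoint hermann_bound n m D :=
  if n is n'.+1 then
    let W := ((m * D).+1 ^ n')%N in
    let N := (m * D * W)%N in
    (hermann_bound n' (m * (N + D * W)) D * W + N)%N
  else 0%N.

(** Solutions of degree at most b generate the module of all solutions, phrased as an induction
    principle for a submodule property [Q]. The bound involves only the number of equations; the
    number of unknowns is free, as it must be because an ideal membership may use arbitrarily many
    generators. *)
Definition hermann_spec (K : fieldType) n m D b := forall (I J : finType)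
    (A : I -> J -> {mpoly K[n]}) (Q : {ffun I -> {mpoly K[n]}} -> Prop),
  (#|J| <= m)%N -> (forall i j, tdeg_le (A i j) D) ->
  Q 0 -> (forall u v, Q u -> Q v -> Q (u + v)) ->
  (forall a u, Q u -> Q [ffun i => a * u i]) ->
  (forall v : {ffun I -> {mpoly K[n]}},
     (forall j, \sum_i v i * A i j = 0) -> (forall i, tdeg_le (v i) b) -> Q v) ->
  forall v : {ffun I -> {mpoly K[n]}}, (forall j, \sum_i v i * A i j = 0) -> Q v.

Lemma hermann0 (K : fieldType) m D : hermann_spec K 0 m D 0.
Proof.
move=> I J A Q _ _ _ _ _ HQ v vA; apply: HQ => // i.
by rewrite (nvar0_mpolyC (v i)); apply: dle_msizeC.
Qed.

(** After Nagata's substitution the maximal minor [mu] has an invertible leading coefficient.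
    Division by it allows subtracting multiples of the Cramer solutions until the free coordinates
    are smaller than [mu] in the main variable; the other coordinates are then small too, and a
    system in n variables remains. *)
Lemma hermannS (K : fieldType) n m D b :
  let W := ((m * D).+1 ^ n)%N in let N := (m * D * W)%N in
  hermann_spec K n (m * (N + D * W)) D b -> hermann_spec K n.+1 m D (b * W + N).
Proof.
move=> W N IH I J A Q leJ dA Q0 QD QM HQ v vA.
pose e := (m * D)%N; have W0 : (0 < W)%N by rewrite expn_gt0.
have [nag [un [[unK nagK] size_nag coef_nag dun lead_nag]]] := nagata_iso K n e.
pose B := \matrix_(i < #|I|, j < #|J|) A (enum_val i) (enum_val j).
have dB i j : dle (msize_fun K n.+1) D (B i j) by rewrite mxE; apply: dA.
have [k [mu [Z [fr [[_ lek] dmu dZ [mu0 ZB kerB Zfr Znfr]]]]]] := cramer_kernel dB.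
have lekm : (k * D <= e)%N by rewrite leq_mul2r (leq_trans lek leJ) orbT.
have {}dmu : tdeg_le mu e by apply: dleW dmu.
have {}dZ i j : tdeg_le (Z i j) e by apply: dleW (dZ i j).
have [c c0 lead_mu] : exists2 c : K, c != 0 & lead_coef (nag mu) = c%:MP by apply: lead_nag.
have Ulead : lead_coef (nag mu) \is a GRing.unit.
  by rewrite lead_mu; apply: rmorph_unit; rewrite unitfE.
have nmu0 : nag mu != 0 by rewrite -lead_coef_eq0 lead_mu mpolyC_eq0.
have smu : (size (nag mu) <= N.+1)%N by apply: size_nag.
pose row_of (u : {ffun I -> {mpoly K[n.+1]}}) : 'rV_#|I| := \row_i u (enum_val i).
have row_ker (u : {ffun I -> {mpoly K[n.+1]}}) :
    (forall j, \sum_i u i * A i j = 0) -> row_of u *m B = 0.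
  move=> uA; apply/rowP=> j; rewrite !mxE -[RHS](uA (enum_val j)).
  rewrite (reindex (@enum_val I xpredT)) /=; last exact/onW_bij/enum_val_bij.
  by apply: eq_bigr => i _; rewrite !mxE.
pose Zr i : {ffun I -> {mpoly K[n.+1]}} := [ffun x => Z i (enum_rank x)].
have ZrA i j : \sum_x Zr i x * A x j = 0.
  have /matrixP/(_ i (enum_rank j)) := ZB; rewrite !mxE => E; rewrite -[RHS]E.
  rewrite (reindex (@enum_val I xpredT)) /=; last exact/onW_bij/enum_val_bij.
  by apply: eq_bigr => x _; rewrite ffunE !mxE enum_valK enum_rankK.
have QZr i : Q (Zr i).
  apply: HQ => // x; rewrite ffunE; apply: tdeg_leW (dZ _ _).
  by rewrite /N (leq_trans (leq_pmulr e W0)) ?leq_addl.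
pose a i := if fr i then un (nag (v (enum_val i)) %/ nag mu) else 0.
pose s := \sum_i [ffun x => a i * Zr i x].
have Qs : Q s by apply: (big_ind Q) => // i _; apply: QM.
pose u := v - s.
suff Qu : Q u by rewrite -(subrK s v); apply: QD.
have sE x : s x = \sum_i a i * Z i (enum_rank x).
  by rewrite sum_ffunE; apply: eq_bigr => i _; rewrite !ffunE.
have uA j : \sum_i u i * A i j = 0.
  rewrite (eq_bigr (fun i => v i * A i j - s i * A i j)) => [|i _]; last first.
    by rewrite !ffunE mulrBl.
  rewrite sumrB vA sub0r (eq_bigr (fun x => \sum_i a i * (Zr i x * A x j))) => [|x _].
    rewrite exchange_big big1 ?oppr0 // => i _.
    by rewrite -mulr_sumr ZrA mulr0.
  by rewrite sE mulr_suml; apply: eq_bigr => i _; rewrite ffunE mulrA.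
have u_free i : fr i -> (size (nag (u (enum_val i))) < size (nag mu))%N.
  move=> fi; rewrite !ffunE sE enum_valK (bigD1 i) //= big1 ?addr0 => [|l li].
    rewrite Zfr // eqxx mulr1n /a fi rmorphB rmorphM nagK {1}(Pdiv.IdomainUnit.divp_eq Ulead (nag (v (enum_val i)))).
    by rewrite addrC addKr ltn_modp.
  rewrite /a; case: ifP => [fl|_]; last by rewrite mul0r.
  by rewrite Zfr // (negPf li) mulr0n mulr0.
(* For a non-free j, mu u_j is the sum over free i of u_i Z_ij, with u_i smaller than mu and Z_ij of
   size at most N+1. *)
have u_size x : (size (nag (u x)) <= N)%N.
  rewrite -(enum_rankK x); set j := enum_rank x.
  have [fj|nfj] := boolP (fr j); first by rewrite -ltnS (leq_trans (u_free _ fj)).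
  have := kerB _ (row_ker _ uA) => /rowP/(_ j); rewrite !mxE => /(congr1 nag).
  have [->|un0] := eqVneq (nag (u (enum_val j))) 0; first by rewrite size_poly0.
  rewrite rmorphM => /(congr1 (fun p : {poly _} => size p)).
  rewrite size_mul // rmorph_sum /= => E.
  have : ((size (nag mu) + size (nag (u (enum_val j)))).-1 <= (size (nag mu)).-1 + N)%N.
    rewrite E; apply: leq_trans (size_sum _ _ _) _; apply/bigmax_leqP => i _.
    rewrite rmorphM [row_of _ _ _]mxE; have [fi|nfi] := boolP (fr i); last first.
      by rewrite Znfr // rmorph0 mulr0 size_poly0.
    apply: leq_trans (size_polyMleq _ _) _.
    have ar k1 k2 k3 : (k1 < k3 -> k2 <= N.+1 -> (k1 + k2).-1 <= k3.-1 + N)%N by lia.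
    by apply: ar; [apply: u_free | apply: size_nag].
  have ar k1 k2 : (0 < k1 -> (k1 + k2).-1 <= k1.-1 + N -> k2 <= N)%N by lia.
  by apply: ar; rewrite size_poly_gt0.
(* The new unknowns are the coefficients of the u_i at Y^k with k < N; the equations are the
   coefficients at Y^l with l < N + D W, beyond which every product vanishes. *)
pose A' (p : I * 'I_N) (q : J * 'I_(N + D * W)) : {mpoly K[n]} :=
  if (p.2 <= q.2)%N then (nag (A p.1 q.1))`_(q.2 - p.2) else 0.
pose asm (f : {ffun I * 'I_N -> {mpoly K[n]}}) (i : I) (l : nat) : {mpoly K[n]} :=
  if insub l is Some k then f (i, k) else 0.
pose back (f : {ffun I * 'I_N -> {mpoly K[n]}}) : {ffun I -> {mpoly K[n.+1]}} :=
  [ffun i => un (\poly_(l < N) asm f i l)].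
have asmE f i (l : 'I_N) : asm f i l = f (i, l) by rewrite /asm valK.
pose vh : {ffun I * 'I_N -> {mpoly K[n]}} := [ffun p : I * 'I_N => (nag (u p.1))`_p.2].
have back_vh : back vh = u.
  apply/ffunP=> i; rewrite ffunE -[RHS]unK; congr (un _).
  apply/polyP=> l; rewrite coef_poly; case: ltnP => [lt|ge].
    by rewrite (asmE _ _ (Ordinal lt)) ffunE.
  by rewrite nth_default // (leq_trans (u_size i)).
have ker_iff (f : {ffun I * 'I_N -> {mpoly K[n]}}) : (forall q, \sum_p f p * A' p q = 0) <-> (forall j, \sum_i back f i * A i j = 0).
  have sumE j : \sum_i back f i * A i j = un (\sum_i (\poly_(l < N) asm f i l) * nag (A i j)).
    rewrite rmorph_sum /=; apply: eq_bigr => i _.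
    by rewrite ffunE rmorphM unK.
  have coefE j l : (\sum_i (\poly_(l < N) asm f i l) * nag (A i j))`_l =
      \sum_(p : I * 'I_N) f p * (if (p.2 <= l)%N then (nag (A p.1 j))`_(l - p.2) else 0).
    transitivity (\sum_i \sum_(k : 'I_N) f (i, k) *
      (if (k <= l)%N then (nag (A i j))`_(l - k) else 0)); last first.
      by rewrite pair_bigA; apply: eq_bigr => -[i k'] _.
    rewrite coef_sum.
    apply: eq_bigr => i _; rewrite poly_def mulr_suml coef_sum; apply: eq_bigr => k' _.
    rewrite asmE -scalerAl coefZ; congr (_ * _); rewrite mulrC coefMXn.
    by rewrite ltnNge; case: leqP.
  split=> H => [j|[j l]].
    rewrite sumE (_ : \sum_i _ = 0) ?rmorph0 //; apply/polyP=> l; rewrite coef0.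
    have [lt|ge] := ltnP l (N + D * W); first by rewrite coefE; apply: (H (j, Ordinal lt)).
    rewrite coef_sum big1 // => i _; rewrite nth_default //.
    apply: leq_trans (size_polyMleq _ _) _.
    have ar k1 k2 k3 : (k1 <= N -> k2 <= (D * W).+1 -> N + D * W <= k3 -> (k1 + k2).-1 <= k3)%N by lia.
    by apply: ar ge; [apply: size_poly | apply: size_nag].
  have := H j; rewrite sumE => /(congr1 nag); rewrite nagK rmorph0.
  by move=> /polyP/(_ l); rewrite coef0 coefE.
rewrite -back_vh; apply: (IH _ _ A' (fun f => Q (back f))).
- by rewrite card_prod card_ord leq_mul2r leJ orbT.
- move=> p q; rewrite /A'; case: ifP => _; last by rewrite /tdeg_le msize0.
  by apply: coef_nag; apply: dA.
- rewrite (_ : back 0 = 0) //; apply/ffunP=> i; rewrite !ffunE.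
  rewrite (_ : \poly_(_ < _) _ = 0) ?rmorph0 //; apply/polyP=> l.
  by rewrite coef_poly coef0 /asm; case: ifP => // _; case: insub => // x; rewrite ffunE.
- move=> f g Qf Qg; rewrite (_ : back (f + g) = back f + back g); first exact: QD.
  apply/ffunP=> i; rewrite !ffunE -rmorphD; congr (un _); apply/polyP=> l.
  rewrite coefD !coef_poly /asm; case: ifP => _; last by rewrite addr0.
  by case: insub => [x|]; rewrite ?ffunE ?addr0.
- move=> a0 f Qf; rewrite (_ : back _ = [ffun i => un a0%:P * back f i]); first exact: QM.
  apply/ffunP=> i; rewrite !ffunE -rmorphM; congr (un _); apply/polyP=> l.
  rewrite mul_polyC coefZ !coef_poly /asm; case: ifP => _; last by rewrite mulr0.
  by case: insub => [x|]; rewrite ?ffunE ?mulr0.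
- move=> f /ker_iff fA df; apply: HQ => // i; rewrite ffunE; apply: dun => // l.
  by rewrite /asm; case: insub => [x|]; [apply: df|rewrite /tdeg_le msize0].
apply/ker_iff; rewrite back_vh; exact: uA.
Qed.

Lemma hermann (K : fieldType) n m D : hermann_spec K n m D (hermann_bound n m D).
Proof. elim: n m => [|n IH] m; [exact: hermann0|exact: (hermannS (IH _))]. Qed.

(** * Ideals *)

Section IdealPred.
Variable R : comNzRingType.
Implicit Types (I : R -> Prop) (f g : R).

Record is_ideal I : Prop := IsIdeal {
  id0 : I 0;
  idD : forall f g, I f -> I g -> I (f + g);
  idM : forall f g, I g -> I (f * g) }.

Variables (I : R -> Prop) (idI : is_ideal I).

Lemma idMr f g : I f -> I (f * g).
Proof. by rewrite mulrC; apply: (idM idI). Qed.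

Lemma idN f : I f -> I (- f).
Proof. by rewrite -mulN1r; apply: (idM idI). Qed.

Lemma idB f g : I f -> I g -> I (f - g).
Proof. by move=> If /idN; apply: (idD idI). Qed.

Lemma id_cong f g : I (f - g) -> I f <-> I g.
Proof.
move=> h; split=> h'; last by rewrite -(subrK g f); apply: (idD idI).
by rewrite -(subKr f g); apply: idB.
Qed.

Lemma id_sum (J : Type) (s : seq J) (P : pred J) (F : J -> R) :
  (forall j, P j -> I (F j)) -> I (\sum_(j <- s | P j) F j).
Proof. by move=> H; apply: big_ind => //; [apply: (id0 idI)|apply: (idD idI)]. Qed.

Lemma id_congM f g f' g' : I (f - f') -> I (g - g') -> I (f * g - f' * g').
Proof.
move=> hf hg; have -> : f * g - f' * g' = (f - f') * g + f' * (g - g') by ring.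
by apply: (idD idI); [apply: idMr|apply: (idM idI)].
Qed.

Lemma id_congX f g k : I (f - g) -> I (f ^+ k - g ^+ k).
Proof. by move=> h; rewrite subrXX; apply: idMr. Qed.

Variable n : nat.
(** The ideal generated by I in the polynomial ring over R, described coefficientwise. *)
Definition idS (f : {mpoly R[n]}) := forall m, I f@_m.

Lemma idS_ideal0 : idS 0. Proof. by move=> m; rewrite mcoeff0; apply: (id0 idI). Qed.

Lemma idSD (f g : {mpoly R[n]}) : idS f -> idS g -> idS (f + g).
Proof. by move=> hf hg m; rewrite mcoeffD; apply: (idD idI). Qed.

Lemma idSM (f g : {mpoly R[n]}) : idS g -> idS (f * g).
Proof. by move=> hg m; rewrite mcoeffM; apply: id_sum => mm _; apply: (idM idI). Qed.

Lemma idSC (c : R) : idS c%:MP <-> I c.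
Proof.
split=> [/(_ 0%MM)|Ic m]; first by rewrite mcoeffC eqxx mulr1.
by rewrite mcoeffC; apply: idMr.
Qed.

Lemma idS_deriv i (f : {mpoly R[n]}) : idS f -> idS f^`M(i).
Proof. by move=> hf m; rewrite mcoeff_deriv -mulr_natl; apply: (idM idI). Qed.

(** Dropping the terms with coefficients in I gives a representative whose leading coefficient, if
    nonzero, lies outside I. The induction makes one classical case distinction per term. *)
Lemma idS_split (f : {mpoly R[n]}) : exists f1 : {mpoly R[n]}, idS (f - f1) /\
  forall m, m \in msupp f1 -> f1@_m = f@_m /\ ~ I f@_m.
Proof.
elim/mpolyind: f => [|c m p mp c0 [p1 [hp Hp]]].
  by exists 0; rewrite subrr; split; [exact: idS_ideal0|move=> m; rewrite msupp0].
have pm : p@_m = 0 by apply/eqP; rewrite mcoeff_eq0.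
have coefm m' : (c *: 'X_[m] + p)@_m' = if m' == m then c else p@_m'.
  rewrite mcoeffD mcoeffZ mcoeffX eq_sym; case: eqP => [->|_]; first by rewrite pm mulr1 addr0.
  by rewrite mulr0 add0r.
have p1m : p1@_m = 0.
  apply/eqP; rewrite mcoeff_eq0; apply/negP=> h; have [E _] := Hp _ h.
  by move: h; rewrite mcoeff_msupp E pm eqxx.
have [Ic|nIc] := classic (I c).
  exists p1; split.
    rewrite -addrA; apply: idSD => //.
    by move=> m'; rewrite mcoeffZ mulrC; apply: (idM idI).
  move=> m' h; rewrite coefm; case: eqP => [E|_]; last exact: Hp.
  by move: h; rewrite E mcoeff_msupp p1m eqxx.
exists (c *: 'X_[m] + p1); split.
  by rewrite opprD addrACA subrr add0r.
have coefm1 m' : (c *: 'X_[m] + p1)@_m' = if m' == m then c else p1@_m'.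
  rewrite mcoeffD mcoeffZ mcoeffX eq_sym; case: eqP => [->|_]; first by rewrite p1m mulr1 addr0.
  by rewrite mulr0 add0r.
move=> m'; rewrite mcoeff_msupp coefm1 !coefm; case: (m' == m) => [_|].
  by split.
by rewrite -mcoeff_msupp; apply: Hp.
Qed.

(* Compare the leading coefficients that do not lie in [I]. *)
Lemma idS_zero_divisor (f g : {mpoly R[n]}) : idS (f * g) -> ~ idS f -> ~ idS g ->
  exists m1 m2 : 'X_{1..n}, [/\ ~ I f@_m1, ~ I g@_m2 & I (f@_m1 * g@_m2)].
Proof.
move=> hfg nf ng; have [f1 [hf Hf]] := idS_split f; have [g1 [hg Hg]] := idS_split g.
have nz (h h1 : {mpoly R[n]}) : ~ idS h -> idS (h - h1) -> mlead h1 \in msupp h1.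
  by move=> nh hh; apply: mlead_supp; apply/eqP => E; move: hh; rewrite E subr0.
have [Ef nIf] := Hf _ (nz _ _ nf hf); have [Eg nIg] := Hg _ (nz _ _ ng hg).
exists (mlead f1), (mlead g1); split=> //; rewrite -Ef -Eg -mleadcM.
have -> : f1 * g1 = f * g - ((f - f1) * g + f1 * (g - g1)) by ring.
rewrite mcoeffB; apply: idB; first exact: hfg.
by apply: idSD; [rewrite mulrC; apply: idSM|apply: idSM].
Qed.

End IdealPred.

Lemma idS_ideal (R : comNzRingType) (I : R -> Prop) n : is_ideal I -> is_ideal (@idS R I n).
Proof. by move=> idI; split; [apply: idS_ideal0|apply: idSD|apply: idSM]. Qed.

Lemma ideal_gen_ideal (R : comNzRingType) n (L : {mpoly R[n]} -> Prop) :
  is_ideal (ideal_gen L).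
Proof.
split.
- by exists [::]; rewrite big_nil.
- move=> f g [s [Hs ->]] [s' [Hs' ->]]; exists (s ++ s'); rewrite big_cat; split=> // c.
  by rewrite mem_cat => /orP[/Hs|/Hs'].
- move=> f g [s [Hs ->]]; exists [seq (f * c.1, c.2) | c <- s]; split.
    by move=> c /mapP[c' /Hs h ->].
  by rewrite big_map mulr_sumr; apply: eq_bigr => c _; rewrite mulrA.
Qed.

Lemma ideal_gen_mem (R : comNzRingType) n (L : {mpoly R[n]} -> Prop) f : L f -> ideal_gen L f.
Proof.
move=> Lf; exists [:: (1, f)]; rewrite big_seq1 mul1r; split=> // c.
by rewrite inE => /eqP->.
Qed.

Lemma ideal_gen_sub (R : comNzRingType) n (L J : {mpoly R[n]} -> Prop) :
  is_ideal J -> (forall f, L f -> J f) -> forall f, ideal_gen L f -> J f.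
Proof.
move=> idJ LJ f [s [Hs ->]]; rewrite big_seq; apply: (id_sum idJ) => c cs.
by apply: (idM idJ); apply/LJ/Hs.
Qed.

(* Hermann's bound controls the generators of the colon ideal by [c]. *)
Lemma bounded_regular (K : fieldType) n d D B (L : {mpoly K[n]} -> Prop)
    (c : {mpoly K[n]}) : (forall f, L f -> tdeg_le f d) -> (d <= D)%N ->
  (D <= B)%N -> (hermann_bound n 1 D <= B)%N -> prime_upto (ideal_gen L) B ->
  tdeg_le c D -> ~ ideal_gen L c -> forall f, ideal_gen L (c * f) -> ideal_gen L f.
Proof.
move=> dL dD DB hB pr dc nc f [s [Hs E]].
have idL := ideal_gen_ideal L.
pose A (i : 'I_(size s).+1) (j : unit) : {mpoly K[n]} :=
  if unlift ord0 i is Some k then - (nth (0, 0) s k).2 else c.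
pose v : {ffun 'I_(size s).+1 -> {mpoly K[n]}} :=
  [ffun i => if unlift ord0 i is Some k then (nth (0, 0) s k).1 else f].
have v0 : v ord0 = f by rewrite ffunE unlift_none.
rewrite -v0; apply: (@hermann K n 1 D _ _ A (fun v => ideal_gen L (v ord0))).
- by rewrite card_unit.
- move=> i j; rewrite /A; case: unlift => [k|] //.
  by rewrite /tdeg_le msizeN; apply: tdeg_leW dD _; apply/dL/Hs/mem_nth.
- by rewrite ffunE; apply: (id0 idL).
- by move=> u w Qu Qw; rewrite ffunE; apply: (idD idL).
- by move=> a u Qu; rewrite ffunE; apply: (idM idL).
(* A bounded solution of c u_0 - sum_k u_k l_k = 0 has c u_0 in the ideal with both factors within
   [B], so bounded primality applies, and c itself is excluded. *)
- move=> u uA du; have [] // := pr c (u ord0).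
  + exact: tdeg_leW dc.
  + exact: tdeg_leW (du ord0).
  have := uA tt; rewrite big_ord_recl {1}/A unlift_none mulrC => /eqP.
  rewrite addr_eq0 => /eqP ->; rewrite -sumrN; apply: (id_sum idL) => k _.
  rewrite /A liftK mulrN opprK; apply: (idM idL).
  by apply/ideal_gen_mem/Hs/mem_nth.
- move=> []; rewrite big_ord_recl {1}/A unlift_none v0 mulrC E (big_nth (0, 0)) big_mkord.
  by rewrite -big_split big1 //= => k _; rewrite ffunE /A liftK mulrN subrr.
Qed.

(** * Box monomials and the generic relation *)

Section DetBounds.
Variables (S : idomainType) (w : size_fun S) (e M : nat) (a : S) (B : 'M[S]_M).
Hypotheses (da : dle w e a) (dB : forall k l, dle w e (B k l)).
(** If a theta v = B v, this matrix at X = theta annihilates v: its determinant is a characteristic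
    polynomial with common denominator a. *)
Definition lin_mx : 'M[{poly S}]_M := \matrix_(k, l) (a%:P * 'X *+ (k == l) - (B k l)%:P).

Lemma dle_det_lin : dle (poly_size_fun w) (M * e) (\det lin_mx).
Proof.
apply: dle_det => k l; rewrite mxE; apply: dleB.
  apply/dle_polyP => j; rewrite coefMn coefMX coefC.
  case: (k == l); rewrite ?mulr1n ?mulr0n; last exact: dle0.
  by case: j => [|[|j]] //=; apply: dle0.
by apply/dle_polyP => j; rewrite coefC; case: eqP => // _; apply: dle0.
Qed.

Lemma size_det_lin : (size (\det lin_mx) <= M.+1)%N.
Proof.
have := @dle_det _ (size_size_fun S) 1 M lin_mx; rewrite muln1; apply=> k l.
rewrite mxE; apply: dleB; rewrite /dle /=.
  case: (k == l); rewrite ?mulr1n ?mulr0n ?size_poly0 //.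
  by rewrite mul_polyC (leq_trans (size_scale_leq _ _)) ?size_polyX.
by rewrite size_polyC; case: eqP.
Qed.

Lemma det_lin_neq0 (T : idomainType) (c : {rmorphism S -> T}) :
  c a != 0 -> (forall k l, c (B k l) = 0) -> \det lin_mx != 0.
Proof.
move=> ca0 cB; apply: contraTneq isT => E; have := congr1 (map_poly c) E; rewrite rmorph0.
rewrite -det_map_mx (_ : map_mx _ lin_mx = ((c a)%:P * 'X)%:M).
  rewrite det_scalar => /eqP; rewrite expf_eq0 mulf_eq0 polyC_eq0 polyX_eq0.
  by rewrite (negPf ca0) andbF.
apply/matrixP=> k l; rewrite !mxE rmorphB /= map_polyC /= cB polyC0 subr0.
by rewrite rmorphMn rmorphM /= map_polyX map_polyC.
Qed.

End DetBounds.

Lemma det_eigen_ideal (Q : comNzRingType) (I : Q -> Prop) M (N : 'M[Q]_M) (v : 'cV[Q]_M) k :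
  is_ideal I -> v k 0 = 1 -> (forall l, I ((N *m v) l 0)) -> I (\det N).
Proof.
move=> idI vk h; have E : \adj N *m (N *m v) = \det N *: v.
  by rewrite mulmxA mul_adj_mx mul_scalar_mx.
have -> : \det N = (\adj N *m (N *m v)) k 0 by rewrite E mxE vk mulr1.
by rewrite mxE; apply: (id_sum idI) => l _; apply: (idM idI).
Qed.

Section Box.
Variables (P R : idomainType) (wP : size_fun P) (wR : size_fun R) (n t : nat).
Variables (x : 'I_n -> R) (iota : {rmorphism P -> R}) (I : R -> Prop) (idI : is_ideal I).
Hypothesis dx : forall i, dle wR 1 (x i).
Variable G : 'I_n -> {poly P}.
Hypothesis sizeG : forall i, size (G i) = t.+2.
Hypothesis coefG : forall i k, dle wP t.+1 (G i)`_k.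
Hypothesis IG : forall i, I ((map_poly iota (G i)).[x i]).

(** Exponent vectors with entries at most t. Every [G i] has degree t+1, so these monomials span
    over P modulo I once the leading coefficients are inverted. *)
Definition box := {ffun 'I_n -> 'I_t.+1}.
Definition box_mnm (a : box) : R := \prod_i x i ^+ a i.
Definition box_lead : P := \prod_i lead_coef (G i).

Lemma card_box : #|{: box}| = (t.+1 ^ n)%N.
Proof. by rewrite card_ffun !card_ord. Qed.

Lemma tdeg_box_lead : dle wP (n * t.+1) box_lead.
Proof.
rewrite -[n in (n * _)%N]card_ord -sum_nat_const.
apply: (@dle_prod _ wP) => i _; exact: coefG.
Qed.

Lemma tdeg_box_mnm a : dle wR (n * t) (box_mnm a).
Proof.
rewrite -[n in (n * _)%N]card_ord -sum_nat_const.
apply: (@dle_prod _ wR) => i _.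
apply: (@dleW _ _ (1 * a i)); first by rewrite mul1n -ltnS.
exact/dleX/dx.
Qed.

Lemma box_lead_neq0 : box_lead != 0.
Proof.
by apply/prodf_neq0 => i _; rewrite lead_coef_eq0 -size_poly_gt0 sizeG.
Qed.

(** Multiplication by x_i stays in the box unless the exponent of x_i is t; then [G i] rewrites
    x_i^(t+1) at the cost of its leading coefficient. In the coefficients, another coefficient of
    [G i] replaces that leading one, so the bound is that of [box_lead]. *)
Lemma box_mul i a : exists w : box -> P, (forall b, dle wP (n * t.+1) (w b)) /\
  I (iota box_lead * x i * box_mnm a - \sum_b iota (w b) * box_mnm b).
Proof.
pose upd (k : 'I_t.+1) : box := [ffun j => if j == i then k else a j].
pose rest : R := \prod_(j | j != i) x j ^+ a j.
have updE k : box_mnm (upd k) = x i ^+ k * rest.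
  rewrite /box_mnm (bigD1 i) //= ffunE eqxx; congr (_ * _).
  by apply: eq_bigr => j ji; rewrite ffunE (negPf ji).
suff [c [dc Ic]] : exists c : 'I_t.+1 -> P, (forall k, dle wP (n * t.+1) (c k)) /\
    I (iota box_lead * x i ^+ (a i).+1 - \sum_k iota (c k) * x i ^+ k).
  exists (fun b => \sum_k c k *+ (b == upd k)); split.
    move=> b; apply: (@dle_sum _ wP) => k _.
    by case: (b == _); rewrite ?mulr1n ?mulr0n; [exact: dc|exact: dle0].
  have -> : \sum_b iota (\sum_k c k *+ (b == upd k)) * box_mnm b =
      (\sum_k iota (c k) * x i ^+ k) * rest.
    under eq_bigr do rewrite rmorph_sum mulr_suml.
    rewrite exchange_big mulr_suml; apply: eq_bigr => k _.
    rewrite (bigD1 (upd k)) //= eqxx mulr1n updE mulrA big1 ?addr0 // => b nb.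
    by rewrite (negPf nb) mulr0n rmorph0 mul0r.
  have -> : box_mnm a = x i ^+ a i * rest by rewrite /box_mnm (bigD1 i).
  by rewrite mulrA -[_ * x i * _]mulrA -exprS -mulrBl; apply: (idMr idI).
have [lt|ge] := ltnP (a i) t.
  exists (fun k => box_lead *+ (k == (a i).+1 :> nat)); split.
    move=> k; case: eqP => _; rewrite ?mulr1n ?mulr0n; first exact: tdeg_box_lead.
    exact: dle0.
  rewrite (bigD1 (Ordinal (lt : (a i).+1 < t.+1)%N)) //= eqxx mulr1n big1.
    by rewrite addr0 subrr; apply: (id0 idI).
  by move=> k; rewrite -val_eqE /= => /negPf->; rewrite mulr0n rmorph0 mul0r.
have Eat : nat_of_ord (a i) = t by apply/eqP; rewrite eqn_leq ge -ltnS ltn_ord.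
pose gi : P := \prod_(j | j != i) lead_coef (G j).
have El : box_lead = gi * lead_coef (G i) by rewrite /box_lead (bigD1 i) //= mulrC.
exists (fun k => - (gi * (G i)`_k)); split.
  move=> k; rewrite dleN.
  have n0 : (0 < n)%N by apply: leq_ltn_trans (ltn_ord i).
  rewrite -(prednK n0) mulSn addnC; apply: dleM; last exact: coefG.
  have -> : (n.-1 * t.+1 = \sum_(j : 'I_n | j != i) t.+1)%N.
    by rewrite sum_nat_const (cardC1 i) card_ord.
  by apply: (@dle_prod _ wP) => j _; apply: coefG.
rewrite (_ : _ - _ = iota gi * (map_poly iota (G i)).[x i]); first exact: (idM idI).
rewrite (@horner_coef_wide _ t.+2); last by rewrite (leq_trans (size_poly _ _)) // sizeG.
rewrite [in RHS]big_ord_recr /= mulrDr addrC; congr (_ + _).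
  rewrite mulr_sumr -sumrN; apply: eq_bigr => k _.
  by rewrite coef_map rmorphN rmorphM /= mulNr opprK mulrA.
by rewrite El rmorphM coef_map lead_coefE sizeG Eat /= mulrA.
Qed.

(** The hypothesis says, as an induction principle, that the x_i generate R as an algebra over P.
    Only the box monomials are bounded: the coefficients [w] have no degree bound, and linear
    algebra over P will deal with them. *)
Lemma box_reduce (f : R) :
  (forall S : R -> Prop, (forall f g, S f -> S g -> S (f + g)) ->
     (forall c f, S f -> S (iota c * f)) -> (forall i f, S f -> S (x i * f)) ->
     S 1 -> forall f, S f) -> exists E (w : box -> P),
  I (iota box_lead ^+ E * f - \sum_b iota (w b) * box_mnm b).
Proof.
move=> gen; pose ok f := exists E (w : box -> P),
  I (iota box_lead ^+ E * f - \sum_b iota (w b) * box_mnm b).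
have okD f1 f2 : ok f1 -> ok f2 -> ok (f1 + f2).
  move=> [E1 [w1 h1]] [E2 [w2 h2]]; exists (E1 + E2)%N.
  exists (fun b => box_lead ^+ E2 * w1 b + box_lead ^+ E1 * w2 b).
  rewrite (_ : _ - _ = iota box_lead ^+ E2 * (iota box_lead ^+ E1 * f1 - \sum_b iota (w1 b) * box_mnm b)
      + iota box_lead ^+ E1 * (iota box_lead ^+ E2 * f2 - \sum_b iota (w2 b) * box_mnm b)).
    by apply: (idD idI); apply: (idM idI).
  have -> : \sum_b iota (box_lead ^+ E2 * w1 b + box_lead ^+ E1 * w2 b) * box_mnm b =
      iota box_lead ^+ E2 * (\sum_b iota (w1 b) * box_mnm b) +
      iota box_lead ^+ E1 * (\sum_b iota (w2 b) * box_mnm b).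
    rewrite !mulr_sumr -big_split; apply: eq_bigr => b _ /=.
    by rewrite rmorphD !rmorphM !rmorphXn /=; ring.
  by rewrite exprD; ring.
have okP (c : P) f1 : ok f1 -> ok (iota c * f1).
  move=> [E [w h]]; exists E, (fun b => c * w b).
  rewrite (_ : _ - _ = iota c * (iota box_lead ^+ E * f1 - \sum_b iota (w b) * box_mnm b)).
    exact: (idM idI).
  rewrite mulrBr mulr_sumr; congr (_ - _); first by ring.
  by apply: eq_bigr => b _; rewrite rmorphM mulrA.
have ok0 : ok 0.
  by exists 0%N, (fun _ => 0); rewrite mulr0 big1 ?subrr => [|b _]; [exact: (id0 idI)|rewrite rmorph0 mul0r].
have okI f1 f2 : I (f1 - f2) -> ok f2 -> ok f1.
  move=> h [E [w hw]]; exists E, w.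
  rewrite (_ : _ - _ = iota box_lead ^+ E * (f1 - f2) +
     (iota box_lead ^+ E * f2 - \sum_b iota (w b) * box_mnm b)); last by ring.
  by apply: (idD idI) => //; apply: (idM idI).
have okl f1 : ok (iota box_lead * f1) -> ok f1.
  by move=> [E [w h]]; exists E.+1, w; rewrite exprSr -mulrA.
have okb b : ok (box_mnm b).
  exists 0%N, (fun b' => (b' == b)%:R); rewrite expr0 mul1r (bigD1 b) //= eqxx big1 => [|b' nb].
    by rewrite rmorph1 mul1r addr0 subrr; apply: (id0 idI).
  by rewrite (negPf nb) rmorph0 mul0r.
have okX i f1 : ok f1 -> ok (x i * f1).
  move=> [E [w h]]; suff H : ok (x i * (iota box_lead ^+ E * f1)).
    elim: (E) H => [|E' IH H]; first by rewrite expr0 mul1r.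
    by apply/IH/okl; move: H; rewrite exprS; congr ok; ring.
  have : ok (x i * \sum_b iota (w b) * box_mnm b).
    rewrite mulr_sumr; apply: (big_ind ok) => // b _.
    rewrite mulrCA; apply: (okP); apply: okl; rewrite mulrA.
    have [w' [_ h']] := box_mul i b; apply: okI h' _.
    by apply: (big_ind ok) => // b' _; apply: okP.
  by apply: okI; rewrite -mulrBr; apply: (idM idI).
have ok1 : ok 1.
  rewrite (_ : 1 = box_mnm [ffun=> ord0]) //; rewrite /box_mnm big1 // => i _.
  by rewrite ffunE expr0.
exact: gen okD okP okX ok1 f.
Qed.

Section Eval.
Variable ev : nat -> {rmorphism {poly {mpoly P[n]}} -> {mpoly R[n]}}.
Hypothesis evC : forall q c, ev q c%:P = map_mpoly iota c.
Hypothesis evX : forall q, ev q 'X = \sum_i (x i ^+ q)%:MP * 'X_i.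

Let wS := mpoly_size_fun wP n.
Let wV := poly_size_fun wS.

(* The determinant trick for the generic linear form [sum_i x_i s_i]. *)
Lemma generic_relation : (0 < n)%N ->
  exists F : {poly {mpoly P[n]}}, [/\ F != 0, dle wV (t.+1 ^ n * (n * t.+1)) F,
    (size F <= (t.+1 ^ n).+1)%N & idS I (ev 1 F)].
Proof.
move=> n0; have idQ := idS_ideal n idI.
pose th0 : {mpoly R[n]} := \sum_i (x i)%:MP * 'X_i.
have evX1 : ev 1 'X = th0.
  by rewrite evX; apply: eq_bigr => i _; rewrite expr1.
have [A HA] : exists A : 'I_n * box -> (box -> P), forall p,
   (forall b, dle wP (n * t.+1) (A p b)) /\
   I (iota box_lead * x p.1 * box_mnm p.2 - \sum_b iota (A p b) * box_mnm b).
  by apply: (@fin_all_exists _ _ (fun p (w : box -> P) => (forall b, dle wP (n * t.+1) (w b)) /\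
   I (iota box_lead * x p.1 * box_mnm p.2 - \sum_b iota (w b) * box_mnm b))) => -[i a]; apply: box_mul.
pose M := #|{: box}|; have EM : M = (t.+1 ^ n)%N by exact: card_box.
pose val_ (k : 'I_M) : box := enum_val k.
pose th := \matrix_(k < M, l < M) (\sum_i (A (i, val_ k) (val_ l))%:MP * 'X_i : {mpoly P[n]}).
pose lS : {mpoly P[n]} := box_lead%:MP.
have dC c : dle wP (n * t.+1) c -> dle wS (n * t.+1) c%:MP.
  move=> dc; apply/dle_mpolyP => m; rewrite mcoeffC.
  by case: (m == _); rewrite ?mulr1 ?mulr0 //; apply: dle0.
have dth k l : dle wS (n * t.+1) (th k l).
  rewrite mxE; apply: dle_sum => i _; rewrite -[X in dle _ X _]addn0; apply: dleM.
    by apply: dC; apply: (HA (i, val_ k)).1.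
  by apply/dle_mpolyP => m; rewrite mcoeffX; case: (_ == m); [apply: dle1|apply: dle0].
have dlS : dle wS (n * t.+1) lS by apply/dC/tdeg_box_lead.
exists (\det (lin_mx lS th)); split.
(* Setting all U_i to 0 kills the matrix of theta and leaves a power of [box_lead] times X. *)
- apply: (det_lin_neq0 (c := mcoeff (0%MM : 'X_{1..n}) : {rmorphism {mpoly P[n]} -> P})).
    by rewrite /= mpolyCK box_lead_neq0.
  move=> k l; rewrite mxE rmorph_sum big1 // => i _.
  by rewrite /= mcoeffCM mcoeffX mnm1_eq0 mulr0.
- by rewrite -EM; apply: dle_det_lin.
- by rewrite -EM; apply: size_det_lin.
(* The vector of box monomials is an eigenvector modulo I[U]; its entry at the zero exponent is 1,
   so the determinant itself lies in I[U]. *)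
pose bv : 'cV[{mpoly R[n]}]_M := \col_k (box_mnm (val_ k))%:MP.
rewrite -det_map_mx.
apply: (@det_eigen_ideal _ _ _ _ bv (enum_rank ([ffun=> ord0] : box)) idQ).
  rewrite mxE /val_ enum_rankK /box_mnm big1 // => i _.
  by rewrite ffunE expr0.
move=> k; rewrite mxE.
rewrite (eq_bigr (fun l => (iota box_lead)%:MP * th0 * (box_mnm (val_ l))%:MP *+ (k == l)
   - (\sum_i (iota (A (i, val_ k) (val_ l)))%:MP * 'X_i) * (box_mnm (val_ l))%:MP)) => [|l _]; last first.
  rewrite !mxE rmorphB rmorphMn rmorphM /= !evC evX1 map_mpolyC mulrBl mulrnAl; congr (_ *+ _ - _ * _).
  by rewrite rmorph_sum; apply: eq_bigr => i _; rewrite rmorphM /= map_mpolyC map_mpolyX.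
rewrite sumrB (bigD1 k) //= eqxx mulr1n big1 => [|l nl]; last first.
  by rewrite eq_sym (negPf nl) mulr0n.
rewrite addr0.
rewrite (_ : _ - _ = \sum_i (iota box_lead * x i * box_mnm (val_ k)
    - \sum_b iota (A (i, val_ k) b) * box_mnm b)%:MP * 'X_i).
  apply: (id_sum idQ) => i _; rewrite mulrC; apply: (idM idQ); apply/idSC => //.
  exact: (HA (i, val_ k)).2.
have -> : \sum_i (iota box_lead * x i * box_mnm (val_ k)
    - \sum_b iota (A (i, val_ k) b) * box_mnm b)%:MP * 'X_i =
  \sum_i ((iota box_lead * x i * box_mnm (val_ k))%:MP * 'X_i -
    \sum_l (iota (A (i, val_ k) (val_ l)) * box_mnm (val_ l))%:MP * 'X_i).
  apply: eq_bigr => i _; rewrite mpolyCB mulrBl -mulr_suml -raddf_sum; congr (_ - _ * _).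
  congr (_%:MP); rewrite (reindex val_) //; exact/onW_bij/enum_val_bij.
rewrite sumrB /th0 mulr_sumr mulr_suml; congr (_ - _).
  by apply: eq_bigr => i _; rewrite !mpolyCM; ring.
rewrite exchange_big; apply: eq_bigr => l _; rewrite mulr_suml; apply: eq_bigr => i _.
by rewrite mpolyCM mulrAC.
Qed.

End Eval.
End Box.

(** * Separable prime relations *)

Lemma dvdr_polyC_size (S : idomainType) (F : {poly S}) (c : S) :
  c != 0 -> dvdr F c%:P -> (size F <= 1)%N.
Proof.
have ar a b : (0 < a -> 0 < b -> 1 = (a + b).-1 -> b <= 1)%N by lia.
move=> c0 [G E]; have := congr1 (fun p : {poly S} => size p) E; rewrite size_polyC c0 => sz.
have /andP[G0 F0] : (G != 0) && (F != 0) by rewrite -negb_or -mulf_eq0 -E polyC_eq0.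
move: sz; rewrite size_mul //; apply: ar; by rewrite size_poly_gt0.
Qed.

(** The resultant eliminates X. It vanishes only if F and H share a nonconstant factor over the
    fraction field, and since F is prime it would then divide H. *)
Lemma primer_resultant (S : idomainType) (w : size_fun S) e (F H : {poly S}) :
  primer F -> (1 < size F)%N -> (1 < size H)%N -> ~ dvdr F H ->
  dle (poly_size_fun w) e F -> dle (poly_size_fun w) e H ->
  exists c u v, [/\ c != 0, c%:P = u * F + v * H
    & dle w (((size H).-1 + (size F).-1) * e) c].
Proof.
move=> prF sF sH ndv dF dH; have [[u v] /= _ E] := resultant_in_ideal sF sH.
exists (resultant F H), u, v; split=> //; last first.
  apply: dle_det => i j; rewrite Sylvester_mxE.
  by case: (split i) => k; case: (_ <= _)%N; rewrite ?mulr1n ?mulr0n ?dle0 //; apply/dle_polyP.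
rewrite resultant_eq0 -leqNgt leqNgt; apply/negP; set g := gcdp F H => sg.
have [[c k] /= c0 Ec] := dvdpP _ _ (dvdp_gcdl F H : g %| F).
have [[c' k'] /= c'0 Ec'] := dvdpP _ _ (dvdp_gcdr F H : g %| H).
have F0 : F != 0 by case: prF.
have [_ _ hF] := prF.
have [|[a Ea]|[a Ea]] := hF k g; first by exists c%:P; rewrite mul_polyC.
  have : dvdr g c%:P.
    by exists a; apply: (mulIf F0); rewrite mul_polyC Ec Ea; ring.
  by move/(dvdr_polyC_size c0); rewrite leqNgt sg.
have [|/(dvdr_polyC_size c'0)|//] := hF c'%:P H; last by rewrite leqNgt sF.
by exists (k' * a); rewrite mul_polyC Ec' Ea mulrA.
Qed.

Lemma map_poly_cons_additive (S : nzRingType) (d : S -> S) (F : {poly S}) c :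
  d 0 = 0 -> {morph d : y z / y + z} ->
  map_poly d (F * 'X + c%:P) = map_poly d F * 'X + (d c)%:P.
Proof.
move=> d0 dD; apply/polyP=> k; rewrite coef_map_id0 // !coefD !coefMX !coefC dD.
by case: k => [|k] /=; rewrite ?d0 ?coef_map_id0.
Qed.

Lemma deriv_cons (S : nzRingType) (F : {poly S}) c :
  (F * 'X + c%:P)^`() = F^`() * 'X + F.
Proof. by rewrite derivD derivM derivX derivC addr0 mulr1. Qed.

Lemma poly_chain_rule (A : nzRingType) (B : comNzRingType) (e : {rmorphism {poly A} -> B})
    (dA : A -> A) (dB : B -> B) y :
  dA 0 = 0 -> {morph dA : u v / u + v} -> {morph dB : u v / u + v} ->
  (forall u v, dB (u * v) = dB u * v + u * dB v) ->
  (forall c, dB (e c%:P) = e (dA c)%:P) -> dB (e 'X) = y ->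
  forall F, dB (e F) = e (map_poly dA F) + e F^`() * y.
Proof.
move=> dA0 dAD dBD dBM dBe dBX; elim/poly_ind => [|F c IH].
  have dB0 : dB 0 = 0 by apply: (addrI (dB 0)); rewrite -dBD !addr0.
  by rewrite map_poly0 deriv0 rmorph0 dB0 mul0r addr0.
rewrite map_poly_cons_additive // deriv_cons !rmorphD !rmorphM /= dBD dBM dBe IH dBX.
by ring.
Qed.

Lemma poly_hom_frob (A B : comNzRingType) (e1 e2 : {rmorphism {poly A} -> B})
    (sA : {rmorphism A -> A}) (sB : {rmorphism B -> B}) p :
  (forall c, e1 (sA c)%:P = sB (e2 c%:P)) -> e1 'X ^+ p = sB (e2 'X) ->
  forall F, e1 (map_poly sA F \Po 'X^p) = sB (e2 F).
Proof.
move=> eC eX; elim/poly_ind => [|F c IH].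
  by rewrite rmorph0 comp_poly0 !rmorph0.
rewrite rmorphD rmorphM /= map_polyX map_polyC comp_polyD comp_polyM comp_polyX comp_polyC.
by rewrite !rmorphD !rmorphM IH eC rmorphXn eX.
Qed.

Lemma expr_sum_pchar (A : comNzRingType) q (J : Type) (s : seq J) (F : J -> A) :
  [pchar A].-nat q -> (\sum_(i <- s) F i) ^+ q = \sum_(i <- s) F i ^+ q.
Proof.
move=> qA; have q0 : (0 < q)%N by case/andP: qA.
elim: s => [|i s IH]; first by rewrite !big_nil expr0n eqn0Ngt q0.
by rewrite !big_cons exprDn_pchar // IH.
Qed.

Lemma pchar_rmorph_nat (A B : nzRingType) (f : {rmorphism A -> B}) q :
  [pchar A].-nat q -> [pchar B].-nat q.
Proof. by apply: sub_in_pnat => p _; apply: (rmorph_pchar f). Qed.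

Lemma deriv_eq0_coef (A : idomainType) (F : {poly A}) k :
  F^`() = 0 -> F`_k = 0 \/ k%:R = 0 :> A.
Proof.
case: k => [|k] dF; first by right.
have := congr1 (fun p : {poly A} => p`_k) dF; rewrite coef_deriv coef0 -[F`_k.+1 *+ _]mulr_natr => /eqP.
by rewrite mulf_eq0 => /orP[]/eqP; [left|right].
Qed.

Lemma leq_size_mul (A : idomainType) (F G : {poly A}) :
  F != 0 -> G != 0 -> (size F <= size (F * G)%R)%N.
Proof.
move=> F0 G0; rewrite size_mul //.
have ar a b : (0 < b -> a <= (a + b).-1)%N by lia.
by apply: ar; rewrite size_poly_gt0.
Qed.

Lemma leq_pred2 a b : (a <= b)%N -> (a.-1 <= b.-1)%N.
Proof. lia. Qed.

Lemma dle_nat (A : idomainType) (w : size_fun A) e k : dle w e k%:R.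
Proof.
by elim: k => [|k IH]; [apply: dle0|rewrite mulrSr; apply: dleD => //; apply: dle1].
Qed.

Lemma dle_map_mderiv (A : idomainType) (w : size_fun A) n e i (G : {poly {mpoly A[n]}}) :
  dle (poly_size_fun (mpoly_size_fun w n)) e G ->
  dle (poly_size_fun (mpoly_size_fun w n)) e (map_poly (mderiv i) G).
Proof.
move=> bG; apply/dle_polyP => j; rewrite coef_map_id0 ?mderiv0 //; apply/dle_mpolyP => m.
rewrite mcoeff_deriv -mulr_natr -[e]addn0; apply: dleM; last exact: dle_nat.
by move/dle_polyP/(_ j)/dle_mpolyP: bG; apply.
Qed.

Lemma msize_mderiv (A : nzRingType) n i (a : {mpoly A[n]}) :
  a != 0 -> (msize a^`M(i) < msize a)%N.
Proof.
move=> a0; have sa : (0 < msize a)%N by rewrite lt0n msize_poly_eq0.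
rewrite -(prednK sa) ltnS msizeE; apply/bigmax_leqP_seq => m md _.
rewrite -ltnS prednK //; have : (mdeg (m + U_(i))%MM < msize a)%N; last first.
  by rewrite mdegD mdeg1 addn1.
apply: msize_mdeg_lt; move: md; rewrite !mcoeff_msupp mcoeff_deriv; apply: contra_neq => ->.
by rewrite mul0rn.
Qed.

(** If the derivative is nonzero, C is constant in X by degree; then C times the leading coefficient
    of G is the U_i-derivative of that coefficient, which has smaller degree. *)
Lemma dvd_mderiv_eq0 (A : idomainType) n i (G C : {poly {mpoly A[n]}}) :
  map_poly (mderiv i) G = C * G -> map_poly (mderiv i) G = 0.
Proof.
move=> E; have [->|G0] := eqVneq G 0; first by rewrite map_poly0.
rewrite E; have [->|C0] := eqVneq C 0; first by rewrite mul0r.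
have sC : (size C <= 1)%N.
  have ar a b : (0 < b -> (a + b).-1 <= b -> a <= 1)%N by lia.
  apply: (ar _ (size G)); first by rewrite size_poly_gt0.
  by rewrite -size_mul // -E size_poly.
move: C0 E; rewrite (size1_polyC sC) polyC_eq0 => c0 E; exfalso.
have lG0 : lead_coef G != 0 by rewrite lead_coef_eq0.
have := msize_mderiv i lG0; have -> : (lead_coef G)^`M(i) = C`_0 * lead_coef G.
  by rewrite lead_coefE -coefCM -E coef_map_id0 ?mderiv0.
rewrite msizeM //; have ar a b : (0 < a -> (a + b).-1 < b -> False)%N by lia.
by apply: ar; rewrite lt0n msize_poly_eq0.
Qed.

Section FrobeniusSubst.
Variables (A : idomainType) (n : nat).

(** Substitutes U_i^p for U_i and leaves the coefficients alone, since elements of P have no p-th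
    roots in general. *)
Definition spow (p : nat) : {mpoly A[n]} -> {mpoly A[n]} :=
  mmap (@mpolyC n A) (fun i => 'X_i ^+ p).
HB.instance Definition _ p := GRing.RMorphism.on (spow p).

Lemma spowC p c : spow p c%:MP = c%:MP. Proof. exact: mmap_mpolyC. Qed.
Lemma spowU p i : spow p 'X_i = 'X_i ^+ p. Proof. exact: mmap_mpolyU. Qed.

Lemma spowX p m : spow p 'X_[m] = 'X_[m *+ p].
Proof.
rewrite /spow mmapX /mmap1 mpolyXE_id; apply: eq_bigr => i _.
by rewrite mulmnE -exprM mulnC.
Qed.

Lemma mcoeff_spow p m f : (0 < p)%N -> (spow p f)@_(m *+ p) = f@_m.
Proof.
move=> p0; rewrite (mpolyE f) !rmorph_sum !raddf_sum /=; apply: eq_bigr => m' _.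
rewrite -mul_mpolyC rmorphM /= spowC spowX !mcoeffCM !mcoeffX; congr (_ * (_ : bool)%:R).
apply/eqP/eqP => [/mnmP E|-> //]; apply/mnmP => i.
by have /eqP := E i; rewrite !mulmnE eqn_pmul2r // => /eqP.
Qed.

Lemma idS_spow (I : A -> Prop) p f : (0 < p)%N -> idS I (spow p f) -> idS I f.
Proof. by move=> p0 h m; rewrite -(mcoeff_spow m f p0). Qed.

Lemma spow_root p (a : {mpoly A[n]}) : p \in [pchar A] -> (forall i, a^`M(i) = 0) ->
  exists2 b, a = spow p b & forall m, b@_m = a@_(m *+ p).
Proof.
move=> pA da; have p0 : (0 < p)%N := prime_gt0 (pcharf_prime pA).
have dvd m i : m \in msupp a -> (p %| m i)%N.
  move=> ma; have [->|mi0] := eqVneq (m i) 0%N; first exact: dvdn0.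
  rewrite (dvdn_pcharf pA); have := congr1 (mcoeff (m - U_(i))%MM) (da i).
  rewrite mcoeff_deriv mcoeff0 submK ?lep1mP //.
  have -> : ((m - U_(i))%MM i).+1 = m i by rewrite mnmBE mnm1E eqxx subn1 prednK // lt0n.
  by move=> /eqP; rewrite -[a@_m *+ _]mulr_natr mulf_eq0 mcoeff_eq0 ma.
exists (\sum_(m <- msupp a) a@_m *: 'X_[[multinom (m i %/ p)%N | i < n]]); last first.
  move=> m; rewrite raddf_sum /= [in RHS](mpolyE a) raddf_sum /= !big_seq.
  apply: eq_bigr => m' m'a; rewrite !mcoeffZ !mcoeffX; congr (_ * (_ : bool)%:R).
  apply/eqP/eqP => [<-|->]; apply/mnmP => i; rewrite ?mulmnE mnmE ?mulmnE ?mulnK //.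
  by rewrite divnK // dvd.
rewrite rmorph_sum /= [LHS]mpolyE big_seq [RHS]big_seq; apply: eq_bigr => m ma.
rewrite -!mul_mpolyC rmorphM /= spowC spowX; congr (_ * 'X_[_]); apply/mnmP => i.
by rewrite mulmnE mnmE divnK // dvd.
Qed.

End FrobeniusSubst.

Section Core.
Variables (P R : idomainType) (wP : size_fun P) (wR : size_fun R) (n : nat).
Variables (x : 'I_n -> R) (iota : {rmorphism P -> R}) (I : R -> Prop) (idI : is_ideal I).
Hypothesis dx : forall i, dle wR 1 (x i).
Hypothesis diota : forall e c, dle wP e c -> dle wR e (iota c).
Variable ev : nat -> {rmorphism {poly {mpoly P[n]}} -> {mpoly R[n]}}.
Hypothesis evC : forall q c, ev q c%:P = map_mpoly iota c.
Hypothesis evX : forall q, ev q 'X = \sum_i (x i ^+ q)%:MP * 'X_i.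

Let wS := mpoly_size_fun wP n.
Let wV := poly_size_fun wS.
Let wQ := mpoly_size_fun wR n.
Implicit Types (F H : {poly {mpoly P[n]}}).

Lemma ev_dle q e s F : dle wV e F -> (size F <= s.+1)%N -> dle wQ (e + q * s) (ev q F).
Proof.
move=> dF sF; rewrite -[F]coefK poly_def rmorph_sum /=; apply: dle_sum => k _.
rewrite -mul_polyC rmorphM rmorphXn /= evC; apply: dleM.
  apply/dle_mpolyP => m; rewrite mcoeff_map_mpoly; apply: diota.
  by move/dle_polyP/(_ k)/dle_mpolyP: dF; apply.
apply: (@dleW _ _ (q * k)); first by rewrite leq_mul2l -ltnS (leq_trans (ltn_ord k)) ?orbT.
apply: dleX; rewrite evX; apply: dle_sum => i _; rewrite -[X in dle _ X _]addn0; apply: dleM.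
  apply/dle_mpolyP => m; rewrite mcoeffC; case: (m == _); last by rewrite mulr0 dle0.
  by rewrite mulr1 -[X in dle _ X _]mul1n; apply: dleX.
by apply/dle_mpolyP => m; rewrite mcoeffX; case: (_ == m); [apply: dle1|apply: dle0].
Qed.

Lemma ev_deriv q i F : (ev q F)^`M(i) =
  ev q (map_poly (mderiv i) F) + ev q F^`() * (x i ^+ q)%:MP.
Proof.
have dth : (ev q 'X)^`M(i) = (x i ^+ q)%:MP.
  rewrite evX raddf_sum (bigD1 i) //= mderiv_mulC mderivX mnm1E eqxx scale1r big1 => [|j ji].
    have -> : (U_(i) - U_(i))%MM = 0%MM :> 'X_{1..n} by apply/mnmP=> j; rewrite mnmBE subnn mnm0E.
    by rewrite mpolyX0 mulr1 addr0.
  by rewrite mderiv_mulC mderivX mnm1E (negPf ji) scale0r mulr0.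
apply: poly_chain_rule => //.
- exact: mderiv0.
- exact: mderivD.
- exact: mderivD.
- exact: mderivM.
move=> c; rewrite !evC; apply/mpolyP=> m.
by rewrite mcoeff_deriv !mcoeff_map_mpoly /= mcoeff_deriv rmorphMn.
Qed.

(** The p-th power of sum_i x_i^q U_i is sum_i x_i^(qp) U_i^p. A relation in X^p and the U_i^p at
    level q thus comes from one of lower degree at level qp. *)
Lemma ev_frob q p F : p \in [pchar P] ->
  ev q (map_poly (@spow P n p) F \Po 'X^p) = spow p (ev (q * p) F).
Proof.
move=> pP; have p0 := prime_gt0 (pcharf_prime pP); apply: poly_hom_frob => [c|].
  rewrite !evC; apply: (@mpoly_hom_ext _ _ _ (map_mpoly iota \o @spow P n p)
    (@spow R n p \o map_mpoly iota)) => [a|i] /=.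
    by rewrite spowC !map_mpolyC spowC.
  by rewrite spowU rmorphXn /= !map_mpolyX spowU.
have pQ : [pchar {mpoly R[n]}].-nat p.
  apply: (pchar_rmorph_nat (@mpolyC n R)); apply: (pchar_rmorph_nat iota).
  by rewrite pnatE ?(pcharf_prime pP).
rewrite !evX expr_sum_pchar // rmorph_sum; apply: eq_bigr => i _.
by rewrite rmorphM /= spowC spowU exprMn -rmorphXn exprM.
Qed.

(** [e0] will bound the coefficients of a relation and [M] will bound q times its degree in X, so
    that a relation evaluates to polynomials with coefficients of degree at most e0 + M. *)
Variables (e0 M T B : nat).
Hypothesis I1 : ~ I 1.
Hypothesis prI : forall f g, dle wR B f -> dle wR B g -> I (f * g) -> I f \/ I g.
Hypothesis indep : forall c, dle wP T c -> I (iota c) -> c = 0.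
Hypothesis ufdP : ufd P.
Hypothesis hB : (e0 + M <= B)%N.

Let prS (f g : {mpoly R[n]}) : dle wQ B f -> dle wQ B g -> idS I (f * g) -> idS I f \/ idS I g.
Proof.
move=> /dle_mpolyP df /dle_mpolyP dg fg; apply: NNPP => /not_or_and[nf ng].
by have [m1 [m2 [n1 n2 /prI[]]]] := idS_zero_divisor idI fg nf ng.
Qed.

(* [F] annihilates, modulo [I], the image of the generic linear form under the
   Frobenius power [q]; passing to larger [q] is what makes [F] separable. *)
Definition candidate q F := [/\ [pchar P].-nat q, F != 0, dle wV e0 F,
  (q * (size F).-1 <= M)%N & idS I (ev q F)].

(** P[U][X] is factorial, and every partial product of the factorization divides F, hence obeys its
    bounds, so bounded primality can be applied along the list of primes. *)
Lemma prime_candidate q F : candidate q F ->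
  exists G, [/\ candidate q G, primer G & (size G <= size F)%N].
Proof.
case=> qP F0 dF sF IF; have idQ := idS_ideal n idI.
have [s [Hs [u Uu EF]]] := ufd_poly (@ufd_mpoly P n ufdP) F0.
have factor G H : F = G * H -> [/\ G != 0, dle wV e0 G & (size G <= size F)%N].
  move=> E; have /andP[G0 H0] : (G != 0) && (H != 0) by rewrite -negb_or -mulf_eq0 -E.
  split=> //; first by apply: (@dle_mulKr _ wV _ _ H) => //; rewrite -E.
  by rewrite E; apply: leq_size_mul.
have evB G H : F = G * H -> dle wQ B (ev q G).
  move=> /factor[G0 dG sG]; apply: dleW hB _; apply: (@dleW _ _ (e0 + q * (size G).-1)).
    rewrite leq_add2l; apply: leq_trans sF; rewrite leq_mul2l; apply/orP; right.
    exact: leq_pred2.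
  by apply: ev_dle => //; rewrite prednK // size_poly_gt0.
suff [G [Gs [H EH] IG]] : exists G, [/\ G \in s, exists H, F = G * H & idS I (ev q G)].
  have [G0 dG sG] := factor _ _ EH.
  exists G; split=> //; last exact: Hs.
  split=> //; apply: leq_trans sF; rewrite leq_mul2l; apply/orP; right.
  exact: leq_pred2.
have evu : ~ idS I (ev q u).
  move=> Iu; have := @idMr _ _ idQ _ (ev q u^-1) Iu; rewrite -rmorphM divrr // rmorph1.
  by move=> /(_ 0%MM); rewrite mcoeff1 eqxx.
have [H EH] : exists H, F = (u * \prod_(p <- s) p) * H by exists 1; rewrite mulr1.
have : idS I (ev q (u * \prod_(p <- s) p)) by rewrite -EF.
elim: {EF IF} s {Hs} H EH => [|p s IH] H EH; first by rewrite big_nil mulr1 => /evu.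
rewrite big_cons mulrCA rmorphM => /prS[].
- by apply: (evB _ (u * \prod_(j <- s) j * H)); rewrite EH big_cons; ring.
- by apply: (evB _ (p * H)); rewrite EH big_cons; ring.
- move=> Ip; exists p; split; rewrite ?mem_head //.
  by exists (u * \prod_(j <- s) j * H); rewrite EH big_cons; ring.
move=> /(IH (p * H))[|G [Gs HG IG]]; first by rewrite EH big_cons; ring.
by exists G; split=> //; rewrite in_cons Gs orbT.
Qed.

(** F acts as a minimal polynomial: otherwise the resultant of F and H is a nonzero element of P[U],
    with coefficients of degree at most [T], whose image lies in I[U], against independence. *)
Lemma candidate_dvd q F H e1 h : candidate q F -> primer F -> dle wV e1 H ->
  (size H <= h.+1)%N -> ((M + h).+1 * maxn e0 e1 <= T)%N -> idS I (ev q H) -> dvdr F H.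
Proof.
case=> qP F0 dF sF IF prF dH sH hT IH; have idQ := idS_ideal n idI.
have q0 : (0 < q)%N by case/andP: qP.
have noC c : dle wS T c -> idS I (ev q c%:P) -> c = 0.
  move=> /dle_mpolyP dc Ic; apply/mpolyP => m; rewrite mcoeff0; apply: indep => //.
  by have := Ic m; rewrite evC mcoeff_map_mpoly.
have sF' : ((size F).-1 <= M)%N by apply: leq_trans sF; rewrite leq_pmull.
have hTm : (maxn e0 e1 <= T)%N by apply: leq_trans hT; rewrite leq_pmull.
have [e0T e1T] : (e0 <= T)%N /\ (e1 <= T)%N.
  by split; apply: leq_trans hTm; rewrite ?leq_maxl ?leq_maxr.
have [s1|s1] := leqP (size F) 1.
  move: F0; rewrite (size1_polyC s1) polyC_eq0 (noC F`_0) ?eqxx //.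
    by apply: dleW e0T _; apply: (dle_polyP _ _ _ dF).
  by rewrite -size1_polyC.
have [t1|t1] := leqP (size H) 1.
  exists 0; rewrite mul0r (size1_polyC t1) (noC H`_0) ?polyC0 //.
    by apply: dleW e1T _; apply: (dle_polyP _ _ _ dH).
  by rewrite -size1_polyC.
apply: NNPP => ndv; have [c [u [v [/eqP c0 Ec dc]]]] :=
  primer_resultant prF s1 t1 ndv (dleW (leq_maxl e0 e1) dF) (dleW (leq_maxr e0 e1) dH).
apply: c0; apply: noC.
  apply: dleW dc; apply: leq_trans hT; rewrite leq_mul2r; apply/orP; right.
  have ar a b : (a <= h.+1 -> b <= M -> a.-1 + b <= (M + h).+1)%N by lia.
  exact: ar.
by rewrite Ec rmorphD !rmorphM; apply: (idD idQ); apply: (idM idQ).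
Qed.

Lemma candidate_size q F : candidate q F -> (e0 <= T)%N -> (1 < size F)%N.
Proof.
case=> qP F0 dF sF IF e0T; rewrite ltnNge; apply/negP => s1.
case/negP: F0; rewrite (size1_polyC s1) polyC_eq0; apply/eqP/mpolyP => m.
rewrite mcoeff0; apply: indep.
  by apply: dleW e0T _; move/dle_polyP/(_ 0%N)/dle_mpolyP: dF; apply.
by have := IF m; rewrite {1}(size1_polyC s1) evC mcoeff_map_mpoly.
Qed.

(** Take a prime candidate G of least size over all q. If G' = 0, [ev_deriv] puts its derivatives in
    the U_i into I[U], so G divides them and they vanish by degree. Then G is a polynomial in X^p
    and the U_i^p, and replacing these by X and the U_i gives a smaller candidate at level qp. *)
Lemma separable_candidate F : candidate 1 F -> ((M + M).+1 * e0 <= T)%N ->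
  exists q G, [/\ candidate q G, primer G & G^`() != 0].
Proof.
move=> cF hT; have idQ := idS_ideal n idI.
have e0T : (e0 <= T)%N by apply: leq_trans hT; rewrite leq_pmull.
have [k [q [G [[cG prG sG] Hmin]]]] : exists k q G, [/\ candidate q G, primer G & size G = k] /\
    forall q' G', candidate q' G' -> (k <= size G')%N.
  have [|k [q [G [cG sG]]] Hk] := @classic_min (fun k => exists q G, candidate q G /\ size G = k).
    by exists (size F), 1%N, F.
  have Hk' q' G' : candidate q' G' -> (k <= size G')%N.
    by move=> cG'; rewrite leqNgt; apply/negP => /Hk; apply; exists q', G'.
  have [G1 [cG1 prG1 sG1]] := prime_candidate cG.
  exists k, q, G1; split=> //; split=> //; apply/eqP; rewrite eqn_leq.
  by apply/andP; split; [rewrite -sG | apply: Hk' cG1].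
exists q, G; split=> //; apply/eqP => dG.
have [qP G0 bG qG IG] := cG.
have q0 : (0 < q)%N by case/andP: qP.
have sGM : (size G <= M.+1)%N.
  have ar a : (a.-1 <= M -> a <= M.+1)%N by lia.
  by apply: ar; apply: leq_trans qG; rewrite leq_pmull.
have sG1 := candidate_size cG e0T.
have dGi i : map_poly (mderiv i) G = 0.
  have IdG : idS I (ev q (map_poly (mderiv i) G)).
    by have := idS_deriv idI i IG; rewrite ev_deriv dG rmorph0 mul0r addr0.
  have bdG : dle wV e0 (map_poly (mderiv i) G) by apply: dle_map_mderiv.
  have sdG : (size (map_poly (mderiv i) G) <= M.+1)%N by rewrite (leq_trans (size_poly _ _)).
  have hT' : ((M + M).+1 * maxn e0 e0 <= T)%N by rewrite maxnn.
  have [C EC] := candidate_dvd cG prG bdG sdG hT' IdG.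
  exact: dvd_mderiv_eq0 EC.
have Gder j i : (G`_j)^`M(i) = 0.
  by rewrite -(coef_map_id0 (f := mderiv i)) ?mderiv0 // dGi coef0.
have lG0 : G`_(size G).-1 != 0 by rewrite -lead_coefE lead_coef_eq0.
have [p pP] : exists p, p \in [pchar P].
  have [/eqP|E] := deriv_eq0_coef (size G).-1 dG; first by rewrite (negPf lG0).
  have [||p pS] := @natf0_pchar {mpoly P[n]} (size G).-1; last first.
  - exists p; exact: (rmorph_pchar (mcoeff (0%MM : 'X_{1..n}) : {rmorphism {mpoly P[n]} -> P}) pS).
  - exact/eqP.
  - by case: (size G) sG1 => [|[]].
have pS : p \in [pchar {mpoly P[n]}] := rmorph_pchar (@mpolyC n P) pP.
have p1 := prime_gt1 (pcharf_prime pP); have p0 := ltnW p1.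
pose N := ((size G).-1 %/ p)%N.
have [c Hc] : exists c : 'I_N.+1 -> {mpoly P[n]}, forall k : 'I_N.+1,
    G`_(p * k) = spow p (c k) /\ forall m, (c k)@_m = G`_(p * k)@_(m *+ p).
  apply: (@fin_all_exists _ _ (fun (k : 'I_N.+1) b =>
     G`_(p * k) = spow p b /\ forall m, b@_m = G`_(p * k)@_(m *+ p))) => j.
  by have [b Eb Hb] := spow_root pP (Gder (p * j)%N); exists b.
pose H := \poly_(j < N.+1) c (inord j).
have GE : G = map_poly (@spow P n p) H \Po 'X^p.
  apply/polyP=> j; rewrite coef_comp_poly_Xn //; case: ifP => [pj|npj]; last first.
    by have [//|/eqP] := deriv_eq0_coef j dG; rewrite -(dvdn_pcharf pS) npj.
  rewrite coef_map coef_poly; case: ltnP => [lt|ge].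
    by have [E _] := Hc (inord (j %/ p)); apply: etrans _ E; rewrite inordK // mulnC divnK.
  rewrite raddf0 nth_default // leqNgt; apply: contraTN ge => ltj; rewrite -ltnNge ltnS.
  by apply: leq_div2r; case: (size G) ltj.
have H0 : H != 0 by apply: contra_neq G0 => H0; rewrite GE H0 rmorph0 comp_poly0.
have sH : ((size H).-1 <= N)%N by have := size_poly N.+1 (fun j => c (inord j)); rewrite -/H; lia.
have cH : candidate (q * p) H.
  split=> //.
  - by rewrite pnatM qP pnatE ?(pcharf_prime pP).
  - apply/dle_polyP => j; rewrite coef_poly; case: ltnP => [lt|_]; last exact: dle0.
    apply/dle_mpolyP => m; have [_ ->] := Hc (inord j).
    by move/dle_polyP/(_ (p * inord j)%N)/dle_mpolyP: bG; apply.
  (* The degree in X drops by the factor p that q gains, so the product stays at most [M]. *)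
  - apply: leq_trans qG; rewrite -mulnA leq_mul2l; apply/orP; right.
    by apply: leq_trans (_ : p * N <= _)%N; [rewrite leq_mul2l sH orbT|rewrite mulnC leq_trunc_div].
  - by apply: (@idS_spow _ _ I p) => //; rewrite -ev_frob // -GE.
have := Hmin _ _ cH; rewrite -sG leqNgt => /negP; apply.
apply: (@leq_ltn_trans N.+1); first exact: size_poly.
rewrite /N; have ar a : (1 < a -> (a.-1 %/ p).+1 < a)%N.
  by case: a => [|[|a]] // _; rewrite /= (ltnS _ a.+1) ltn_Pdiv.
exact: ar.
Qed.

End Core.

(** * The generic zero *)

(** The exponent of the leading coefficient is fixed to [N], not to the number of steps performed,
    so that remainders of several H can be combined linearly. *)
Lemma pseudo_division (S : idomainType) (w : size_fun S) e a (F : {poly S}) :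
  F != 0 -> dle (poly_size_fun w) e F -> forall N H,
  dle (poly_size_fun w) a H -> (size H <= N)%N ->
  exists C E, [/\ (lead_coef F ^+ N)%:P * H = C * F + E, (size E < size F)%N
    & dle (poly_size_fun w) (a + N * e) E].
Proof.
move=> F0 dF; have dl : dle w e (lead_coef F) by apply: (dle_polyP _ _ _ dF).
have dC c k : dle w k c -> dle (poly_size_fun w) k c%:P.
  by move=> dc; apply/dle_polyP => j; rewrite coefC; case: eqP => // _; apply: dle0.
move=> N; elim: N a => [|N IH] a H dH sH.
  exists 0, 0; rewrite size_poly0 size_poly_gt0 F0 mul0r addr0; split=> //; last exact: dle0.
  by move: sH; rewrite leqn0 size_poly_eq0 => /eqP->; rewrite mulr0.
have [lt|ge] := ltnP (size H) (size F).
  exists 0, ((lead_coef F ^+ N.+1)%:P * H); rewrite mul0r add0r; split=> //.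
    by rewrite mul_polyC (leq_ltn_trans (size_scale_leq _ _)).
  by rewrite addnC mulnC; apply: dleM => //; apply/dC/dleX.
pose H' := (lead_coef F)%:P * H - (lead_coef H)%:P * 'X^(size H - size F) * F.
have dX k : dle (poly_size_fun w) 0 ('X^k : {poly S}).
  by apply/dle_polyP => j; rewrite coefXn; apply: dle_nat.
have dH' : dle (poly_size_fun w) (a + e) H'.
  apply: dleB; first by rewrite addnC; apply: dleM => //; apply: dC.
  apply: dleM => //; rewrite -[a]addn0; apply: dleM => //.
  by apply: dC; apply: (dle_polyP _ _ _ dH).
have sH' : (size H' <= N)%N.
  have H0 : H != 0 by rewrite -size_poly_gt0 (leq_trans _ ge) // size_poly_gt0.
  have s1 : (0 < size H)%N by rewrite size_poly_gt0.
  apply/leq_sizeP => j Nj; rewrite coefB -mulrA !coefCM mulrC coefXnM.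
  have sj : ((size H).-1 <= j)%N by rewrite (leq_trans _ Nj) //; case: (size H) sH.
  have [E|ne] := eqVneq j (size H).-1.
    rewrite ltnNge E; have -> : (size H - size F <= (size H).-1)%N.
      by rewrite -size_poly_gt0 in F0; lia.
    have -> : ((size H).-1 - (size H - size F) = (size F).-1)%N.
      by rewrite -size_poly_gt0 in F0; lia.
    by rewrite -!lead_coefE mulrC subrr.
  have lj : (size H <= j)%N by rewrite -(prednK s1) ltn_neqAle eq_sym ne.
  rewrite nth_default // mul0r; case: ltnP => [_|_]; first by rewrite mulr0 subrr.
  have ar f h : (f <= h -> h <= j -> f <= j - (h - f))%N by lia.
  by rewrite [F`__]nth_default ?mulr0 ?subrr //; apply: ar.
have [C [E [EC sE dE]]] := IH _ _ dH' sH'.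
exists (C + (lead_coef F ^+ N)%:P * (lead_coef H)%:P * 'X^(size H - size F)), E; split=> //.
  rewrite mulrDl addrAC -EC /H' exprSr polyCM; ring.
by move: dE; rewrite mulSn addnA.
Qed.

Section Parametrize.
Variables (P R : idomainType) (wP : size_fun P) (wR : size_fun R) (n : nat).
Variables (x : 'I_n -> R) (iota : {rmorphism P -> R}) (I : R -> Prop) (idI : is_ideal I).
Hypothesis dx : forall i, dle wR 1 (x i).
Hypothesis diota : forall e c, dle wP e c -> dle wR e (iota c).
Variable ev : nat -> {rmorphism {poly {mpoly P[n]}} -> {mpoly R[n]}}.
Hypothesis evC : forall q c, ev q c%:P = map_mpoly iota c.
Hypothesis evX : forall q, ev q 'X = \sum_i (x i ^+ q)%:MP * 'X_i.
Variables (e0 M T D d : nat).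
Hypothesis indep : forall c, dle wP T c -> I (iota c) -> c = 0.
Hypothesis regI : forall c, dle wR D c -> ~ I c -> forall f, I (c * f) -> I f.
Hypothesis hD : (e0 + M <= D)%N.

Let wS := mpoly_size_fun wP n.
Let wV := poly_size_fun wS.
Let wQ := mpoly_size_fun wR n.
Local Notation V := {poly {mpoly P[n]}}.

Variables (q : nat) (Phi : V).
Hypothesis candPhi : candidate wP I ev e0 M q Phi.
Hypothesis prPhi : primer Phi.
Hypothesis Phi'0 : Phi^`() != 0.
Hypothesis hT1 : ((M + M).+1 * e0 <= T)%N.

Local Notation delta := (ev q Phi^`()).
Let idQ := idS_ideal n idI.

Let q0 : (0 < q)%N. Proof. by case: candPhi => /andP[]. Qed.

Let sPhi : (size Phi <= M.+1)%N.
Proof.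
case: candPhi => _ _ _ h _; have ar a : (a.-1 <= M -> a <= M.+1)%N by lia.
by apply: ar; apply: leq_trans h; rewrite leq_pmull.
Qed.

Let bPhi' : dle wV e0 Phi^`().
Proof.
apply/dle_polyP => j; rewrite coef_deriv -mulr_natr -[e0]addn0; apply: dleM; last exact: dle_nat.
by case: candPhi => _ _ /dle_polyP.
Qed.

Lemma ndvd_deriv : ~ dvdr Phi Phi^`().
Proof.
case=> C E; have C0 : C != 0 by apply: contra_neq Phi'0 => C0; rewrite E C0 mul0r.
have Phi0 : Phi != 0 by case: prPhi.
have le : (size Phi <= size (Phi * C)%R)%N by apply: leq_size_mul.
by have := lt_size_deriv Phi0; rewrite E mulrC ltnNge le.
Qed.

Lemma delta_notin : ~ idS I delta.
Proof.
move=> h; apply: ndvd_deriv.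
apply: (candidate_dvd idI evC indep hD candPhi prPhi bPhi' (h := M)) => //.
  apply: leq_trans sPhi; exact: leq_trans (size_poly _ _) (leq_pred _).
by rewrite maxnn.
Qed.

Lemma delta_regular g : idS I (delta * g) -> idS I g.
Proof.
move=> h; apply: NNPP => ng.
have [m1 [m2 [n1 n2 h12]]] := idS_zero_divisor idI h delta_notin ng.
apply: n2; apply: regI h12 => //; apply: dleW hD _.
have : dle wQ (e0 + M) delta; last by move/dle_mpolyP.
case: candPhi => _ _ _ hq _; apply: (@dleW _ _ (e0 + q * (size Phi).-1)).
  by rewrite leq_add2l.
apply: (ev_dle dx diota evC evX q bPhi').
exact: leq_trans (size_poly _ _) (leqnSn _).
Qed.

Lemma delta_regularX k g : idS I (delta ^+ k * g) -> idS I g.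
Proof.
by elim: k g => [|k IH] g; rewrite ?expr0 ?mul1r // exprS -mulrA => /delta_regular/IH.
Qed.

Variables (nu : 'I_n -> V) (e2 h2 : nat).
Hypothesis h2_1 : (M <= h2)%N.
Hypothesis e0e2 : (e0 <= e2)%N.
Hypothesis nuI : forall i, idS I (ev q (nu i) - delta * (x i ^+ q)%:MP).
Hypothesis dnu : forall i, dle wV e2 (nu i).
Hypothesis snu : forall i, (size (nu i) <= h2.+1)%N.
Hypothesis hT2 : ((M + d * h2).+1 * maxn e0 (d * e2) <= T)%N.

Local Notation tf := (@tofrac V).
Variable psi : {rmorphism R -> {fraction V}}.
Hypothesis psi_iota : forall c, psi (iota c) = tf ((c%:MP)%:P ^+ q).
Hypothesis psi_x : forall i, tf Phi^`() * psi (x i) = tf (nu i).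

(** The degree filtration of R is generated by the x_i in degree 1 and constants of P in degree 0;
    stating it as an induction principle keeps R abstract. *)
Hypothesis Rfilt : forall S : nat -> R -> Prop,
  (forall k f g, S k f -> S k g -> S k (f + g)) ->
  (forall k l f g, S k f -> S l g -> S (k + l)%N (f * g)) ->
  (forall i, S 1%N (x i)) -> (forall c, dle wP 0 c -> S 0%N (iota c)) ->
  (forall k f, S k f -> S k.+1 f) -> forall k f, dle wR k f -> S k f.

(* [psi] sends [x i] to [nu i / Phi^`()], the coordinate of the generic zero read
   off from the derivatives of [Phi]; it restricts to the [q]-th power on [P]. *)
Definition numer k f H := [/\ tf H = tf Phi^`() ^+ k * psi f,
  idS I (ev q H - delta ^+ k * (f ^+ q)%:MP), dle wV (k * e2) H & (size H <= (k * h2).+1)%N].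

Let qR : [pchar R].-nat q.
Proof. by case: candPhi => qP _ _ _ _; apply: (pchar_rmorph_nat iota). Qed.

(** The conditions are compatible with sums and products because the q-th power is a ring
    homomorphism; multiplying by the derivative of Phi raises k. *)
Lemma numer_exists k f : dle wR k f -> exists H, numer k f H.
Proof.
pose S k f := exists H, numer k f H; apply: (Rfilt (S := S)); rewrite /S {k f}.
- move=> k f g [H1 [E1 I1 d1 s1]] [H2 [E2 I2 d2 s2]]; exists (H1 + H2); split.
  + by rewrite tofracD E1 E2 rmorphD mulrDr.
  + rewrite rmorphD exprDn_pchar // mpolyCD mulrDr opprD addrACA; exact: (idD idQ).
  + exact: dleD.
  + by apply: leq_trans (size_polyD _ _) _; rewrite geq_max s1.
- move=> k l f g [H1 [E1 I1 d1 s1]] [H2 [E2 I2 d2 s2]]; exists (H1 * H2); split.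
  + by rewrite tofracM E1 E2 rmorphM exprD; ring.
  + rewrite rmorphM exprMn mpolyCM exprD [X in _ - X]mulrACA; exact: (id_congM idQ).
  + by rewrite mulnDl; apply: dleM.
  + apply: leq_trans (size_polyMleq _ _) _.
    have ar a b : (a <= (k * h2).+1 -> b <= (l * h2).+1 -> (a + b).-1 <= ((k + l) * h2).+1)%N by lia.
    exact: ar.
- by move=> i; exists (nu i); split; rewrite ?expr1 ?mul1n ?psi_x.
- move=> c dc; exists ((c%:MP)%:P ^+ q); split; rewrite ?mul0n.
  + by rewrite expr0 mul1r psi_iota.
  + rewrite expr0 mul1r rmorphXn /= evC map_mpolyC !rmorphXn /= subrr; exact: (id0 idQ).
  + rewrite -[X in dle _ X _](mul0n q); apply: dleX; apply/dle_polyP => j; rewrite coefC.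
    case: eqP => _; last exact: dle0.
    by apply/dle_mpolyP => m; rewrite mcoeffC; case: (_ == _); rewrite ?mulr1 ?mulr0 ?dle0.
  + apply: leq_trans (size_poly_exp_leq _ _) _.
    by rewrite size_polyC; case: (_ == 0).
- move=> k f [H [E IH dH sH]]; exists (H * Phi^`()); split.
  + by rewrite tofracM E exprS; ring.
  + have -> : ev q (H * Phi^`()) - delta ^+ k.+1 * (f ^+ q)%:MP =
        delta * (ev q H - delta ^+ k * (f ^+ q)%:MP) by rewrite rmorphM exprS; ring.
    exact: (idM idQ).
  + by rewrite mulSn addnC; apply: dleM => //; apply: dleW e0e2 _.
  + apply: leq_trans (size_polyMleq _ _) _.
    have ar a b : (a <= (k * h2).+1 -> b <= h2.+1 -> (a + b).-1 <= (k.+1 * h2).+1)%N by lia.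
    apply: ar => //; apply: leq_trans (size_poly _ _) _; apply: leq_trans (leq_pred _) _.
    by apply: leq_trans sPhi _; rewrite ltnS.
Qed.

(** The contraction along [psi] of the prime (Phi) of V localized at the derivative of Phi. *)
Definition kerL f := exists k C, tf Phi^`() ^+ k * psi f = tf (Phi * C).

Let tfP0 : tf Phi^`() != 0. Proof. by rewrite tofrac_eq0. Qed.

Lemma numerE f : exists k H, numer k f H.
Proof. by have [H nH] := @numer_exists (wR f) f (leqnSn _); exists (wR f), H. Qed.

(** Phi is prime and does not divide its derivative, so the exponent of the denominator is
    immaterial. *)
Lemma kerLE k f H : tf H = tf Phi^`() ^+ k * psi f -> kerL f <-> dvdr Phi H.
Proof.
move=> EH; split=> [[l [C E]]|[C E]]; last first.
  by exists k, C; rewrite -EH E mulrC.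
have : dvdr Phi (Phi^`() ^+ l * H).
  exists (Phi^`() ^+ k * C); apply/eqP; rewrite -tofrac_eq.
  by rewrite !tofracM !tofracXn EH mulrCA E tofracM; apply/eqP; ring.
elim: l {E} => [|l IH]; first by rewrite expr0 mul1r.
by rewrite exprS -mulrA; case: prPhi => _ _ h /h[/ndvd_deriv|].
Qed.

Lemma kerLP k f H : numer k f H -> kerL f <-> dvdr Phi H.
Proof. by case=> EH _ _ _; apply: kerLE EH. Qed.

Lemma kerL_ideal : is_ideal kerL.
Proof.
split.
- by exists 0%N, 0; rewrite rmorph0 !mulr0 tofrac0.
- move=> f g [k [C E]] [l [C' E']]; exists (k + l)%N, (Phi^`() ^+ l * C + Phi^`() ^+ k * C').
  have -> : Phi * (Phi^`() ^+ l * C + Phi^`() ^+ k * C') =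
    Phi^`() ^+ l * (Phi * C) + Phi^`() ^+ k * (Phi * C') by ring.
  by rewrite tofracD !(tofracM (_ ^+ _)) -E -E' !tofracXn rmorphD exprD; ring.
- move=> f g [k [C E]]; have [l [H [EH _ _ _]]] := numerE f; exists (k + l)%N, (H * C).
  have -> : Phi * (H * C) = H * (Phi * C) by ring.
  by rewrite tofracM -E EH rmorphM exprD; ring.
Qed.

Lemma kerL_prime f g : kerL (f * g) -> kerL f \/ kerL g.
Proof.
have [k [H nH]] := numerE f; have [l [H' nH']] := numerE g.
case=> j [C E].
have : dvdr Phi (Phi^`() ^+ j * (H * H')).
  exists (Phi^`() ^+ (k + l) * C); apply/eqP; rewrite -tofrac_eq.
  case: nH nH' => [EH _ _ _] [EH' _ _ _].
  have -> : Phi^`() ^+ (k + l) * C * Phi = Phi^`() ^+ (k + l) * (Phi * C) by ring.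
  rewrite !(tofracM (_ ^+ _)) -E tofracM EH EH' !tofracXn rmorphM exprD.
  by apply/eqP; ring.
case: (prPhi) => _ _ h; elim: j {E} => [|j IH].
  by rewrite expr0 mul1r => /h[]; [left|right]; [apply/(kerLP nH)|apply/(kerLP nH')].
by rewrite exprS -mulrA => /h[/ndvd_deriv|].
Qed.

Lemma kerL_of_bounded f : dle wR d f -> I f -> kerL f.
Proof.
move=> df If; have [H nH] := numer_exists df; apply/(kerLP nH).
case: nH => _ IH dH sH.
apply: (candidate_dvd idI evC indep hD candPhi prPhi dH sH hT2).
rewrite -[X in idS I X](subrK (delta ^+ d * (f ^+ q)%:MP)); apply: (idD idQ) => //.
apply: (idM idQ); apply/idSC => //.
by case: (q) q0 => // q' _; rewrite exprS; apply: (idMr idI).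
Qed.

Lemma kerL_expr f : kerL f -> I (f ^+ q).
Proof.
have [k [H nH]] := numerE f; move/(kerLP nH) => [C EC]; case: nH => _ IH _ _.
apply/(idSC idI n)/(@delta_regularX k).
apply: (proj1 (id_cong idQ IH)); rewrite EC rmorphM; apply: (idM idQ).
by case: candPhi.
Qed.

(** * Extracting q-th roots modulo I *)

Section Radical.
Variables (J : finType) (b : J -> R) (kb N e3 : nat).
Hypothesis db : forall j, dle wR kb (b j).
Hypothesis hN : ((kb * h2).+1 <= N)%N.
Hypothesis he3 : (kb * e2 + N * e0 <= e3)%N.
Hypothesis hTJ : (#|J| * e3 <= T)%N.
Hypothesis hDJ : (#|J| * e3 <= D)%N.
Hypothesis rootI : forall f, dle wR (#|J| * e3 + kb) f -> I (f ^+ q) -> I f.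
Hypothesis q_linearize : forall (J1 : finType) (a : J -> J1 -> P) e,
  (forall i j, dle wP e (a i j)) ->
  exists (J2 : finType) (c : J -> J2 -> P), (forall i j, dle wP e (c i j)) /\
    forall w : J -> P, (forall j, \sum_i w i ^+ q * a i j = 0) <->
                       (forall j, \sum_i w i * c i j = 0).
Hypothesis d_gt : forall f, I (f ^+ q) -> kerL f.

Let comb (w : J -> P) : R := \sum_j iota (w j) * b j.

Let Phi0 : Phi != 0. Proof. by case: prPhi. Qed.
Let bPhi : dle wV e0 Phi. Proof. by case: candPhi. Qed.

(* Divisibility of a numerator by [Phi] is the vanishing of a pseudo-remainder,
   which is linear in the [q]-th powers of the coefficients of the combination. *)
Lemma kerL_linear : exists (J2 : finType) (c : J -> J2 -> P),
  (forall i j, dle wP e3 (c i j)) /\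
  forall w, kerL (comb w) <-> (forall j, \sum_i w i * c i j = 0).
Proof.
have [H HH] : exists H : J -> V, forall j, numer kb (b j) (H j).
  by apply: (@fin_all_exists _ _ (fun j H => numer kb (b j) H)) => j; apply: numer_exists.
have [A HA] : exists A : J -> V * V, forall j,
   [/\ (lead_coef Phi ^+ N)%:P * H j = (A j).1 * Phi + (A j).2,
      (size (A j).2 < size Phi)%N & dle wV (kb * e2 + N * e0) (A j).2].
  apply: (@fin_all_exists _ _ (fun j A => [/\ (lead_coef Phi ^+ N)%:P * H j = A.1 * Phi + A.2,
      (size A.2 < size Phi)%N & dle wV (kb * e2 + N * e0) A.2])) => j.
  have [_ _ dH sH] := HH j.
  have [C [E [E1 E2 E3]]] := pseudo_division Phi0 bPhi dH (leq_trans sH hN).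
  by exists (C, E).
pose bnd := (\max_(j : J) \max_(k < size Phi) msize (A j).2`_k)%N.
pose a (j : J) (p : 'I_(size Phi) * 'X_{1..n < bnd}) : P := (A j).2`_p.1@_p.2.
have da j p : dle wP e3 (a j p).
  by apply: dleW he3 _; have [_ _ /dle_polyP/(_ p.1)/dle_mpolyP] := HA j; apply.
have [J2 [c [dc Hc]]] := q_linearize da; exists J2, c; split=> // w.
have eqH : tf (\sum_j ((w j)%:MP)%:P ^+ q * H j) = tf Phi^`() ^+ kb * psi (comb w).
  rewrite rmorph_sum /comb rmorph_sum mulr_sumr; apply: eq_bigr => j _.
  by rewrite /= tofracM rmorphM psi_iota; have [-> _ _ _] := HH j; ring.
rewrite (kerLE eqH) -Hc {Hc eqH}.
pose cw j : {mpoly P[n]} := (w j ^+ q)%:MP.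
have Ecw j : ((w j)%:MP)%:P ^+ q = (cw j)%:P :> V by rewrite /cw !rmorphXn.
rewrite (eq_bigr (fun j => (cw j)%:P * H j)); last by move=> j _; rewrite Ecw.
pose rem := \sum_j (cw j)%:P * (A j).2.
have EL : (lead_coef Phi ^+ N)%:P * (\sum_j (cw j)%:P * H j) =
    (\sum_j (cw j)%:P * (A j).1) * Phi + rem.
  rewrite mulr_sumr mulr_suml -big_split; apply: eq_bigr => j _ /=.
  by rewrite mulrCA; have [-> _ _] := HA j; ring.
have srem : (size rem < size Phi)%N.
  have P1 : (0 < size Phi)%N by rewrite size_poly_gt0.
  rewrite -(prednK P1) ltnS; apply: leq_trans (size_sum _ _ _) _; apply/bigmax_leqP => j _.
  rewrite mul_polyC (leq_trans (size_scale_leq _ _)) // -ltnS prednK //.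
  by have [] := HA j.
have coef_rem (k : nat) m : rem`_k@_m = \sum_j w j ^+ q * (A j).2`_k@_m.
  by rewrite coef_sum raddf_sum; apply: eq_bigr => j _; rewrite /cw /= coefCM mcoeffCM.
(* A multiple of Phi smaller than Phi is 0. Conversely Phi is prime and not constant in X, so it
   does not divide the power of its leading coefficient. *)
have -> : dvdr Phi (\sum_j (cw j)%:P * H j) <-> rem = 0.
  split=> [[C E]|E].
    apply: NNPP => /eqP rem0; move: srem; rewrite ltnNge => /negP; apply.
    pose C' := (lead_coef Phi ^+ N)%:P * C - \sum_j (cw j)%:P * (A j).1.
    have ErC : rem = Phi * C'.
      rewrite /C' mulrBr [Phi * (_ * C)]mulrC -mulrA -E EL; ring.
    rewrite ErC; apply: leq_size_mul => //.
    by apply: contra_neq rem0 => C0; rewrite ErC C0 mulr0.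
  have [_ _ hPhi] := prPhi.
  case: (hPhi (lead_coef Phi ^+ N)%:P (\sum_j (cw j)%:P * H j)) => //.
    by exists (\sum_j (cw j)%:P * (A j).1); rewrite EL E addr0.
  have lN0 : lead_coef Phi ^+ N != 0 by rewrite expf_neq0 // lead_coef_eq0.
  move/(dvdr_polyC_size lN0) => s1; case/negP: Phi'0.
  by rewrite (size1_polyC s1) derivC.
split=> [E p|E].
  by rewrite -[LHS](coef_rem p.1 p.2) E coef0 mcoeff0.
apply/polyP=> k; apply/mpolyP=> m; rewrite coef0 mcoeff0 coef_rem.
have [lk|gk] := ltnP k (size Phi); last first.
  apply: big1 => j _; rewrite nth_default ?mcoeff0 ?mulr0 //.
  by apply: leq_trans gk; have [_ /ltnW] := HA j.
have [lm|gm] := ltnP (mdeg m) bnd; first by have := E (Ordinal lk, BMultinom lm).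
apply: big1 => j _; rewrite memN_msupp_eq0 ?mulr0 //; apply: msize_mdeg_ge.
apply: leq_trans gm; apply: leq_trans (leq_bigmax j).
exact: (leq_bigmax (F := fun k : 'I_(size Phi) => msize (A j).2`_k) (Ordinal lk)).
Qed.

(** No bound on [w] is available, so roots are taken only for the rows of [Z]; [mu] lies outside I
    by independence and is cancelled by [regI]. *)
Lemma radical_comb w : I (comb w ^+ q) -> I (comb w).
Proof.
have [J2 [c [dc Hc]]] := kerL_linear; move=> /d_gt/Hc wc.
pose C := \matrix_(i < #|J|, j < #|J2|) c (enum_val i) (enum_val j).
have dC i j : dle wP e3 (C i j) by rewrite mxE.
have [k [mu [Z [fr [[lek _] dmu dZ [mu0 ZC kerC _ _]]]]]] := cramer_kernel dC.
have kJ : (k * e3 <= #|J| * e3)%N by rewrite leq_mul2r lek orbT.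
pose f g := comb (fun j => Z g (enum_rank j)).
have If g : I (f g).
  apply: rootI.
    apply: dle_sum => j _; apply: dleM => //; apply: diota; apply: dleW kJ _; exact: dZ.
  apply: kerL_expr; apply/Hc => j.
  have /matrixP/(_ g (enum_rank j)) := ZC; rewrite !mxE => E; rewrite -[RHS]E.
  rewrite (reindex (@enum_val J xpredT)) /=; last exact/onW_bij/enum_val_bij.
  by apply: eq_bigr => i _; rewrite mxE enum_valK enum_rankK.
have vC : (\row_(i < #|J|) w (enum_val i)) *m C = 0.
  apply/rowP=> j; rewrite !mxE -[RHS](wc (enum_val j)).
  rewrite [RHS](reindex (@enum_val J xpredT)) /=; last exact/onW_bij/enum_val_bij.
  by apply: eq_bigr => i _; rewrite !mxE.
apply: (regI (c := iota mu)).
- by apply: dleW hDJ _; apply: dleW kJ _; apply: diota.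
- by move=> Imu; case/negP: mu0; apply/eqP; apply: indep Imu; apply: dleW hTJ _; apply: dleW kJ _.
have -> : iota mu * comb w = \sum_g iota (w (enum_val g)) * f g.
  rewrite /comb mulr_sumr (eq_bigr (fun g => \sum_j iota (w (enum_val g) * Z g (enum_rank j)) * b j)).
    rewrite exchange_big; apply: eq_bigr => j _ /=.
    rewrite -mulr_suml -rmorph_sum mulrA -rmorphM; congr (iota _ * _).
    have /rowP/(_ (enum_rank j)) := kerC _ vC; rewrite !mxE enum_rankK => ->.
    by apply: eq_bigr => i _; rewrite !mxE.
  by move=> g _; rewrite /f /comb mulr_sumr; apply: eq_bigr => j _; rewrite rmorphM mulrA.
by apply: (id_sum idI) => g _; apply: (idM idI).
Qed.

End Radical.
End Parametrize.

(** * Linearization of Frobenius systems *)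

(** A finite family independent over K^q whose span contains [s], built greedily, which also serves
    K of infinite degree over K^q. Coordinates are written as q-th powers of elements of K. *)
Lemma frobenius_basis (K : fieldType) q (s : seq K) : [pchar K].-nat q ->
  exists e : seq K,
    (forall k : nat -> K, \sum_(i < size e) k i ^+ q * e`_i = 0 ->
       forall i, (i < size e)%N -> k i = 0) /\
    (forall y, y \in s -> exists k : nat -> K, y = \sum_(i < size e) k i ^+ q * e`_i).
Proof.
move=> qK; have q0 : (0 < q)%N by case/andP: qK.
elim: s => [|y s [e [ind span]]]; first by exists [::].
case: (classic (exists k : nat -> K, y = \sum_(i < size e) k i ^+ q * e`_i)) => [ey|ney].
  exists e; split=> // z; rewrite inE => /orP[/eqP->//|]; exact: span.
exists (y :: e); split=> [k|z].
  rewrite /= big_ord_recl /= => k0.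
  have E (f : nat -> K) : \sum_(i < size e) k (lift ord0 i) ^+ q * (y :: e)`_(lift ord0 i) =
    \sum_(i < size e) k i.+1 ^+ q * e`_i by apply: eq_bigr.
  rewrite (E (fun=> 0)) {E} in k0.
  have k00 : k 0%N = 0.
    apply: NNPP => /eqP nk; apply: ney; exists (fun i => - k i.+1 / k 0%N).
    have kq : k 0%N ^+ q != 0 by rewrite expf_neq0.
    apply: (mulfI kq); rewrite mulr_sumr.
    rewrite (eq_bigr (fun i : 'I_(size e) => (- k i.+1) ^+ q * e`_i)); last first.
      by move=> i _; rewrite expr_div_n mulrA mulrCA divff // mulr1.
    move/eqP: k0; rewrite addr_eq0 => /eqP->; rewrite -sumrN.
    apply: eq_bigr => i _; rewrite -mulNr; congr (_ * _).
    apply/eqP; rewrite eq_sym -subr_eq0 opprK -exprDn_pchar // addNr expr0n.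
    by rewrite eqn0Ngt q0.
  move=> [|i] //=; rewrite ltnS; apply: (ind (fun i => k i.+1)).
  by rewrite -[RHS]k0 k00 expr0n eqn0Ngt q0 mul0r add0r.
rewrite inE => /orP[/eqP->|/span[k ->]].
  exists (fun i => (i == 0%N)%:R); rewrite big_ord_recl /= expr1n mul1r big1 ?addr0 // => i _.
  by rewrite expr0n eqn0Ngt q0 mul0r.
exists (fun i => if i is j.+1 then k j else 0); rewrite big_ord_recl /=.
rewrite expr0n eqn0Ngt q0 mul0r add0r; by apply: eq_bigr.
Qed.

Lemma mcoeff_frob (K : fieldType) r q (f : {mpoly K[r]}) (m nu nu' : 'X_{1..r}) :
  [pchar K].-nat q -> (forall i, nu i < q)%N -> (forall i, nu' i < q)%N ->
  ('X_[nu] * f ^+ q)@_(m *+ q + nu')%MM = (nu == nu')%:R * f@_m ^+ q.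
Proof.
move=> qK hnu hnu'; have q0 : (0 < q)%N by case/andP: qK.
rewrite {1}[f]mpolyE expr_sum_pchar; last exact: (pchar_rmorph_nat (@mpolyC r K)).
rewrite mulr_sumr raddf_sum /=.
have Em (m1 : 'X_{1..r}) : ('X_[nu] * (f@_m1 *: 'X_[m1]) ^+ q)@_(m *+ q + nu')%MM =
    (nu == nu')%:R * ((m1 == m)%:R * f@_m1 ^+ q).
  rewrite exprZn mpolyXn -scalerAr mcoeffZ -mpolyXD mcoeffX mulrA -natrM mulnb [LHS]mulrC.
  congr (_%:R * _); congr (nat_of_bool _).
  apply/eqP/andP=> [/mnmP h|[/eqP-> /eqP->]]; last by rewrite addmC.
  have h1 i : nu i = nu' i /\ m1 i = m i.
    have := h i; rewrite !mnmDE !mulmnE => h1; have := hnu i; have := hnu' i => a b.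
    have E1 : nu i = nu' i.
      by have := congr1 (modn^~ q) h1; rewrite /= modnMDl addnC modnMDl !modn_small.
    split=> //; apply/eqP; rewrite -(eqn_pmul2r q0) -(eqn_add2l (nu i)) h1 E1 addnC //.
  by split; apply/eqP/mnmP=> i; case: (h1 i).
rewrite (eq_bigr _ (fun i _ => Em i)) -mulr_sumr; congr (_ * _).
have [mf|mf] := boolP (m \in msupp f).
  rewrite (bigD1_seq m) //= eqxx mul1r big1 ?addr0 // => i /negPf->.
  by rewrite mul0r.
rewrite (memN_msupp_eq0 mf) expr0n eqn0Ngt q0 big_seq big1 // => i fi.
by case: eqP fi mf => [->->//|_ _ _]; rewrite mul0r.
Qed.

(** The products g_i X^nu with all nu_k < q are independent over the subring of q-th powers. Writing
    a = sum g_i X^nu c^q turns sum w^q a into sum g_i X^nu (sum w c)^q, which vanishes exactly when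
    every sum w c does. Exponents are divided by q, so degrees do not grow. *)
Lemma frobenius_linearize (K : fieldType) r q (J J1 : finType)
    (a : J -> J1 -> {mpoly K[r]}) e : [pchar K].-nat q ->
  (forall i j, tdeg_le (a i j) e) ->
  exists (J2 : finType) (c : J -> J2 -> {mpoly K[r]}), (forall i j, tdeg_le (c i j) e) /\
    forall w : J -> {mpoly K[r]}, (forall j, \sum_i w i ^+ q * a i j = 0) <->
                       (forall j, \sum_i w i * c i j = 0).
Proof.
move=> qK da; have q0 : (0 < q)%N by case/andP: qK.
have qP : [pchar {mpoly K[r]}].-nat q by exact: (pchar_rmorph_nat (@mpolyC r K)).
pose M := 'X_{1..r < e.+1}; pose N := {ffun 'I_r -> 'I_q}.
pose mn (nu : N) := [multinom (nu i : nat) | i < r].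
have mnq (nu : N) i : (mn nu i < q)%N by rewrite mnmE.
pose s := [seq (a x.1.1 x.1.2)@_(x.2.1 *+ q + mn x.2.2)%MM | x : (J * J1) * (M * N)].
have [g [ind span]] := frobenius_basis s qK.
pose Q (x : (J * J1) * (M * N)) (k : nat -> K) :=
  (a x.1.1 x.1.2)@_(x.2.1 *+ q + mn x.2.2)%MM = \sum_(i < size g) k i ^+ q * g`_i.
have [kap kapE] : exists kap, forall x, Q x (kap x).
  apply: (@fin_all_exists _ _ Q) => x; apply: span.
  by apply: (image_f (fun x : (J * J1) * (M * N) => (a x.1.1 x.1.2)@_(x.2.1 *+ q + mn x.2.2)%MM)).
pose c j (p : J1 * N * 'I_(size g)) : {mpoly K[r]} :=
  \sum_(m : M) kap ((j, p.1.1), (m, p.1.2)) p.2 *: 'X_[m].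
exists (J1 * N * 'I_(size g))%type, c; split=> [j p|w].
  apply: (dle_sum (w := msize_fun K r)) => m _; apply: leq_trans (msizeZ_le _ _) _.
  by rewrite msizeX; apply: bmdeg.
have CF (F : N -> 'I_(size g) -> {mpoly K[r]}) m nu :
    (\sum_(nu : N) \sum_(i < size g) g`_i *: ('X_[mn nu] * F nu i ^+ q))@_(m *+ q + mn nu)%MM =
    \sum_(i < size g) (F nu i)@_m ^+ q * g`_i.
  rewrite raddf_sum (bigD1 nu) //= [X in _ + X]big1 ?addr0 => [|nu' ne].
    by rewrite raddf_sum; apply: eq_bigr => i _; rewrite /= mcoeffZ mcoeff_frob // eqxx mul1r mulrC.
  rewrite raddf_sum big1 // => i _; rewrite /= mcoeffZ mcoeff_frob //.
  case: eqP => [/mnmP h|_]; last by rewrite mul0r mulr0.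
  case/eqP: ne; apply/ffunP=> k; apply: val_inj => /=.
  by have := h k; rewrite !mnmE.
have aE j al : a j al = \sum_(nu : N) \sum_(i < size g) g`_i *: ('X_[mn nu] * c j (al, nu, i) ^+ q).
  apply/mpolyP=> mu; pose m := [multinom (mu i %/ q)%N | i < r].
  pose nu : N := [ffun i => Ordinal (ltn_pmod (mu i) q0)].
  have -> : mu = (m *+ q + mn nu)%MM.
    by apply/mnmP=> i; rewrite mnmDE mulmnE !mnmE ffunE -divn_eq.
  rewrite (CF (fun nu i => c j (al, nu, i))).
  have [lm|gm] := ltnP (mdeg m) e.+1.
    rewrite (kapE ((j, al), (BMultinom lm, nu))); apply: eq_bigr => i _; congr (_ ^+ q * _).
    rewrite /c raddf_sum (bigD1 (BMultinom lm)) //= mcoeffZ mcoeffX eqxx mulr1 big1 ?addr0 //.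
    by move=> m' ne; rewrite mcoeffZ mcoeffX; move: ne; rewrite -val_eqE /= => /negPf->; rewrite mulr0.
  rewrite memN_msupp_eq0 ?big1 // => [i _|].
    rewrite (_ : _@_m = 0) ?expr0n ?eqn0Ngt ?q0 ?mul0r //.
    apply: memN_msupp_eq0; apply: msize_mdeg_ge; apply: leq_trans gm.
    apply: (dle_sum (w := msize_fun K r)) => m' _; apply: leq_trans (msizeZ_le _ _) _.
    by rewrite msizeX; apply: bmdeg.
  apply: msize_mdeg_ge; apply: leq_trans (da _ _) _; apply: leq_trans gm _.
  rewrite mdegD mdegMn; apply: leq_trans (leq_addr _ _); exact: leq_pmulr.
pose D (al : J1) (nu : N) (i : 'I_(size g)) := \sum_j w j * c j (al, nu, i).
have E al : \sum_j w j ^+ q * a j al =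
    \sum_(nu : N) \sum_(i < size g) g`_i *: ('X_[mn nu] * D al nu i ^+ q).
  rewrite (eq_bigr (fun j => \sum_(nu : N) \sum_(i < size g)
     g`_i *: ('X_[mn nu] * (w j * c j (al, nu, i)) ^+ q))); last first.
    move=> j _; rewrite aE mulr_sumr; apply: eq_bigr => nu _; rewrite mulr_sumr.
    by apply: eq_bigr => i _; rewrite exprMn -scalerAr mulrCA.
  rewrite exchange_big; apply: eq_bigr => nu _; rewrite exchange_big; apply: eq_bigr => i _ /=.
  by rewrite -scaler_sumr -mulr_sumr /D expr_sum_pchar.
split=> [h [[al nu] i]|h al]; last first.
  rewrite E big1 // => nu _; rewrite big1 // => i _.
  by rewrite /D (h (al, nu, i)) expr0n eqn0Ngt q0 mulr0 scaler0.
apply/mpolyP=> m; rewrite mcoeff0.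
pose k j := if insub j is Some j' then (D al nu j')@_m else 0.
have kE (j : 'I_(size g)) : k j = (D al nu j)@_m by rewrite /k valK.
rewrite -[LHS](kE i); apply: ind (ltn_ord i).
rewrite (eq_bigr (fun j : 'I_(size g) => (D al nu j)@_m ^+ q * g`_j)).
  by rewrite -(CF (D al)) -E h mcoeff0.
by move=> j _; rewrite kE.
Qed.

(** * Primality *)

Lemma bounded_root (R : idomainType) (w : size_fun R) (I : R -> Prop) B e f q :
  (forall f g, dle w B f -> dle w B g -> I (f * g) -> I f \/ I g) ->
  (0 < q)%N -> (q * e <= B)%N -> dle w e f -> I (f ^+ q) -> I f.
Proof.
move=> prI; case: q => // q _; elim: q => [|q IH] hB df; first by rewrite expr1.
rewrite exprS; case/prI => //.
- by apply: dleW df; apply: leq_trans hB; rewrite leq_pmull.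
- by apply: dleW (dleX _ df); apply: leq_trans hB; rewrite mulnC leq_mul2r leqnSn orbT.
- by apply: IH => //; apply: leq_trans hB; rewrite leq_mul2r leqnSn orbT.
Qed.

Section AbstractPrimality.
Variables (P R : idomainType) (wP : size_fun P) (wR : size_fun R) (n r t : nat).
Variables (x : 'I_n -> R) (iota : {rmorphism P -> R}) (I : R -> Prop) (idI : is_ideal I).
Variables (s : 'I_r -> 'I_n) (u : 'I_r -> P).
Hypothesis s_inj : injective s.
Hypothesis n0 : (0 < n)%N.
Hypothesis ufdP : ufd P.
Hypothesis dx : forall i, dle wR 1 (x i).
Hypothesis du : forall j, dle wP 1 (u j).
Hypothesis xs : forall j, x (s j) = iota (u j).
Hypothesis diota : forall e c, dle wP e c -> dle wR e (iota c).
Variable ev : nat -> {rmorphism {poly {mpoly P[n]}} -> {mpoly R[n]}}.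
Hypothesis evC : forall q c, ev q c%:P = map_mpoly iota c.
Hypothesis evX : forall q, ev q 'X = \sum_i (x i ^+ q)%:MP * 'X_i.
Hypothesis Rfilt : forall S : nat -> R -> Prop,
  (forall k f g, S k f -> S k g -> S k (f + g)) ->
  (forall k l f g, S k f -> S l g -> S (k + l)%N (f * g)) ->
  (forall i, S 1%N (x i)) -> (forall c, dle wP 0 c -> S 0%N (iota c)) ->
  (forall k f, S k f -> S k.+1 f) -> forall k f, dle wR k f -> S k f.
(** R is a polynomial ring in the x_i, with the x_(s j) coming from P: images of the x_i may be
    prescribed if on the x_(s j) they agree with [phi] followed by the q-th power. *)
Hypothesis Runiv : forall (F : comNzRingType) (phi : {rmorphism P -> F}) q (y : 'I_n -> F),
  [pchar P].-nat q -> (forall j, y (s j) = phi (u j) ^+ q) ->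
  exists psi : {rmorphism R -> F},
    (forall c, psi (iota c) = phi c ^+ q) /\ (forall i, psi (x i) = y i).
Hypothesis Plin : forall q (J J1 : finType) (a : J -> J1 -> P) e, [pchar P].-nat q ->
  (forall i j, dle wP e (a i j)) ->
  exists (J2 : finType) (c : J -> J2 -> P), (forall i j, dle wP e (c i j)) /\
    forall w : J -> P, (forall j, \sum_i w i ^+ q * a i j = 0) <->
                       (forall j, \sum_i w i * c i j = 0).

Variable G : 'I_n -> {poly P}.
Hypothesis sizeG : forall i, size (G i) = t.+2.
Hypothesis coefG : forall i k, dle wP t.+1 (G i)`_k.
Hypothesis IG : forall i, I ((map_poly iota (G i)).[x i]).

Variables (d D T B : nat).
Hypothesis I1 : ~ I 1.
Hypothesis prI : forall f g, dle wR B f -> dle wR B g -> I (f * g) -> I f \/ I g.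
Hypothesis indep : forall c, dle wP T c -> I (iota c) -> c = 0.
Hypothesis regI : forall c, dle wR D c -> ~ I c -> forall f, I (c * f) -> I f.
Hypothesis Igen : forall J : R -> Prop, is_ideal J ->
  (forall f, dle wR d f -> I f -> J f) -> forall f, I f -> J f.

(** [M] counts box monomials and bounds the degree in X of the generic relation; [e0] bounds its
    coefficients. [e3] is kb e2 + N e0 for the linear system, with kb = n t for box monomials, e2 =
    M + e0 for the numerators nu_i and N = n t M + 1 for pseudo-division. *)
Let M := (t.+1 ^ n)%N.
Let e0 := (M * (n * t.+1))%N.
Let e3 := (n * t * (M + e0) + (n * t * M).+1 * e0)%N.
Hypothesis hT1 : ((M + M).+1 * e0 <= T)%N.
Hypothesis hT2 : ((M + d * M).+1 * maxn e0 (d * (M + e0)) <= T)%N.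
Hypothesis hT3 : (M * e3 <= T)%N.
Hypothesis hT4 : (n * t.+1 <= T)%N.
Hypothesis hD1 : (e0 + M <= D)%N.
Hypothesis hD2 : (M * e3 <= D)%N.
Hypothesis hD3 : (n * t.+1 <= D)%N.
Hypothesis hB1 : (e0 + M <= B)%N.
Hypothesis hB2 : (M * (M * e3 + n * t) <= B)%N.

Let wS := mpoly_size_fun wP n.
Let wV := poly_size_fun wS.
Let wQ := mpoly_size_fun wR n.
Let idQ := idS_ideal n idI.

Lemma abstract_primality f g : I (f * g) -> I f \/ I g.
Proof.
have [F [F0 dF sF IF]] := generic_relation idI sizeG coefG IG evC evX n0.
have cF : candidate wP I ev e0 M 1 F.
  by split=> //; rewrite ?mul1n -?subn1 ?leq_subLR ?add1n.
have [q [Phi [cPhi prPhi Phi'0]]] :=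
  separable_candidate idI dx diota evC evX I1 prI indep ufdP hB1 cF hT1.
have [qP Phi0 dPhi sPhi IPhi] := cPhi.
have e0T : (e0 <= T)%N by apply: leq_trans hT1; rewrite leq_pmull.
have szPhi := candidate_size evC indep cPhi e0T.
have q0 : (0 < q)%N by case/andP: qP.
have qM : (q <= M)%N.
  by apply: leq_trans sPhi; rewrite leq_pmulr // -subn1 subn_gt0.
have sPhi' : (size Phi <= M.+1)%N.
  by rewrite -[M.+1]add1n -leq_subLR subn1; apply: leq_trans sPhi; rewrite leq_pmull.
have dPhi' : dle wV e0 Phi^`().
  apply/dle_polyP => j; rewrite coef_deriv -mulr_natr -[e0]addn0; apply: dleM; last exact: dle_nat.
  by move/dle_polyP: dPhi.
(* For x_i in P the numerator must be exactly u_j^q times the derivative of Phi, because [psi] has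
   to be the q-th power on P; minus the U_i-derivative of Phi matches this only up to elements
   evaluating into I[U]. *)
have [nu nuP] : exists nu : 'I_n -> {poly {mpoly P[n]}}, forall i,
    [/\ idS I (ev q (nu i) - ev q Phi^`() * (x i ^+ q)%:MP), dle wV (M + e0) (nu i),
        (size (nu i) <= M.+1)%N & forall j, s j = i -> nu i = ((u j)%:MP)%:P ^+ q * Phi^`()].
  apply: (@fin_all_exists _ _ (fun i nui => [/\ idS I (ev q nui - ev q Phi^`() * (x i ^+ q)%:MP),
    dle wV (M + e0) nui, (size nui <= M.+1)%N &
    forall j, s j = i -> nui = ((u j)%:MP)%:P ^+ q * Phi^`()])) => i.
  have [[j sj]|nsj] := classic (exists j, s j = i).
    exists (((u j)%:MP)%:P ^+ q * Phi^`()); split.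
    - rewrite rmorphM rmorphXn /= evC map_mpolyC /= -xs sj -rmorphXn mulrC subrr; exact: (id0 idQ).
    - apply: dleM => //; apply: (@dleW _ _ (1 * q)); first by rewrite mul1n.
      apply: dleX; apply/dle_polyP => k; rewrite coefC; case: eqP => _; last exact: dle0.
      by apply/dle_mpolyP => m; rewrite mcoeffC; case: (_ == _); rewrite ?mulr1 ?mulr0 ?dle0.
    - rewrite -rmorphXn mul_polyC; apply: leq_trans (size_scale_leq _ _) _.
      by apply: leq_trans sPhi'; apply: leq_trans (size_poly _ _) (leq_pred _).
    - by move=> j' sj'; rewrite (s_inj (etrans sj (esym sj'))).
  exists (- map_poly (mderiv i) Phi); split.
  - have := idS_deriv idI i IPhi; rewrite (ev_deriv evC evX) => h.
    by rewrite rmorphN -opprD; apply: (idN idQ).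
  - by rewrite dleN; apply: dle_map_mderiv; apply: dleW (leq_addl _ _) _.
  - by rewrite size_polyN; apply: leq_trans sPhi'; apply: size_poly.
  - by move=> j sj; case: nsj; exists j.
pose y i := tofrac (nu i) / tofrac Phi^`().
have tfP0 : tofrac Phi^`() != 0 by rewrite tofrac_eq0.
pose phi := [the {rmorphism P -> _} of @tofrac {poly {mpoly P[n]}} \o polyC \o @mpolyC n P].
have phiE c : tofrac ((c%:MP)%:P ^+ q) = phi c ^+ q by rewrite tofracXn.
have ys j : y (s j) = phi (u j) ^+ q.
  by have [_ _ _ /(_ j erefl) E] := nuP (s j); rewrite /y E tofracM mulfK ?phiE.
have [psi [psi_iota' psi_x']] := Runiv qP ys.
have psi_iota c : psi (iota c) = tofrac ((c%:MP)%:P ^+ q) by rewrite phiE.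
have psi_x i : tofrac Phi^`() * psi (x i) = tofrac (nu i).
  by rewrite psi_x' mulrC divfK.
pose ker := kerL Phi psi.
have nuI i : idS I (ev q (nu i) - ev q Phi^`() * (x i ^+ q)%:MP) by case: (nuP i).
have dnu i : dle wV (M + e0) (nu i) by case: (nuP i).
have snu i : (size (nu i) <= M.+1)%N by case: (nuP i).
have e02 : (e0 <= M + e0)%N by rewrite leq_addl.
have idker : is_ideal ker.
  exact: (kerL_ideal idI evC hD1 cPhi Phi'0 hT1 (leqnn M) e02 nuI dnu snu hT2 psi_iota psi_x Rfilt).
have prker h1 h2 : ker (h1 * h2) -> ker h1 \/ ker h2.
  exact: (kerL_prime idI evC hD1 cPhi prPhi Phi'0 hT1 (leqnn M) e02 nuI dnu snu hT2 psi_iota psi_x Rfilt).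
have Iker h : I h -> ker h.
  apply: (Igen idker) => {}h dh.
  exact: (kerL_of_bounded idI evC indep hD1 cPhi prPhi Phi'0 hT1 (leqnn M) e02 nuI dnu snu hT2 psi_iota psi_x Rfilt).
have kerI h : ker h -> I (h ^+ q).
  exact: (kerL_expr idI dx diota evC evX indep regI hD1 cPhi prPhi Phi'0 hT1 (leqnn M) e02 nuI dnu snu hT2 psi_iota psi_x Rfilt).
have ker_expr h : I (h ^+ q) -> ker h.
  move/Iker; case: (q) q0 => // k _; elim: k => [|k IH]; first by rewrite expr1.
  by rewrite exprS => /prker[].
have rad w : I ((\sum_(b : box n t) iota (w b) * box_mnm x b) ^+ q) ->
    I (\sum_(b : box n t) iota (w b) * box_mnm x b).
  have cb : #|{: box n t}| = M by rewrite card_box.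
  apply: (radical_comb idI dx diota evC evX indep regI hD1 cPhi prPhi Phi'0 hT1 (leqnn M) e02
    nuI dnu snu hT2 psi_iota psi_x Rfilt (tdeg_box_mnm dx) (leqnn _) (leqnn _)) => //.
  - by rewrite cb.
  - by rewrite cb.
  - by move=> h; rewrite cb; apply: (bounded_root prI q0); apply: leq_trans hB2; rewrite leq_mul2r qM orbT.
  - by move=> J1 a e; apply: Plin.
have gen (S : R -> Prop) : (forall f g, S f -> S g -> S (f + g)) ->
     (forall c f, S f -> S (iota c * f)) -> (forall i f, S f -> S (x i * f)) ->
     S 1 -> forall f, S f.
  move=> SD SM SX S1 h.
  suff: forall k f, dle wR k f -> forall g, S g -> S (f * g).
    by move/(_ _ _ (leqnSn (wR h)) 1 S1); rewrite mulr1.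
  apply: Rfilt => //.
  - by move=> k f1 f2 h1 h2 f3 Sf3; rewrite mulrDl; apply: SD; auto.
  - by move=> k l f1 f2 h1 h2 f3 Sf3; rewrite -mulrA; auto.
  - by move=> c _ f3; apply: SM.
have rootP h : I (h ^+ q) -> I h.
  have [E [w hw]] := box_reduce idI sizeG coefG IG h gen => Ih.
  have {}Ih : I (iota (box_lead G) ^+ E * h).
    apply: (proj2 (id_cong idI hw)); apply: rad.
    have hq := id_congX idI q hw.
    by apply: (proj1 (id_cong idI hq)); rewrite exprMn; apply: (idM idI).
  elim: E {hw} Ih => [|E IH]; first by rewrite mul1r.
  rewrite exprS -mulrA => /regI h'; apply/IH/h' => [|Il].
    by apply: dleW hD3 _; apply/diota/tdeg_box_lead.
  case/negP: (box_lead_neq0 sizeG); apply/eqP/indep => //.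
  by apply: dleW hT4 _; apply/tdeg_box_lead.
by move/Iker/prker => -[]/kerI/rootP; [left|right].
Qed.
End AbstractPrimality.

Lemma frobenius_rmorphism (A : comNzRingType) q : [pchar A].-nat q ->
  exists h : {rmorphism A -> A}, forall a, h a = a ^+ q.
Proof.
move=> qA; have q0 : (0 < q)%N by case/andP: qA.
pose h (a : A) := a ^+ q.
have hD : {morph h : a b / a + b} by move=> a b; apply: exprDn_pchar.
have h0 : h 0 = 0 by rewrite /h expr0n eqn0Ngt q0.
have hM : monoid_morphism h.
  by split; [apply: expr1n|move=> a b; apply: exprMn].
pose hA := GRing.isSemiAdditive.Build A A h (conj h0 hD).
pose hR := GRing.isMonoidMorphism.Build A A h hM.
pose hh : {rmorphism A -> A} := HB.pack h hA hR.
by exists hh.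
Qed.

Lemma generic_evaluation (P R : idomainType) n (iota : {rmorphism P -> R})
    (th : nat -> {mpoly R[n]}) :
  exists ev : nat -> {rmorphism {poly {mpoly P[n]}} -> {mpoly R[n]}},
    (forall q c, ev q c%:P = map_mpoly iota c) /\ (forall q, ev q 'X = th q).
Proof.
exists (fun q => [the {rmorphism _ -> _} of horner_eval (th q) \o map_poly (map_mpoly iota)]).
split=> q => [c|]; first by rewrite /= map_polyC /horner_eval hornerC.
by rewrite /= map_polyX /horner_eval hornerX.
Qed.

(** * Polynomial rings in a subset of the variables *)

Section VarEmbedding.
Variables (K : fieldType) (n r : nat) (s : 'I_r -> 'I_n).
Variable iota : {rmorphism {mpoly K[r]} -> {mpoly K[n]}}.
Hypothesis iotaC : forall c, iota c%:MP = c%:MP.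
Hypothesis iotaX : forall j, iota 'X_j = 'X_(s j).

Lemma tdeg_embed e c : tdeg_le c e -> tdeg_le (iota c) e.
Proof.
move=> dc; pose f := [the {rmorphism _ -> _} of mmap (@mpolyC n K) (fun j => 'X_(s j))].
have -> : iota c = f c.
  apply: mpoly_hom_ext => [a|j] /=; first by rewrite iotaC mmap_mpolyC.
  by rewrite iotaX mmap_mpolyU.
rewrite -[e]add0n -[e]muln1; apply: (dle_mmap (w := msize_fun K n)) => //.
  by move=> a; apply: dle_msizeC.
by move=> j; apply: dle_msizeX.
Qed.

Lemma embed_universal (F : comNzRingType) (phi : {rmorphism {mpoly K[r]} -> F}) q
    (y : 'I_n -> F) : [pchar {mpoly K[r]}].-nat q -> (forall j, y (s j) = phi 'X_j ^+ q) ->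
  exists psi : {rmorphism {mpoly K[n]} -> F},
    (forall c, psi (iota c) = phi c ^+ q) /\ (forall i, psi 'X_i = y i).
Proof.
move=> qP ys; have [fr frE] := frobenius_rmorphism (pchar_rmorph_nat phi qP).
pose psi := [the {rmorphism _ -> _} of mmap (fr \o phi \o @mpolyC r K) y].
exists psi; split=> [c|i]; last by rewrite /= mmap_mpolyU.
rewrite -frE; apply: (mpoly_hom_ext (f := psi \o iota) (g := fr \o phi)) => [a|j] /=.
  by rewrite iotaC mmap_mpolyC.
by rewrite iotaX mmap_mpolyU ys frE.
Qed.

Lemma tdeg_le_ind (S : nat -> {mpoly K[n]} -> Prop) :
  (forall k f g, S k f -> S k g -> S k (f + g)) ->
  (forall k l f g, S k f -> S l g -> S (k + l)%N (f * g)) ->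
  (forall i, S 1%N 'X_i) -> (forall c, S 0%N c%:MP) ->
  (forall k f, S k f -> S k.+1 f) -> forall k f, tdeg_le f k -> S k f.
Proof.
move=> SD SM SX SC SW k f df; have Sle j l g : (j <= l)%N -> S j g -> S l g.
  by move=> /subnK<-; elim: (l - j)%N => // i IH /IH; apply: SW.
have S1 : S 0%N 1 by rewrite -mpolyC1.
rewrite (mpolyE f) big_seq; elim/big_ind: _ => [||m mf].
- by apply: (Sle 0%N) => //; rewrite -mpolyC0.
- by move=> ? ?; apply: SD.
have lm : (mdeg m <= k)%N by rewrite -ltnS (leq_trans (msize_mdeg_lt mf)).
apply: (Sle _ _ _ lm); rewrite -mul_mpolyC -[mdeg m]add0n; apply: (SM) => //.
rewrite mpolyXE_id mdegE; apply: (big_ind2 (fun e g => S e g)) => //.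
  by move=> e1 g1 e2 g2; apply: (SM).
move=> i _; elim: (m i) => [|j IH]; first by rewrite expr0.
by rewrite exprS -add1n; apply: SM.
Qed.

Variables (L : {mpoly K[n]} -> Prop) (d t D T B : nat).
Variable G : 'I_n -> {poly {mpoly K[r]}}.
Local Notation I := (ideal_gen L).
Hypothesis n0 : (0 < n)%N.
Hypothesis s_inj : injective s.
Hypothesis dL : forall f, L f -> tdeg_le f d.
Hypothesis sizeG : forall i, size (G i) = t.+2.
Hypothesis coefG : forall i k, tdeg_le (G i)`_k t.+1.
Hypothesis IG : forall i, I ((map_poly iota (G i)).['X_i]).
Hypothesis I1 : ~ I 1.
Hypothesis prI : prime_upto I B.
Hypothesis indep : forall c, tdeg_le c T -> I (iota c) -> c = 0.
Let M := (t.+1 ^ n)%N.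
Let e0 := (M * (n * t.+1))%N.
Let e3 := (n * t * (M + e0) + (n * t * M).+1 * e0)%N.
Hypothesis hT1 : ((M + M).+1 * e0 <= T)%N.
Hypothesis hT2 : ((M + d * M).+1 * maxn e0 (d * (M + e0)) <= T)%N.
Hypothesis hT3 : (M * e3 <= T)%N.
Hypothesis hT4 : (n * t.+1 <= T)%N.
Hypothesis hD0 : (d <= D)%N.
Hypothesis hD1 : (e0 + M <= D)%N.
Hypothesis hD2 : (M * e3 <= D)%N.
Hypothesis hD3 : (n * t.+1 <= D)%N.
Hypothesis hB0 : (D <= B)%N.
Hypothesis hB1 : (hermann_bound n 1 D <= B)%N.
Hypothesis hB2 : (M * (M * e3 + n * t) <= B)%N.

Lemma bounded_primality : prime_ideal I.
Proof.
have idI := ideal_gen_ideal L.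
have [ev [evC evX]] := generic_evaluation iota
  (fun q => \sum_i (('X_i : {mpoly K[n]}) ^+ q)%:MP * 'X_i : {mpoly {mpoly K[n]}[n]}).
move=> f g.
apply: (abstract_primality (wP := msize_fun K r) (wR := msize_fun K n) (ev := ev) idI s_inj n0 _ _ _ (fun j => esym (iotaX j))
  _ evC evX _ _ _ sizeG _ IG I1 prI indep _ _ hT1 hT2 hT3 hT4 hD1 hD2 hD3 _ hB2) => //.
- exact: (ufd_mpoly (@ufd_field K)).
- exact: dle_msizeX.
- exact: dle_msizeX.
- exact: tdeg_embed.
- move=> S SD SM SX SC SW; apply: tdeg_le_ind => // c; rewrite -iotaC; apply: SC.
  exact: dle_msizeC.
- by move=> F phi q y; apply: embed_universal.
- by move=> q J J1 a e /(pchar_rmorph_nat (mcoeff 0%MM))/frobenius_linearize; apply.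
- by move=> c dc nc; apply: (bounded_regular dL hD0 hB0 hB1 prI).
- move=> J idJ IJ; apply: ideal_gen_sub => // h Lh; apply: IJ; first exact: dL.
  exact: ideal_gen_mem.
- exact: leq_trans hB0.
Qed.

End VarEmbedding.

(** * Degree bounds *)

(** With b = t+1 and M = b^n, all quantities are compared with monomials M^i b^j, and S is M^3 b^5;
    the hypothesis on t lets a factor b absorb n, d and small constants. *)
Lemma threshold_bounds n d t :
  (0 < n)%N -> (4 * n * d.+1 <= t.+1)%N ->
  let M := (t.+1 ^ n)%N in let e0 := (M * (n * t.+1))%N in
  let e3 := (n * t * (M + e0) + (n * t * M).+1 * e0)%N in
  let S := (t.+1 ^ (3 * n + 5))%N in
  [/\ ((M + M).+1 * e0 <= S)%N, ((M + d * M).+1 * maxn e0 (d * (M + e0)) <= S)%N,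
      (M * e3 <= S)%N, (n * t.+1 <= S)%N &
      [/\ (d <= S)%N, (e0 + M <= S)%N & (M * (M * e3 + n * t) <= S * S)%N]].
Proof.
move=> n0 hb M e0 e3 S; set b := t.+1 in hb M e0 e3 S *.
have ES : S = (M ^ 3 * b ^ 5)%N by rewrite /S expnD mulnC [in RHS]mulnC /M -expnM (mulnC n).
have M0 : (0 < M)%N by rewrite expn_gt0.
have tb : (t <= b)%N by rewrite leqnSn.
have nb : (4 * n <= b)%N by apply: leq_trans hb; rewrite leq_pmulr.
have db : (4 * d.+1 <= b)%N by apply: leq_trans hb; rewrite -mulnA leq_mul2l leq_pmull.
clearbody b M S; subst S.
have b4 : (4 <= b)%N by apply: leq_trans db; rewrite leq_pmulr.
have b0 : (0 < b)%N by apply: leq_trans b4.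
have Mb i j k l : (i <= k)%N -> (j <= l)%N -> (M ^ i * b ^ j <= M ^ k * b ^ l)%N.
  by move=> ik jl; apply: leq_mul; rewrite leq_pexp2l.
have nb1 : (n * b + 1 <= b ^ 2)%N.
  have : (4 * n * b <= b * b)%N by rewrite leq_mul2r nb orbT.
  have : (0 < n * b)%N by rewrite muln_gt0 n0.
  by rewrite -mulnA mulnn; move: (n * b)%N (b ^ 2)%N; lia.
have nt1 : (n * t + 1 <= b ^ 2)%N.
  by apply: leq_trans nb1; rewrite leq_add2r leq_mul2l tb orbT.
have h1 : (e0 + M <= M * b ^ 2)%N.
  by apply: leq_trans (_ : M * (n * b + 1) <= _)%N; rewrite ?leq_mul2l ?nb1 ?orbT // mulnDr muln1.
have h0 : (e0 <= M * b ^ 2)%N by apply: leq_trans h1; apply: leq_addr.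
have h2 : (M * e3 <= M ^ 3 * b ^ 5)%N.
  rewrite expnS -mulnA leq_mul2l; apply/orP; right.
  have a1 : (n * t * (M + e0) <= M ^ 2 * b ^ 4)%N.
    apply: leq_trans (_ : b ^ 2 * (M * b ^ 2) <= _)%N.
      by apply: leq_mul; [apply: leq_trans nt1; apply: leq_addr|rewrite addnC].
    by rewrite mulnCA -expnD -[X in (X * _ <= _)%N]expn1; apply: Mb.
  have a2 : ((n * t * M).+1 * e0 <= M ^ 2 * b ^ 4)%N.
    apply: leq_trans (_ : (M * b ^ 2) * (M * b ^ 2) <= _)%N.
      apply: leq_mul => //; apply: leq_trans (_ : M * (n * t + 1) <= _)%N.
        by rewrite mulnDr muln1 mulnC -addn1 leq_add2l.
      by rewrite leq_mul2l nt1 orbT.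
    by rewrite mulnACA mulnn -expnD.
  apply: leq_trans (leq_add a1 a2) _; rewrite addnn -muln2 -mulnA leq_mul2l [(b ^ 5)%N]expnSr.
  by rewrite leq_mul2l (leq_trans _ b4) ?orbT.
have bS k : (k <= 5)%N -> (b ^ k <= M ^ 3 * b ^ 5)%N.
  by move=> k5; rewrite -[X in (X <= _)%N]mul1n; apply: (Mb 0%N).
split=> //.
- apply: leq_trans (_ : M * b * (M * b ^ 2) <= _)%N.
    apply: leq_mul => //; apply: leq_trans (_ : M * 4 <= _)%N; last by rewrite leq_mul2l b4 orbT.
    by move: (M) M0; lia.
  by rewrite mulnACA -expnS mulnn; apply: Mb.
- apply: leq_trans (_ : M * b * (M * b ^ 3) <= _)%N.
    apply: leq_mul.
      apply: leq_trans (_ : M * (4 * d.+1) <= _)%N; last by rewrite leq_mul2l db orbT.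
      have -> : (M * (4 * d.+1) = 4 * M + 4 * (d * M))%N by ring.
      by move: (d * M)%N (M) M0; lia.
    rewrite geq_max; apply/andP; split; first by apply: leq_trans h0 _; rewrite leq_mul2l leq_pexp2l ?orbT.
    rewrite expnS mulnCA; apply: leq_mul; last by rewrite addnC.
    by apply: leq_trans db; move: (d); lia.
  by rewrite mulnACA -expnS mulnn; apply: Mb.
- by apply: leq_trans (bS 2%N isT); apply: leq_trans nb1; apply: leq_addr.
split.
- by apply: leq_trans (bS 1%N isT); apply: leq_trans db; move: (d); lia.
- by apply: leq_trans h1 _; rewrite -[X in (X * _ <= _)%N]expn1; apply: Mb.
apply: leq_trans (_ : M * (b * (M ^ 3 * b ^ 5)) <= _)%N.
  rewrite leq_mul2l; apply/orP; right.
  apply: leq_trans (_ : 2 * (M ^ 3 * b ^ 5) <= _)%N; last by rewrite leq_mul2r (leq_trans _ b4) ?orbT.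
  rewrite mul2n -addnn leq_add //; apply: leq_trans (bS 2%N isT).
  by apply: leq_trans nt1; apply: leq_addr.
rewrite mulnA leq_mul2r; apply/orP; right.
by have := @Mb 1%N 1%N 3%N 5%N isT isT; rewrite !expn1.
Qed.

Lemma leq_exp2r_weak a b n : (a <= b -> a ^ n <= b ^ n)%N.
Proof. by case: n => // n; rewrite leq_exp2r. Qed.

(** Each elimination step from n+1 to n variables turns a + 2 into (a + 2)(n + 2), so the exponent
    obeys g_(n+1) = (n + 2)(g_n + 1). *)
Lemma hermann_bound_leq n m D a : (2 <= D)%N -> (m <= D ^ a)%N ->
  (hermann_bound n m D <= D ^ ((a + 2) * iteri n (fun k g => (k + 2) * (g + 1)) 0))%N.
Proof.
move=> D2; have D0 : (0 < D)%N by apply: leq_trans D2.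
elim: n m a => [|n IH] m a hm //=.
set g := iteri n _ 0%N; set W := ((m * D).+1 ^ n)%N.
have DD i j : (i <= j)%N -> (D ^ i <= D ^ j)%N by move=> ij; rewrite leq_pexp2l.
have D2X i j : (i < j)%N -> (2 * D ^ i <= D ^ j)%N.
  by move=> ij; apply: leq_trans (DD _ _ ij); rewrite expnS leq_mul2r D2 orbT.
have DDX i j k : (i < k)%N -> (j < k)%N -> (D ^ i + D ^ j <= D ^ k)%N.
  case: k => // k ik jk; apply: leq_trans (D2X k _ (ltnSn k)).
  by rewrite mul2n -addnn leq_add ?DD.
have hmD : (m * D <= D ^ a.+1)%N by rewrite expnSr leq_mul2r hm orbT.
have hW : (W <= D ^ ((a + 2) * n))%N.
  rewrite expnM; apply: leq_exp2r_weak.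
  apply: leq_trans (DDX a.+1 0%N (a + 2)%N _ _); first by rewrite addn1 ltnS.
    by rewrite addn2.
  by rewrite addn2.
have hN : (m * D * W <= D ^ (a.+1 + (a + 2) * n))%N by rewrite expnD leq_mul.
have hDW : (D * W <= D ^ (1 + (a + 2) * n))%N by rewrite expnD expn1 leq_mul.
have hm' : (m * (m * D * W + D * W) <= D ^ ((a + 2) * (n + 2) - 2))%N.
  apply: leq_trans (_ : D ^ a * D ^ (a + 2 + (a + 2) * n) <= _)%N.
    apply: leq_mul => //; apply: leq_trans (leq_add hN hDW) _; apply: DDX; lia.
  by rewrite -expnD; apply: DD; nia.
apply: leq_trans (_ : D ^ ((a + 2) * (n + 2) * g) * D ^ ((a + 2) * n) + D ^ (a.+1 + (a + 2) * n) <= _)%N.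
  apply: leq_add => //; apply: leq_mul => //.
  have := IH _ _ hm'; rewrite -/g subnK //; nia.
by rewrite -expnD; apply: DDX; nia.
Qed.

Lemma hermann_exponent_leq n : (iteri n (fun k g => (k + 2) * (g + 1)) 0 <= 2 ^ (n ^ 2))%N.
Proof.
elim: n => [//|[//|n] IH]; rewrite [iteri _ _ _]/=; set g := iteri n _ _ in IH *.
apply: leq_trans (_ : 2 ^ n.+2 * (2 ^ (n.+1 ^ 2) + 1) <= _)%N.
  apply: leq_mul; last by rewrite leq_add2r.
  by have := ltn_expl n (ltnSn 1); rewrite !expnS; lia.
have -> : (n.+2 ^ 2 = n.+2 + (n.+1 ^ 2 + n.+1))%N by rewrite -!mulnn; lia.
rewrite expnD leq_mul2l; apply/orP; right; rewrite expnD.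
have : (2 <= 2 ^ n.+1)%N by rewrite expnS leq_pmulr ?expn_gt0.
have : (1 <= 2 ^ (n.+1 ^ 2))%N by rewrite expn_gt0.
by nia.
Qed.

(** * Thresholds *)

Definition var_embed (K : fieldType) n r (s : 'I_r -> 'I_n) :
    {rmorphism {mpoly K[r]} -> {mpoly K[n]}} :=
  [the {rmorphism _ -> _} of mmap (@mpolyC n K) (fun j => 'X_(s j))].

Section Thresholds.
Variables (K : fieldType) (n : nat).

Lemma var_embedC r (s : 'I_r -> 'I_n) c : var_embed K s c%:MP = c%:MP.
Proof. exact: mmap_mpolyC. Qed.

Lemma var_embedX r (s : 'I_r -> 'I_n) j : var_embed K s 'X_j = 'X_(s j).
Proof. exact: mmap_mpolyU. Qed.

(** The new variable comes last, where [muni] makes it the main variable. *)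
Definition extend_vars r (s : 'I_r -> 'I_n) i (k : 'I_r.+1) : 'I_n :=
  if unlift ord_max k is Some j then s j else i.

Lemma muni_ord_max r : muni ('X_ord_max : {mpoly K[r.+1]}) = 'X.
Proof. rewrite /muni mmap_mpolyU; case: splitP => //.
by case=> j lj /eqP /=; have := lj; rewrite ltn_neqAle eq_sym => /andP[/negbTE->]. Qed.

Lemma mdeg_rcons r (m : 'X_{1..r}) k : mdeg (mnm_rcons m k) = (mdeg m + k)%N.
Proof.
rewrite !mdegE big_ord_recr /= mnm_rcons_max; congr (_ + _)%N.
by apply: eq_bigr => j _; rewrite mnm_rcons_widen.
Qed.

Lemma tdeg_muni r (c : {mpoly K[r.+1]}) b : tdeg_le c b ->
  (forall k, tdeg_le (muni c)`_k b) /\ (size (muni c) <= b.+1)%N.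
Proof.
move=> dc; split=> [k|].
  rewrite /tdeg_le msizeE; apply/bigmax_leqP_seq => m mc _; rewrite ltnS leqNgt; apply/negP => lm.
  move: mc; rewrite mcoeff_msupp coef_muni => /eqP[].
  apply/memN_msupp_eq0/msize_mdeg_ge/(leq_trans dc)/(leq_trans lm).
  by rewrite mdeg_rcons leq_addr.
apply/leq_sizeP => k lk; apply/mpolyP=> m; rewrite coef_muni mcoeff0.
apply/memN_msupp_eq0/msize_mdeg_ge/(leq_trans dc)/(leq_trans lk).
by rewrite mdeg_rcons leq_addl.
Qed.

Lemma horner_muni r (s : 'I_r -> 'I_n) i c :
  (map_poly (var_embed K s) (muni c)).['X_i] = var_embed K (extend_vars s i) c.
Proof.
pose f := [the {rmorphism _ -> _} of horner_eval 'X_i \o map_poly (var_embed K s) \o @muni r K].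
apply: (mpoly_hom_ext (f := f)) => [a|k] /=.
  rewrite muniC map_polyC /horner_eval hornerC /= mmap_mpolyC; exact/esym/mmap_mpolyC.
have -> : mmap (@mpolyC n K) (fun j => 'X_(extend_vars s i j)) 'X_k =
   'X_(extend_vars s i k) by apply: mmap_mpolyU.
rewrite /extend_vars; case: unliftP => [j ->|->]; last first.
  by rewrite muni_ord_max map_polyX /horner_eval hornerX.
have -> : muni ('X_(lift ord_max j) : {mpoly K[r.+1]}) = ('X_j)%:P.
  rewrite /muni mmap_mpolyU; case: splitP => [l E|l].
    by congr ('X__)%:P; apply: val_inj; rewrite /= -E /= /bump leqNgt ltn_ord.
  rewrite ord1 /= /bump leqNgt ltn_ord addn0 => /eqP.
  by rewrite /= add0n ltn_eqF.
rewrite map_polyC /horner_eval hornerC; exact: mmap_mpolyU.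
Qed.

Variables (L : {mpoly K[n]} -> Prop) (d : nat).
Local Notation I := (ideal_gen L).

(* Independence up to [threshold k.+1], paired with relations of degree at most
   [threshold k], leaves room for every degree bound of [bounded_primality]. *)
Definition threshold k := ((4 * n * d.+1) ^ ((3 * n + 5) ^ k))%N.

(** The exponent is that of [threshold_bounds]: a threshold dominates the degrees required for
    independence when relations are bounded by the previous one. *)
Lemma thresholdS k : threshold k.+1 = (threshold k ^ (3 * n + 5))%N.
Proof. by rewrite /threshold expnSr expnM. Qed.

Hypothesis n0 : (0 < n)%N.

Lemma threshold_ge k : (4 * n * d.+1 <= threshold k)%N.
Proof.
rewrite -[X in (X <= _)%N]expn1 leq_pexp2l ?expn_gt0 ?muln_gt0 ?n0 //.
by rewrite addn_gt0 orbT.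
Qed.

Lemma threshold_gt0 k : (0 < threshold k)%N.
Proof. by apply: leq_trans (threshold_ge k); rewrite !muln_gt0 n0. Qed.

Lemma threshold_mono k l : (k <= l)%N -> (threshold k <= threshold l)%N.
Proof.
move=> kl; rewrite leq_pexp2l ?muln_gt0 ?n0 // leq_pexp2l //.
by rewrite addn_gt0 orbT.
Qed.

Definition independent T r (s : 'I_r -> 'I_n) :=
  forall c, tdeg_le c T -> I (var_embed K s c) -> c = 0.

Hypothesis I1 : ~ I 1.

Lemma independent_inj T r (s : 'I_r -> 'I_n) : (0 < T)%N -> independent T s -> injective s.
Proof.
move=> T0 ind i j sij; apply: NNPP => nij.
have : ('X_i - 'X_j : {mpoly K[r]}) = 0.
  apply: ind; last by rewrite rmorphB /= !mmap_mpolyU sij subrr; apply: id0 (ideal_gen_ideal L).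
  apply: (dleW (w := msize_fun K r) T0); apply: dleB; exact: dle_msizeX.
move/eqP; rewrite subr_eq0 => /eqP/(congr1 (fun c => c@_U_(i))).
rewrite !mcoeffXU eqxx; case: eqP => [/esym//|_ /eqP]; by rewrite oner_eq0.
Qed.

Lemma independent0 T (s : 'I_0 -> 'I_n) : independent T s.
Proof.
move=> c _; have [a ->] : exists a, c = a%:MP.
  exists c@_0%MM; apply/mpolyP=> m; rewrite mcoeffC.
  have -> : m = 0%MM by apply/mnmP=> -[].
  by rewrite eqxx mulr1.
rewrite var_embedC => Ia; apply: NNPP => na; apply: I1.
have a0 : a != 0 by apply: contra_notN na => /eqP->; rewrite mpolyC0.
by rewrite -(mpolyC1 n K) -(mulVf a0) mpolyCM; apply: (idM (ideal_gen_ideal L)).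
Qed.

Lemma algebraic_relation T b r (s : 'I_r -> 'I_n) i : (b <= T)%N -> independent T s ->
  ~ independent b (extend_vars s i) -> exists G : {poly {mpoly K[r]}},
  [/\ size G = b.+1, forall k, tdeg_le G`_k b & I ((map_poly (var_embed K s) G).['X_i])].
Proof.
move=> bT ind nind; have [c [dc Ic c0]] : exists c, [/\ tdeg_le c b,
    I (var_embed K (extend_vars s i) c) & c != 0].
  apply: NNPP => h; apply: nind => c dc Ic; apply: NNPP => /eqP c0; apply: h.
  by exists c.
rewrite -horner_muni in Ic; have [dG sG] := tdeg_muni dc.
have G0 : muni c != 0.
  by apply: contra_neq c0 => E; apply: (@muni_inj r K); rewrite E muni0.
(* Padding by a power of X gives the relations of all variables the same size, as a common box
   requires. *)
exists ('X^(b.+1 - size (muni c)) * muni c); split=> [|k|].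
- by rewrite size_monicM ?monicXn // size_polyXn /= addnC subnKC.
- rewrite coefXnM; case: ifP => _; last exact: dG.
  by rewrite /tdeg_le msize0.
by rewrite rmorphM hornerM; apply: (idM (ideal_gen_ideal L)).
Qed.

Variable B : nat.
Hypothesis dL : forall f, L f -> tdeg_le f d.
Hypothesis prI : prime_upto I B.
Hypothesis hB1 : (threshold n.+1 * threshold n.+1 <= B)%N.
Hypothesis hB2 : (hermann_bound n 1 (threshold n.+1) <= B)%N.

(** Longer families are asked for independence at lower thresholds. A family of maximal length r is
    independent at level n+1-r, and adjoining any variable fails at level n-r; independent variables
    are distinct, so r is at most n and these levels are consecutive. *)
Lemma prime_up_to_threshold : prime_ideal I.
Proof.
pose ok r := (r <= n.+1)%N /\ exists s : 'I_r -> 'I_n, independent (threshold (n.+1 - r)) s.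
have ok0 : ok 0%N by split=> //; exists (fun=> Ordinal n0); apply: independent0.
have [r [[rn [s ind]] maxr]] : exists r, ok r /\ ~ ok r.+1.
  apply: NNPP => h; have okr r : ok r.
    by elim: r => // r IH; apply: NNPP => nr; apply: h; exists r.
  by have [] := okr n.+2; rewrite ltnn.
have s_inj := independent_inj (threshold_gt0 _) ind.
have {}rn : (r <= n)%N by have := leq_card _ s_inj; rewrite !card_ord.
set k := (n - r)%N; have Ek : (n.+1 - r = k.+1)%N by rewrite subSn.
rewrite Ek in ind; pose b := threshold k.
have rel i : exists G : {poly {mpoly K[r]}},
    [/\ size G = b.+1, forall k, tdeg_le G`_k b & I ((map_poly (var_embed K s) G).['X_i])].
  apply: algebraic_relation ind _; first exact: threshold_mono.
  move=> h; apply: maxr; split; first by rewrite ltnS.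
  by exists (extend_vars s i); rewrite subSS.
have [G HG] := fin_all_exists rel.
pose t := b.-1; have Et : t.+1 = b by rewrite prednK ?threshold_gt0.
have hb : (4 * n * d.+1 <= t.+1)%N by rewrite Et; apply: threshold_ge.
have [h1 h2 h3 h4 [h5 h6 h7]] := threshold_bounds n0 hb.
have ET : (t.+1 ^ (3 * n + 5) = threshold k.+1)%N by rewrite thresholdS Et.
rewrite ET in h1 h2 h3 h4 h5 h6 h7.
have TD : (threshold k.+1 <= threshold n.+1)%N by apply: threshold_mono; rewrite ltnS leq_subr.
have h8 : (threshold n.+1 <= B)%N by apply: leq_trans hB1; rewrite leq_pmulr ?threshold_gt0.
apply: (bounded_primality (var_embedC s) (var_embedX s) n0 s_inj dL (G := G) (t := t) (B := B)
  (T := threshold k.+1) (D := threshold n.+1)) => //.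
- by move=> i; have [-> _ _] := HG i; rewrite Et.
- by move=> i j; have [_ + _] := HG i; rewrite Et; apply.
- by move=> i; have [] := HG i.
- exact: leq_trans TD.
- exact: leq_trans TD.
- exact: leq_trans TD.
- exact: leq_trans TD.
- by apply: leq_trans hB1; apply: leq_trans h7 _; apply: leq_mul.
Qed.

End Thresholds.

(** * Lower bounds for p_n(d) *)

(** The exponent 2^(n^2+1) bounds the one in Hermann's bound for a single equation (a = 0) and also
    covers the square required of [B]. *)
Lemma threshold_exp2 n d : (0 < n)%N ->
  (threshold n d n.+1 ^ (2 * 2 ^ (n ^ 2)) <= 2 ^ ((n + d + 2) * 2 ^ (2 * n ^ 2 + 3 * n + 3)))%N.
Proof.
move=> n0; rewrite /threshold -expnM.
have h1 : (4 * n * d.+1 <= 2 ^ (n + d + 2))%N.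
  have a1 := ltn_expl n (ltnSn 1); have a2 := ltn_expl d (ltnSn 1).
  have -> : (2 ^ (n + d + 2) = 4 * 2 ^ n * 2 ^ d)%N by rewrite !expnD mulnC mulnA.
  by apply: leq_mul => //; apply: leq_mul => //; apply: ltnW.
have h2 : (3 * n + 5 <= 2 ^ (n + 2))%N.
  elim: n n0 {h1} => // -[|n] // IH _; have := IH isT.
  by rewrite (expnS 2 (n.+1 + 2)); lia.
apply: leq_trans (leq_exp2r_weak _ h1) _; rewrite -expnM leq_exp2l // leq_mul2l.
apply/orP; right.
apply: leq_trans (_ : (2 ^ (n + 2)) ^ n.+1 * (2 * 2 ^ (n ^ 2)) <= _)%N.
  by rewrite leq_mul2r leq_exp2r ?h2 ?orbT.
rewrite -expnM -expnS -expnD leq_exp2l // -mulnn; nia.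
Qed.

Lemma zeta2_geq n d b : (15 <= zeta1 n d b)%N -> (2 ^ (2 ^ (zeta1 n d b).+1) <= zeta2 n d b)%N.
Proof.
rewrite /zeta2; move: (zeta1 n d b) => z hz.
apply: leq_trans (_ : (2 ^ 4) ^ (2 ^ z - 1) <= _)%N; last by apply: leq_exp2r_weak; lia.
rewrite -expnM leq_exp2l // expnS.
have : (2 ^ 1 <= 2 ^ z)%N by rewrite leq_exp2l //; lia.
lia.
Qed.

Lemma zeta1_geq n p d : (0 < n)%N -> ((d + 3) * ((2 * p) ^ (2 ^ n)).+1 <= zeta1 n p d)%N.
Proof.
have binS a k : (0 < k)%N -> (a.+1 <= 'C(a + k, k))%N.
  case: k => // k _; rewrite addnC; elim: k => [|k IH]; first by rewrite bin1.
  by rewrite addSn binS; apply: leq_trans IH _; apply: leq_addl.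
move=> n0; rewrite /zeta1; apply: leq_mul; first by have := binS d n n0; move: 'C(_, _) => c; lia.
by rewrite /zeta0 addnC binS.
Qed.

Lemma frakp_geq n d : (zeta2 n.+1 (frakp n.+1 d) d <= frakp n.+2 d)%N.
Proof.
have E : frakp n.+2 d = maxn (2 * 'C(zeta1 n.+1 (frakp n.+1 d) d * zeta2 n.+1 (frakp n.+1 d) d + n.+2, n.+2)
  * (zeta1 n.+1 (frakp n.+1 d) d * zeta2 n.+1 (frakp n.+1 d) d)) (frake n.+1 d) by [].
rewrite E; apply: leq_trans (leq_maxl _ _).
have z1 : (0 < zeta1 n.+1 (frakp n.+1 d) d)%N.
  by apply: leq_trans (zeta1_geq _ _ (ltn0Sn n)); rewrite muln_gt0 addn_gt0 orbT.
apply: leq_trans (_ : zeta1 n.+1 (frakp n.+1 d) d * zeta2 n.+1 (frakp n.+1 d) d <= _)%N.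
  exact: leq_pmull.
by apply: leq_pmull; rewrite muln_gt0 bin_gt0 leq_addl.
Qed.

(** In the inductive step zeta1 is at least twice the previous value of p, so zeta2 exponentiates
    that value twice, whereas one more variable changes the required double exponent only by a
    polynomial amount. *)
Lemma frakp_exp2 n d : (0 < d)%N ->
  (2 ^ ((n.+2 + d + 2) * 2 ^ (2 * n.+2 ^ 2 + 3 * n.+2 + 3)) <= frakp n.+2 d)%N.
Proof.
move=> d0; elim: n => [|n IH]; apply: leq_trans (frakp_geq _ _).
  have z : (5 * (d + 3) <= zeta1 1 (frakp 1 d) d)%N.
    apply: leq_trans (zeta1_geq _ _ _) => //; rewrite mulnC leq_mul2l; apply/orP; right.
    by rewrite ltnS expn1 expnMn leq_pmulr // expn_gt0 d0.
  apply: leq_trans (zeta2_geq _); last by lia.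
  rewrite leq_exp2l //; apply: leq_trans (_ : 2 ^ (2 + d) * 2 ^ (2 * 2 ^ 2 + 3 * 2 + 3) <= _)%N.
    rewrite leq_mul2r; apply/orP; right; rewrite expnD.
    by have := ltn_expl d (ltnSn 1); lia.
  (* For two variables the claim comes down to d + 19 <= 5 (d + 3) + 1, where d > 0 enters. *)
  by rewrite -expnD leq_exp2l //; move: z; rewrite -[(2 * 2 ^ 2 + 3 * 2 + 3)%N]/17%N; lia.
set p := frakp n.+2 d in IH *; set X := (_ * _)%N in IH.
have z : (2 * p <= zeta1 n.+2 p d)%N.
  apply: leq_trans (zeta1_geq _ _ _) => //.
  apply: leq_trans (_ : ((2 * p) ^ (2 ^ n.+2)).+1 <= _)%N; last by rewrite leq_pmull // addn_gt0 orbT.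
  apply: leqW; have [->//|p0] := posnP p.
  by rewrite -[X in (X <= _)%N]expn1 leq_pexp2l ?expn_gt0 ?muln_gt0 ?p0.
have hX : (X <= p)%N by apply: leq_trans IH; apply/ltnW/ltn_expl.
have hX2 : ((n.+2 + d + 2) * (2 * n.+2 ^ 2 + 3 * n.+2 + 3).+1 <= X)%N.
  by rewrite leq_mul2l ltn_expl // orbT.
have z15 : (15 <= zeta1 n.+2 p d)%N.
  apply: leq_trans z; apply: leq_trans (leq_mul (leqnn 2) (leq_trans hX2 hX)); nia.
apply: leq_trans (zeta2_geq z15); rewrite leq_exp2l //.
apply: leq_trans (_ : 2 ^ (n.+3 + d + 2) * 2 ^ (2 * n.+3 ^ 2 + 3 * n.+3 + 3) <= _)%N.
  by rewrite leq_mul2r ltnW ?orbT // ltn_expl.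
rewrite -expnD leq_exp2l //; apply: leq_trans (leqnSn _); apply: leq_trans z.
apply: leq_trans (leq_mul (leqnn 2) (leq_trans hX2 hX)).
by clear; nia.
Qed.

(** * Degenerate and univariate cases *)

Lemma prime_ideal_unit (R : comNzRingType) n (I : {mpoly R[n]} -> Prop) :
  is_ideal I -> I 1 -> prime_ideal I.
Proof. by move=> idI I1 f g _; left; rewrite -[f]mulr1; apply: (idM idI). Qed.

Lemma prime_ideal_gen0 (R : idomainType) n (L : {mpoly R[n]} -> Prop) :
  (forall f, L f -> f = 0) -> prime_ideal (ideal_gen L).
Proof.
move=> L0 f g; have I0 h : ideal_gen L h -> h = 0.
  apply: ideal_gen_sub L0 h; split=> // [h h' -> ->|h h' ->]; by rewrite ?addr0 ?mulr0.
move/I0/eqP; rewrite mulf_eq0 => /orP[]/eqP->; [left|right]; exact: id0 (ideal_gen_ideal L).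
Qed.

Lemma prime_ideal_const (K : fieldType) n (L : {mpoly K[n]} -> Prop) :
  (forall f, L f -> tdeg_le f 0) -> prime_ideal (ideal_gen L).
Proof.
move=> dL; have idI := ideal_gen_ideal L.
have [[f [Lf f0]]|nL] := classic (exists f, L f /\ f != 0); last first.
  by apply: prime_ideal_gen0 => f Lf; apply: NNPP => /eqP f0; apply: nL; exists f.
have [a ef] : exists a, f = a%:MP by have /msize1_polyC E := dL f Lf; exists f@_0%MM.
apply: prime_ideal_unit => //; rewrite -(mpolyC1 n K).
have a0 : a != 0 by apply: contra_neq f0 => a0; rewrite ef a0 mpolyC0.
by rewrite -(mulVf a0) mpolyCM -ef; apply: (idM idI); apply: ideal_gen_mem.
Qed.

Import Pdiv.Field.

(** K[X] is principal: let Q, of degree at most d, generate the ideal and let A = gcd(Q, F). Bounded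
    primality applied to Q = (Q/A) A either gives Q | F or makes A constant, and then Q divides
    G. *)
Lemma prime_up_to_univariate (K : fieldType) d (L : {mpoly K[1]} -> Prop) :
  (forall f, L f -> tdeg_le f d) -> prime_upto (ideal_gen L) d ->
  prime_ideal (ideal_gen L).
Proof.
move=> dL prI; have idI := ideal_gen_ideal L.
have [[l [Ll l0]]|nL] := classic (exists f, L f /\ f != 0); last first.
  by apply: prime_ideal_gen0 => f Lf; apply: NNPP => /eqP f0; apply: nL; exists f.
pose phi := [the {rmorphism {poly K} -> {mpoly K[1]}} of
  horner_eval ('X_ord0) \o map_poly (@mpolyC 1 K)].
have phi_surj k f : tdeg_le f k -> exists P : {poly K}, (size P <= k.+1)%N /\ phi P = f.
  move: k f; apply: tdeg_le_ind.
  - move=> k _ _ [P [sP <-]] [Q [sQ <-]]; exists (P + Q); split; last exact: rmorphD.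
    by apply: leq_trans (size_polyD _ _) _; rewrite geq_max sP.
  - move=> k j _ _ [P [sP <-]] [Q [sQ <-]]; exists (P * Q); split; last exact: rmorphM.
    by apply: leq_trans (size_polyMleq _ _) _; lia.
  - move=> i; exists 'X; rewrite size_polyX; split=> //.
    by rewrite /= map_polyX /horner_eval hornerX [i]ord1 [ord0]ord1.
  - move=> c; exists c%:P; rewrite size_polyC leq_b1; split=> //.
    by rewrite /= map_polyC /horner_eval hornerC.
  - by move=> k f [P [sP <-]]; exists P; split=> //; apply: leqW.
have dphi k (P : {poly K}) : (size P <= k.+1)%N -> tdeg_le (phi P) k.
  move=> sP; rewrite /= /horner_eval horner_coef.
  apply: (dle_sum (w := msize_fun K 1)) => i _; rewrite -[k]add0n; apply: dleM.
    by rewrite coef_map; apply: dle_msizeC.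
  apply: (@dleW _ _ (1 * i)); last by apply: dleX; apply: dle_msizeX.
  rewrite mul1n -ltnS; apply: leq_trans sP; apply: leq_trans (ltn_ord i) (size_poly _ _).
pose I P := ideal_gen L (phi P).
have [P0 [sP0 EP0]] := phi_surj d l (dL l Ll).
have IP0 : I P0 by rewrite /I EP0; apply: ideal_gen_mem.
have P00 : P0 != 0 by apply: contra_neq l0 => E; rewrite -EP0 E rmorph0.
have [|k [Q [IQ Q0 sQk]] Qmin] := @classic_min (fun k => exists Q, [/\ I Q, Q != 0 & size Q = k]).
  by exists (size P0), P0.
have {}Qmin C : I C -> C != 0 -> (size Q <= size C)%N.
  by move=> IC C0; rewrite sQk leqNgt; apply/negP => /Qmin[]; exists C.
have sQ : (size Q <= d.+1)%N by apply: leq_trans sP0; apply: Qmin.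
have IE P : I P <-> Q %| P.
  split=> [IP|/dvdpP[C ->]]; last by rewrite /I rmorphM; apply: (idM idI).
  rewrite /dvdp; apply: NNPP => /negP r0.
  have : (size Q <= size (P %% Q)%R)%N.
    apply: Qmin => //.
    have -> : P %% Q = P - P %/ Q * Q by rewrite {2}(divp_eq P Q) addrC addKr.
    by rewrite /I rmorphB rmorphM; apply: (idB idI) => //; apply: (idM idI).
  by rewrite leqNgt ltn_modp Q0.
move=> f g; have [F [_ <-]] := phi_surj _ f (leqnSn _); have [G [_ <-]] := phi_surj _ g (leqnSn _).
rewrite -rmorphM -!/(I _) !IE => QFG.
pose A := gcdp Q F; have AQ : A %| Q by apply: dvdp_gcdl.
have A0 : A != 0 by rewrite gcdp_eq0 (negPf Q0).
have EQ : Q = Q %/ A * A by rewrite divpK.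
have C0 : Q %/ A != 0 by apply: contra_neq Q0 => C0; rewrite EQ C0 mul0r.
have [|||IC|IA] := prI (phi (Q %/ A)) (phi A).
- by apply: dphi; apply: leq_trans sQ; apply: dvdp_leq => //; rewrite {2}EQ dvdp_mulr.
- by apply: dphi; apply: leq_trans sQ; apply: dvdp_leq.
- by rewrite -rmorphM -EQ.
- right; have cQF : coprimep Q F.
    have : (size Q <= size (Q %/ A)%R)%N by apply: dvdp_leq => //; apply/IE.
    rewrite /coprimep -/A {1}EQ size_mul //.
    have : (0 < size A)%N by rewrite size_poly_gt0.
    have : (0 < size (Q %/ A)%R)%N by rewrite size_poly_gt0.
    by move: (size A) (size (Q %/ A)); lia.
  by rewrite -(Gauss_dvdpr _ cQF).
by left; apply: dvdp_trans (dvdp_gcdr Q F); apply/IE.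
Qed.

Theorem theorem2p20 (K : fieldType) (n d : nat) (hn : (1 <= n)%N)
    (Lambda : {mpoly K[n]} -> Prop)
    (hLambda : forall f : {mpoly K[n]}, Lambda f -> tdeg_le f d)
    (hprime : prime_upto (ideal_gen Lambda) (frakp n d)) :
  prime_ideal (ideal_gen Lambda).
Proof.
have [I1|I1] := classic (ideal_gen Lambda 1).
  exact: prime_ideal_unit (ideal_gen_ideal _) I1.
(* For d = 0 the generators are constants; the lower bound [frakp_exp2] is for positive d. *)
case: d hLambda hprime => [dL _|d dL]; first exact: prime_ideal_const.
case: n hn Lambda dL I1 => [//|[_ L dL _|n _ L dL I1 prI]].
  exact: prime_up_to_univariate.
have D2 : (2 <= threshold n.+2 d.+1 n.+3)%N.
  by apply: leq_trans (threshold_ge _ _ _) => //; lia.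
have D0 : (0 < threshold n.+2 d.+1 n.+3)%N by apply: leq_trans D2.
have h := leq_trans (threshold_exp2 d.+1 (ltn0Sn n.+1)) (frakp_exp2 n (ltn0Sn d)).
apply: (prime_up_to_threshold (ltn0Sn n.+1) I1 dL prI); apply: leq_trans h.
  by rewrite mulnn leq_exp2l // leq_pmulr // expn_gt0.
apply: leq_trans (hermann_bound_leq n.+2 D2 (a := 0) _) _; first by rewrite expn0.
by rewrite leq_exp2l // leq_mul2l hermann_exponent_leq.
Qed.
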